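(* Let $n\ge1$, $1\le k\le n$, and let $\Omega\subset\mathbb{R}^{n+1}$ be a bounded convex domain whose boundary $\Sigma=\partial\Omega$ is a smooth closed strictly convex hypersurface. Suppose that $0$ is the center of the circumscribed sphere of $\Sigma$ and let $r$ denote the circumradius. Then: (i) For $0\le m<1$, $$\left(\frac{I_k}{I_{k-1}}\right)^{1-m}\frac{I_{k-1}^2-I_kI_{k-2}}{I_k}+\frac{m+1}{2r^{1-m}}\,\delta_{2,k}\left(\Omega,B_0\left(\frac{I_{k-1}}{I_k}\right)\right)^2+\frac{1-m}{2r^{2-m}}\,\delta_{2,k-1}\left(\Omega,B_0\left(\frac{I_{k-2}}{I_{k-1}}\right)\right)^2\le\frac{1}{k\binom{n}{k}}\int_\Sigma\frac{T_{k-1}\circ A(X^T,X^T)}{u^{1-m}}\,d\mu .$$ Equality holds if and only if $\Sigma$ is a sphere centered at $0$. (ii) For $0\le m\le1$, $$\left(\frac{I_{k-2}}{I_{k-1}}\right)^{1-m}\frac{I_{k-1}^2-I_kI_{k-2}}{I_{k-2}}+\frac{1-m}{2r^{m+1}}\,\delta_{2,k}\left(\Omega,B_0\left(\frac{I_{k-1}}{I_k}\right)\right)^2+\frac{m+1}{2r^{m+2}}\,\delta_{2,k-1}\left(\Omega,B_0\left(\frac{I_{k-2}}{I_{k-1}}\right)\right)^2\le\frac{1}{k\binom{n}{k}}\int_\Sigma\frac{T_{k-1}\circ A(X^T,X^T)}{u^{m+1}}\,d\mu .$$ Equality holds if and only if $\Sigma$ is a sphere centered at $0$.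
   Context: Strictly convex means that all principal curvatures of $\Sigma$ are positive. $X$ is the position vector, $\nu$ the outward unit normal of $\Sigma$, $X^T$ the component of $X$ tangential to $\Sigma$, $u=\langle X,\nu\rangle$ the support function, $d\mu$ the induced area measure. The circumscribed sphere is the smallest sphere enclosing $\Sigma$, and its radius is the circumradius. $A$ is the shape operator with respect to $\nu$ (positive for round spheres), with eigenvalues the principal curvatures $\kappa_1,\dots,\kappa_n$. $H_j=\binom{n}{j}^{-1}\sigma_j(\kappa)$ with $\sigma_j$ the $j$-th elementary symmetric polynomial ($H_0=1$). $I_{-1}=(n+1)|\Omega|$ and $I_j=\int_\Sigma H_j\,d\mu$ for $0\le j\le n$. The Newton tensors are $T_0=\mathrm{Id}$, $T_j=\sigma_j(\kappa)\,\mathrm{Id}-A\circ T_{j-1}$, and $T_{k-1}\circ A(Y,Y)=\langle T_{k-1}(A(Y)),Y\rangle$. $B_0(s)$ is the ball of radius $s$ centered at the origin, and $\delta_{2,j}(\Omega,B_0(s))=\left(\int_\Sigma(u-s)^2H_j\,d\mu\right)^{1/2}$. *)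

(* Defs.v *)
(* MathComp and MathComp-Analysis; points of R^n are row vectors, linear maps
   act on the right, as in the library's jacobian. *)
From HB Require Import structures.
From mathcomp Require Import all_boot all_order all_algebra.
From mathcomp Require Import all_classical all_reals all_analysis.

Set Implicit Arguments.
Unset Strict Implicit.
Unset Printing Implicit Defensive.

Import Order.TTheory GRing.Theory Num.Theory.
Import numFieldNormedType.Exports.

Local Open Scope classical_set_scope.
Local Open Scope ring_scope.

Section EuclideanSpace.
Context {R : realType}.

Definition dot d (v w : 'rV[R]_d) : R := (v *m w^T) 0 0.

(* The library norm on matrices is the sup norm, hence this definition. *)
Definition enorm d (v : 'rV[R]_d) : R := Num.sqrt (dot v v).

Definition borel d := g_sigma_algebraType (@open 'rV[R]_d).

(* Lebesgue integral over R^d of a nonnegative Borel function, as an iterated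
   integral (Tonelli). *)
Fixpoint lebesgue_int d : ('rV[R]_d -> \bar R) -> \bar R :=
  match d with
  | 0 => fun f => f 0
  | d'.+1 => fun f => (\int[@lebesgue_measure R]_x
      lebesgue_int (fun y : 'rV[R]_d' => f (row_mx (x%:M : 'rV[R]_1) y)))%E
  end.

Definition volume d (A : set 'rV[R]_d) : R :=
  fine (lebesgue_int (fun x => (\1_A x)%:E)).

Fixpoint Ck (k : nat) d e (U : set 'rV[R]_d) (f : 'rV[R]_d -> 'rV[R]_e) : Prop :=
  match k with
  | 0 => forall x, U x -> {for x, continuous f}
  | k'.+1 => (forall x, U x -> differentiable f x) /\
             (forall i : 'I_d, Ck k' U ('D_(delta_mx 0 i) f))
  end.

Definition smooth_on d e (U : set 'rV[R]_d) (f : 'rV[R]_d -> 'rV[R]_e) : Prop :=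
  forall k, Ck k U f.

End EuclideanSpace.

Section Hypersurface.
Context {R : realType} {n : nat}.
Implicit Types (S Omega : set 'rV[R]_n.+1) (p v : 'rV[R]_n.+1).

(* phi : U -> S is a smooth injective immersion and a homeomorphism onto a
   relatively open part of S (the last clause: phi is open as a map into S). *)
Definition local_param S (U : set 'rV[R]_n) (phi : 'rV[R]_n -> 'rV[R]_n.+1) :=
  [/\ open U, smooth_on U phi,
      {in U &, injective phi},
      (forall x, U x -> \rank ('J phi x) = n) &
      (forall W, open W -> W `<=` U ->
         exists2 V, open V & phi @` W = V `&` S)].

Definition smooth_hypersurface S : Prop :=
  forall p, S p -> exists U phi, local_param S U phi /\ (phi @` U) p.

(* The induced area measure of S, as a Borel measure on R^{n+1} carried by S:
   in every local parametrization its density is sqrt (det (g_ij)), with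
   g_ij = <d_i phi, d_j phi>.  As S is covered by countably many local
   parametrizations, this determines the measure. *)
Definition is_area_measure S
    (mu : {measure set (@borel R n.+1) -> \bar R}) : Prop :=
  mu (~` S) = 0%E /\
  forall U phi (E : set 'rV[R]_n),
    local_param S U phi -> measurable (E : set (@borel R n)) -> E `<=` U ->
    mu (phi @` E) = lebesgue_int (fun x =>
      (\1_E x * Num.sqrt (\det ('J phi x *m ('J phi x)^T)))%:E).

Definition curve_in S p (gamma : R -> 'rV[R]_n.+1) v : Prop :=
  [/\ gamma 0 = p, (\forall t \near (0 : R), S (gamma t)) &
      is_derive (0 : R) 1 gamma v].

Definition tangent S p v : Prop := exists gamma, curve_in S p gamma v.

Definition boundary Omega := closure Omega `\` interior Omega.

Definition is_outward_normal Omega p v : Prop :=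
  [/\ enorm v = 1, (forall w, tangent (boundary Omega) p w -> dot v w = 0) &
      (\forall t \near (0 : R)^'+, ~ closure Omega (p + t *: v))].

Definition normal Omega p : 'rV[R]_n.+1 :=
  xget 0 [set v | is_outward_normal Omega p v].

(* The shape operator is the differential of the unit normal along the
   hypersurface, an endomorphism of the tangent space.  It is represented by a
   matrix of the ambient space, extended by 0 on the normal line. *)
Definition is_shape_operator Omega p (A : 'M[R]_n.+1) : Prop :=
  (forall gamma v, curve_in (boundary Omega) p gamma v ->
     is_derive (0 : R) 1 (normal Omega \o gamma) (v *m A)) /\
  normal Omega p *m A = 0.

Definition shape Omega p : 'M[R]_n.+1 :=
  xget 0 [set A | is_shape_operator Omega p A].

(* Eigenvalues, with multiplicity, of the shape operator on the tangent space;
   the factor 'X accounts for the extension by 0 to the normal line. *)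
Definition is_principal_curvatures Omega p (kappa : 'rV[R]_n) : Prop :=
  char_poly (shape Omega p) = 'X * \prod_(i < n) ('X - (kappa 0 i)%:P).

(* The order of the curvatures is arbitrary. *)
Definition curvatures Omega p : 'rV[R]_n :=
  xget 0 [set kappa | is_principal_curvatures Omega p kappa].

Definition strictly_convex Omega : Prop :=
  forall p, boundary Omega p -> forall i, 0 < curvatures Omega p 0 i.

Definition sigma (j : nat) (kappa : 'rV[R]_n) : R :=
  \sum_(J : {set 'I_n} | #|J| == j) \prod_(i in J) kappa 0 i.

Definition Hmean (j : nat) Omega p : R := sigma j (curvatures Omega p) / 'C(n, j)%:R.

Definition support Omega p : R := dot p (normal Omega p).

Definition tangential_part Omega p : 'rV[R]_n.+1 :=
  p - support Omega p *: normal Omega p.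

(* T_j = sigma_j Id - A o T_{j-1}; with row vectors, A o T is T *m A. *)
Fixpoint newton (j : nat) Omega p : 'M[R]_n.+1 :=
  match j with
  | 0 => 1%:M
  | j'.+1 => (sigma j'.+1 (curvatures Omega p))%:M
             - newton j' Omega p *m shape Omega p
  end.

(* (T_j o A)(v, v) = <T_j (A v), v> *)
Definition newton_shape (j : nat) Omega p v : R :=
  dot (v *m shape Omega p *m newton j Omega p) v.

Definition is_circumscribed S (c : 'rV[R]_n.+1) (r : R) : Prop :=
  (forall x, S x -> enorm (x - c) <= r) /\
  (forall c' r', (forall x, S x -> enorm (x - c') <= r') -> r <= r').

Definition is_centered_sphere S : Prop :=
  exists2 rho : R, 0 < rho & S = [set x | enorm x = rho].

Section Integrals.
Variable mu : {measure set (@borel R n.+1) -> \bar R}.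

(* I_j for j >= -1; the value for j < -1 is irrelevant. *)
Definition Iint Omega (j : int) : R :=
  match j with
  | Posz j' => \int[mu]_(p in boundary Omega) Hmean j' Omega p
  | Negz 0 => n.+1%:R * volume Omega
  | Negz _ => 0
  end.

(* delta_{2,j}(Omega, B_0(s)) *)
Definition delta2 (j : nat) Omega (s : R) : R :=
  Num.sqrt (\int[mu]_(p in boundary Omega)
              ((support Omega p - s) ^+ 2 * Hmean j Omega p)).

(* 1/(k binom(n,k)) * int_Sigma (T_{k-1} o A)(X^T, X^T) / u^a dmu *)
Definition newton_integral (k : nat) Omega (a : R) : R :=
  (k * 'C(n, k))%:R^-1 *
  \int[mu]_(p in boundary Omega)
     (newton_shape k.-1 Omega p (tangential_part Omega p)
      / (support Omega p) `^ a).

End Integrals.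

End Hypersurface.

(* Main.v *)
(* Let [f' x = x ^ (q - 1)], with [q = m] in (i) and [q = - m] in (ii).  The
   divergence theorem for the Newton tensor [T_{k-1}] and the field [f(u) X] shows
   that the right-hand side equals [int f(u) (u H_k - H_{k-1})], and for constant
   [f] it gives Minkowski's formula [int H_{k-1} = int u H_k]; in the lowest degree
   [I_{-1} = int u].  As [0 < u <= r], the second derivatives
   [(q + 1) x ^ (q - 1)] of [x f x] and [(1 - q) x ^ (q - 2)] of [- f] are at least
   their values at [r].  Taylor expansion of [x f x] at [a = I_{k-1} / I_k],
   integrated against [H_k], and of [- f] at [b = I_{k-2} / I_{k-1}], integrated
   against [H_{k-1}], therefore bounds the right-hand side below by
   [(f a - f b) I_{k-1}] plus the two deviation terms, and the tangent of [- f] at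
   [a], respectively of [x f x] at [b], bounds [f a - f b] below.  Equality makes
   [u] constant.

   The divergence theorem is first proved for the parallel hypersurfaces
   [phi + s nu] of a chart, where it is the antisymmetry of second derivatives in
   an expanded determinant, and the Newton tensors appear by comparing
   coefficients of the powers of [s]; a partition of unity makes it global. *)
Require Import Defs.
From HB Require Import structures.
From mathcomp Require Import all_boot all_order all_algebra.
From mathcomp Require Import all_classical all_reals all_analysis.
From mathcomp Require Import measurable_realfun ring lra perm.

Set Implicit Arguments.
Unset Strict Implicit.
Unset Printing Implicit Defensive.

Import Order.TTheory GRing.Theory Num.Theory.
Import numFieldNormedType.Exports.

Local Open Scope classical_set_scope.
Local Open Scope ring_scope.

(** * Differential calculus in charts *)

Section Calculus.
Context {R : realType}.

(** The circumscribed sphere enters twice: its centre lies in Omega, which makes [u] positive, and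
    its radius bounds [u] from above. The numbers [a] and [b] are the means of [u] for the weights
    [H_k] and [H_{k-1}], so the first-order Taylor terms integrate to zero. The range [-1 <= q < 1]
    covers both parts. At [q = -1] the function [x f x] is affine and contributes nothing, whereas
    [- f] is strictly convex for every [q < 1]: it alone yields the equality case.

    A direct proof that the Newton tensors are divergence free goes through the Codazzi equations.
    With the parameter [s], only second derivatives of [phi + s nu] occur, and their symmetry
    suffices.

    Normal, shape operator and curvatures are [xget] choices, so their existence and regularity have
    to be derived. The area measure is given only by its values in charts, so its finiteness has to
    be derived as well. Finally, [I_{-1} = int u] involves the volume and is obtained by slicing
    Omega along one coordinate. *)

Lemma mx_norm_lt m n (M : 'M[R]_(m, n)) (e : R) : 0 < e ->
  (`|M| < e) <-> (forall i j, `|M i j| < e).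
Proof.
move=> e0; rewrite [`|M|]mx_normrE; split.
  move=> h i j; apply: le_lt_trans h.
  by rewrite (le_trans _ (le_bigmax _ _ (i, j))).
by move=> h; apply/bigmax_ltP; split => // -[i j] _ /=.
Qed.

Lemma differentiable_eps (V W : normedModType R) (f : V -> W) (L : {linear V -> W})
    (x : V) : continuous L ->
  (forall e, 0 < e -> \forall y \near x, `|f y - f x - L (y - x)| <= e * `|y - x|) ->
  differentiable f x /\ 'd f x = L :> (V -> W).
Proof.
move=> cL h.
have E : f \o shift x = cst (f x) + L +o_ (0 : V) id.
  apply/eqaddoP => e e0.
  have := h e e0; rewrite (near_shift 0) /=; apply: filterS => z /=.
  by rewrite subr0 addrK [X in `|X|](_ : _ = f (z + x) - f x - L z)// opprD addrA.
have dE := diff_unique cL E.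
by split => //; apply/diff_locallyP; rewrite dE.
Qed.

Lemma differentiable_epsP (V W : normedModType R) (f : V -> W) (x : V) :
  differentiable f x ->
  forall e, 0 < e -> \forall y \near x, `|f y - f x - 'd f x (y - x)| <= e * `|y - x|.
Proof.
move=> /diff_locally /eqaddoP h e e0.
have := h e e0; rewrite [in X in _ -> X](near_shift 0) /=; apply: filterS => z /=.
by rewrite subr0 addrK [X in `|X| <= _ -> _](_ : _ = f (z + x) - f x - 'd f x z)// opprD addrA.
Qed.

Lemma near_eq_differentiable (V W : normedModType R) (f g : V -> W) (x : V) :
  (\near x, f x = g x) -> differentiable f x ->
  differentiable g x /\ 'd g x = 'd f x :> (V -> W).
Proof.
move=> fg df; apply: differentiable_eps => [|e e0].
  exact: diff_continuous.
near=> y; rewrite -(near fg y)// -(nbhs_singleton fg).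
by near: y; exact: differentiable_epsP.
Unshelve. all: by end_near. Qed.

Lemma diff_partial d (f : 'rV[R]_d -> R) x (v : 'rV[R]_d) : differentiable f x ->
  'D_v f x = \sum_j v 0 j * 'D_(delta_mx 0 j) f x.
Proof.
move=> df; rewrite deriveE// [in LHS](row_sum_delta v) linear_sum.
by apply: eq_bigr => j _; rewrite linearZ deriveE.
Qed.

Lemma derive_coord d (v x : 'rV[R]_d) i : 'D_v (fun y : 'rV[R]_d => y 0 i) x = v 0 i.
Proof.
have := derive_mx (@derivable_id _ _ x v).
by rewrite derive_id => /(congr1 (fun M : 'rV[R]_d => M 0 i)); rewrite mxE => <-.
Qed.

Lemma derive_compR (V : normedModType R) (f : V -> R) (phi : R -> R) (x v : V) dphi :
  is_derive (f x) 1 phi dphi -> differentiable f x ->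
  differentiable (phi \o f) x /\ 'D_v (phi \o f) x = dphi * 'D_v f x.
Proof.
move=> dp df; have dp' : derivable phi (f x) 1 by exact: ex_derive.
have dp'' : differentiable phi (f x) by exact/derivable1_diffP.
have dc : differentiable (phi \o f) x by exact: differentiable_comp.
split => //; rewrite !deriveE// diff_comp//= deriv1E//= derive1E.
by rewrite (@derive_val _ _ _ _ _ _ _ dp) [LHS]mulrC.
Qed.

(** Scalar counterpart of [Ck]. Sums, products, inverses and determinants are formed from scalar
    functions, and [Ck_coordP] passes to vector-valued maps entry by entry. *)
Fixpoint CkR (k : nat) d (U : set 'rV[R]_d) (f : 'rV[R]_d -> R) : Prop :=
  match k with
  | 0 => forall x, U x -> {for x, continuous f}
  | k'.+1 => (forall x, U x -> differentiable f x) /\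
             (forall i : 'I_d, CkR k' U ('D_(delta_mx 0 i) f))
  end.

Section CkTheory.
Variables (d : nat) (U : set 'rV[R]_d).
Hypothesis oU : open U.

Let nearU x : U x -> \forall y \near x, U y.
Proof. by move=> Ux; exact: open_nbhs_nbhs. Qed.

Lemma CkR_eq k (f g : 'rV[R]_d -> R) : (forall x, U x -> f x = g x) ->
  CkR k U f -> CkR k U g.
Proof.
elim: k f g => [|k IH] f g fg /=.
  move=> cf x Ux; have fgx : \near x, f x = g x by near=> y; apply: fg; near: y; exact: nearU.
  rewrite /prop_for /continuous_at -(fg _ Ux).
  exact: cvg_trans (@near_eq_cvg _ _ (nbhs x) _ f g fgx) (cf x Ux).
move=> [df Df]; have fgx x : U x -> \near x, f x = g x.
  by move=> Ux; near=> y; apply: fg; near: y; exact: nearU.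
split=> [x Ux|i]; first exact: (near_eq_differentiable (fgx x Ux) (df x Ux)).1.
by apply: IH (Df i) => x Ux; apply: near_eq_derive; exact: fgx.
Unshelve. all: by end_near. Qed.

Lemma CkR_pred k (f : 'rV[R]_d -> R) : CkR k.+1 U f -> CkR k U f.
Proof.
elim: k f => [|k IH] f [df Df] /=.
  by move=> x Ux; exact/differentiable_continuous/df.
by split => // i; exact: IH.
Qed.

Lemma CkR_cst k (c : R) : CkR k U (fun=> c).
Proof.
elim: k c => [|k IH] c /=; first by move=> x _; exact: cst_continuous.
split=> [x _|i]; first exact: differentiable_cst.
by apply: CkR_eq (IH 0) => x _; rewrite derive_cst.
Qed.

Lemma CkR_coord k (i : 'I_d) : CkR k U (fun x => x 0 i).
Proof.
case: k => [|k] /=; first by move=> x _; exact: coord_continuous.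
split=> [x _|j]; first exact: differentiable_coord.
apply: CkR_eq (CkR_cst k ((delta_mx 0 j : 'rV[R]_d) 0 i)) => x _.
by rewrite derive_coord.
Qed.

Lemma CkR_add k (f g : 'rV[R]_d -> R) : CkR k U f -> CkR k U g ->
  CkR k U (fun x => f x + g x).
Proof.
elim: k f g => [|k IH] f g /=.
  by move=> cf cg x Ux; apply: continuousD; [exact: cf|exact: cg].
move=> [df Df] [dg Dg]; split=> [x Ux|i].
  by apply: differentiableD; [exact: df|exact: dg].
apply: CkR_eq (IH _ _ (Df i) (Dg i)) => x Ux.
rewrite [RHS]deriveD//; first exact/diff_derivable/df.
exact/diff_derivable/dg.
Qed.

Lemma CkR_mul k (f g : 'rV[R]_d -> R) : CkR k U f -> CkR k U g ->
  CkR k U (fun x => f x * g x).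
Proof.
elim: k f g => [|k IH] f g /=.
  by move=> cf cg x Ux; apply: continuousM; [exact: cf|exact: cg].
move=> Cf Cg; have [df Df] := Cf; have [dg Dg] := Cg; split=> [x Ux|i].
  by apply: differentiableM; [exact: df|exact: dg].
apply: CkR_eq (CkR_add (IH _ _ (CkR_pred Cf) (Dg i)) (IH _ _ (CkR_pred Cg) (Df i))) => x Ux.
have dfx := df _ Ux; have dgx := dg _ Ux.
by rewrite -[in RHS]/(f * g) deriveM//; exact: diff_derivable.
Qed.

Lemma CkR_opp k (f : 'rV[R]_d -> R) : CkR k U f -> CkR k U (fun x => - f x).
Proof.
move=> Cf; apply: CkR_eq (CkR_mul (CkR_cst k (-1)) Cf) => x _.
by rewrite mulN1r.
Qed.

Lemma CkR_sub k (f g : 'rV[R]_d -> R) : CkR k U f -> CkR k U g ->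
  CkR k U (fun x => f x - g x).
Proof. by move=> Cf Cg; apply: CkR_add => //; exact: CkR_opp. Qed.

Lemma CkR_sum k (I : Type) (s : seq I) (P : pred I) (f : I -> 'rV[R]_d -> R) :
  (forall i, P i -> CkR k U (f i)) -> CkR k U (fun x => \sum_(i <- s | P i) f i x).
Proof.
move=> Cf; elim: s => [|a s IH].
  by apply: CkR_eq (CkR_cst k 0) => x _; rewrite big_nil.
have [Pa|nPa] := boolP (P a).
  by apply: CkR_eq (CkR_add (Cf _ Pa) IH) => x _; rewrite big_cons Pa.
by apply: CkR_eq IH => x _; rewrite big_cons (negbTE nPa).
Qed.

Lemma CkR_prod k (I : Type) (s : seq I) (P : pred I) (f : I -> 'rV[R]_d -> R) :
  (forall i, P i -> CkR k U (f i)) -> CkR k U (fun x => \prod_(i <- s | P i) f i x).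
Proof.
move=> Cf; elim: s => [|a s IH].
  by apply: CkR_eq (CkR_cst k 1) => x _; rewrite big_nil.
have [Pa|nPa] := boolP (P a).
  by apply: CkR_eq (CkR_mul (Cf _ Pa) IH) => x _; rewrite big_cons Pa.
by apply: CkR_eq IH => x _; rewrite big_cons (negbTE nPa).
Qed.

Lemma CkR_det k m (M : 'rV[R]_d -> 'M[R]_m) :
  (forall i j, CkR k U (fun x => M x i j)) -> CkR k U (fun x => \det (M x)).
Proof.
move=> CM; apply: CkR_sum => s _; apply: CkR_mul; first exact: CkR_cst.
by apply: CkR_prod => i _; exact: CM.
Qed.

Lemma CkR_inv k (f : 'rV[R]_d -> R) : (forall x, U x -> f x != 0) ->
  CkR k U f -> CkR k U (fun x => (f x)^-1).
Proof.
move=> f0; elim: k => [|k IH] /=.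
  by move=> cf x Ux; apply: continuousV; [exact: f0|exact: cf].
move=> Cf; have [df Df] := Cf; split=> [x Ux|i].
  by apply: differentiableV; [exact: df|exact: f0].
have If := IH (CkR_pred Cf).
apply: CkR_eq (CkR_opp (CkR_mul (CkR_mul If If) (Df i))) => x Ux.
rewrite [RHS]deriveV; [|exact: f0|exact/diff_derivable/df].
by rewrite -mulNr -expr2 exprVn.
Qed.

Lemma CkR_invmx k m (M : 'rV[R]_d -> 'M[R]_m) : (forall x, U x -> M x \in unitmx) ->
  (forall i j, CkR k U (fun x => M x i j)) ->
  forall i j, CkR k U (fun x => invmx (M x) i j).
Proof.
move=> uM CM i j.
have CD : CkR k U (fun x => (\det (M x))^-1).
  apply: CkR_inv; last exact: CkR_det.
  by move=> x /uM; rewrite unitmxE unitfE.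
(* Cramer's rule: the [(i, j)] entry of the adjugate. *)
pose f x := (-1) ^+ (j + i) * \det (row' j (col' i (M x))).
have Cf : CkR k U f.
  apply: CkR_mul; first exact: CkR_cst.
  by apply: CkR_det => a b; apply: CkR_eq (CM (lift j a) (lift i b)) => x _; rewrite [RHS]mxE [RHS]mxE.
apply: CkR_eq (CkR_mul CD Cf) => x Ux.
by rewrite /invmx uM// [in RHS]mxE [X in _ = _ * X]mxE.
Qed.

Lemma CkR_sqrt k (f : 'rV[R]_d -> R) : (forall x, U x -> 0 < f x) ->
  CkR k U f -> CkR k U (fun x => Num.sqrt (f x)).
Proof.
move=> f0; elim: k => [|k IH].
  move=> cf x Ux; apply: (@continuous_comp _ _ _ f (@Num.sqrt R)); first exact: cf.
  exact: sqrt_continuous.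
move=> Cf; have [df Df] := Cf.
have dsq v x : U x -> differentiable (Num.sqrt \o f) x /\
    'D_v (Num.sqrt \o f) x = (2 * Num.sqrt (f x))^-1 * 'D_v f x.
  by move=> Ux; apply: derive_compR (df _ Ux); apply: is_derive1_sqrt; exact: f0.
split=> [x Ux|i]; first exact: (dsq 0 x Ux).1.
have Ci : CkR k U (fun x => (2 * Num.sqrt (f x))^-1).
  apply: CkR_inv => [x Ux|]; first by rewrite mulf_neq0// gt_eqF// sqrtr_gt0 f0.
  by apply: CkR_mul; [exact: CkR_cst|exact/IH/CkR_pred].
by apply: CkR_eq (CkR_mul Ci (Df i)) => x Ux; rewrite (dsq _ x Ux).2.
Qed.

End CkTheory.

Lemma differentiable_rV (V : normedModType R) d (g : V -> 'rV[R]_d) x :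
  (forall j, differentiable (fun y => g y 0 j) x) -> differentiable g x.
Proof.
move=> dg; rewrite (_ : g = \sum_j (fun y => g y 0 j *: delta_mx 0 j)); last first.
  by apply/funext => y; rewrite [LHS]row_sum_delta fct_sumE.
by apply: differentiable_sum => j; exact: differentiableZl.
Qed.

Lemma differentiable_entry (V : normedModType R) d (g : V -> 'rV[R]_d) x j :
  differentiable g x -> differentiable (fun y => g y 0 j) x.
Proof.
move=> dg; apply: (@differentiable_comp _ _ _ _ g (fun M : 'rV[R]_d => M 0 j)) => //.
exact: differentiable_coord.
Qed.

Lemma derive_entry (V : normedModType R) d (g : V -> 'rV[R]_d) x v j :
  derivable g x v -> 'D_v g x 0 j = 'D_v (fun y => g y 0 j) x.
Proof. by move=> dg; rewrite derive_mx// mxE. Qed.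

Lemma continuous_rV (T : topologicalType) d (g : T -> 'rV[R]_d) x :
  (forall j, {for x, continuous (fun y => g y 0 j)}) -> {for x, continuous g}.
Proof.
move=> cg; apply/cvgrPdist_lt => e e0; near=> y; apply/mx_norm_lt => // i j.
rewrite ord1 !mxE; move: j; near: y; apply: filter_forall => j.
by have /cvgrPdist_lt/(_ e e0) := cg j.
Unshelve. all: by end_near. Qed.

Lemma Ck_coordP k d e (U : set 'rV[R]_d) (f : 'rV[R]_d -> 'rV[R]_e) : open U ->
  Ck k U f <-> forall j, CkR k U (fun x => f x 0 j).
Proof.
move=> oU; elim: k f => [|k IH] f /=.
  split=> [cf j x Ux|cf x Ux]; last by apply: continuous_rV => j; exact: cf.
  apply: (@continuous_comp _ _ _ f (fun M : 'rV[R]_e => M 0 j)); first exact: cf.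
  exact: coord_continuous.
split=> [[df Df] j|Cf].
  split=> [x Ux|i]; first exact/differentiable_entry/df.
  apply: CkR_eq ((IH _).1 (Df i) j) => // x Ux.
  by rewrite derive_entry//; exact/diff_derivable/df.
have df x : U x -> differentiable f x.
  by move=> Ux; apply: differentiable_rV => j; exact: (Cf j).1.
split => // i; apply/IH => j; apply: CkR_eq ((Cf j).2 i) => // x Ux.
by rewrite derive_entry//; exact/diff_derivable/df.
Qed.

Lemma CkR_comp k d e (U : set 'rV[R]_d) (V : set 'rV[R]_e)
    (g : 'rV[R]_d -> 'rV[R]_e) (f : 'rV[R]_e -> R) : open U -> open V ->
  (forall x, U x -> V (g x)) -> (forall j, CkR k U (fun x => g x 0 j)) ->
  CkR k V f -> CkR k U (f \o g).
Proof.
move=> oU oV gUV; elim: k f => [|k IH] f Cg Cf /=.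
  move=> x Ux; apply: continuous_comp; last exact/Cf/gUV.
  by apply: continuous_rV => j; exact: Cg.
have dg x : U x -> differentiable g x.
  by move=> Ux; apply: differentiable_rV => j; exact: (Cg j).1.
have df x : U x -> differentiable f (g x) by move=> Ux; apply: Cf.1; exact: gUV.
split=> [x Ux|i]; first by apply: differentiable_comp; [exact: dg|exact: df].
have C i0 : CkR k U (fun x => \sum_j 'D_(delta_mx 0 i0) (fun y => g y 0 j) x *
    'D_(delta_mx 0 j) f (g x)).
  apply: CkR_sum => // j _; apply: CkR_mul => //; first exact: (Cg j).2.
  by apply: (IH ('D_(delta_mx 0 j) f)) => [l|]; [exact: CkR_pred|exact: Cf.2].
apply: CkR_eq (C i) => // x Ux.
have dgx := dg _ Ux; have dfx := df _ Ux.
rewrite [RHS]deriveE; last exact: differentiable_comp.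
rewrite diff_comp//= -[in RHS]deriveE// -[in RHS]deriveE// diff_partial//.
by apply: eq_bigr => j _; rewrite derive_entry//; exact: diff_derivable.
Qed.

Lemma line_is_derive d (f : 'rV[R]_d -> R) (x v : 'rV[R]_d) (t : R) :
  derivable f (x + t *: v) v ->
  is_derive t 1 (fun s => f (x + s *: v)) ('D_v f (x + t *: v)).
Proof.
move=> df; have E : (fun h : R => h^-1 *: ((fun s => f (x + s *: v)) (h *: 1 + t) -
    (fun s => f (x + s *: v)) t)) =
    (fun h => h^-1 *: (f (h *: v + (x + t *: v)) - f (x + t *: v))).
  apply/funext => h; congr (_ *: (f _ - _)).
  by rewrite scalerDl [h *: 1]mulr1 addrCA.
by apply: DeriveDef; [rewrite /derivable E|rewrite /derive E].
Qed.

Lemma norm_delta_le d (i : 'I_d) : `|(delta_mx 0 i : 'rV[R]_d)| <= 1.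
Proof.
rewrite [`|_|]mx_normrE; apply/bigmax_leP; split => // -[a b] _ /=.
by rewrite mxE; case: (_ && _); rewrite ?normr1 ?normr0.
Qed.

(** The mean value theorem is applied to the difference in direction [j] as a function of the step
    in direction [i], then to ['D_(delta_mx 0 i) f] in direction [j]. The left-hand side is
    symmetric in [i] and [j], which [derive_swap] exploits. *)
Lemma mixed_difference d (U : set 'rV[R]_d) (f : 'rV[R]_d -> R) x (i j : 'I_d) (e h : R) :
  open U -> CkR 2 U f -> ball x e `<=` U -> 0 < h -> 2 * h < e ->
  exists2 p, ball x e p &
    f (x + h *: delta_mx 0 i + h *: delta_mx 0 j) - f (x + h *: delta_mx 0 i)
    - (f (x + h *: delta_mx 0 j) - f x) =
    'D_(delta_mx 0 j) ('D_(delta_mx 0 i) f) p * h ^+ 2.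
Proof.
move=> oU [df Df] eU h0 he.
set ei := delta_mx 0 i; set ej := delta_mx 0 j.
have inB s t : 0 <= s <= h -> 0 <= t <= h -> ball x e (x + s *: ei + t *: ej).
  move=> /andP[s0 sh] /andP[t0 th].
  rewrite -ball_normE /ball_ /= -addrA opprD addNKr normrN.
  apply: le_lt_trans he; apply: le_trans (ler_normD _ _) _.
  rewrite !normrZ (ger0_norm s0) (ger0_norm t0) mulr2n mulrDl mul1r.
  by rewrite lerD//; [apply: le_trans sh|apply: le_trans th]; rewrite ler_piMr// norm_delta_le.
have h00 : 0 <= h <= h by rewrite lexx ltW.
have h01 : 0 <= (0 : R) <= h by rewrite lexx ltW.
pose phi s := f (x + s *: ei + h *: ej) - f (x + s *: ei).
pose dphi s := 'D_ei f (x + s *: ei + h *: ej) - 'D_ei f (x + s *: ei).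
have dfB s t v : 0 <= s <= h -> 0 <= t <= h -> derivable f (x + s *: ei + t *: ej) v.
  by move=> sh th; apply/diff_derivable/df/eU/inB.
have isphi s : 0 <= s <= h -> is_derive s 1 phi (dphi s).
  move=> sh; apply: is_deriveB.
    rewrite (_ : (fun _ => _) = fun s => f (x + h *: ej + s *: ei)); last first.
      by apply/funext => u; rewrite addrAC.
    by rewrite [X in 'D_ei f X]addrAC; apply: line_is_derive; rewrite addrAC; exact: dfB.
  by apply: line_is_derive; have := dfB s 0 ei sh h01; rewrite scale0r addr0.
have [||s sh E1] := @MVT R phi dphi 0 h h0.
- move=> s; rewrite in_itv/= => /andP[/ltW s0 /ltW sh]; apply: isphi; exact/andP.
- apply: derivable_within_continuous => s; rewrite in_itv/= => sh.
  by case: (isphi s sh).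
have {}sh : 0 <= s <= h by move: sh; rewrite in_itv/= => /andP[/ltW-> /ltW->].
pose psi t := 'D_ei f (x + s *: ei + t *: ej).
have ispsi t : 0 <= t <= h -> is_derive t 1 psi ('D_ej ('D_ei f) (x + s *: ei + t *: ej)).
  by move=> th; apply: line_is_derive; apply/diff_derivable/(Df i).1/eU/inB.
have [||t th E2] := @MVT R psi (fun t => 'D_ej ('D_ei f) (x + s *: ei + t *: ej)) 0 h h0.
- move=> t; rewrite in_itv/= => /andP[/ltW t0 /ltW th]; apply: ispsi; exact/andP.
- apply: derivable_within_continuous => t; rewrite in_itv/= => th.
  by case: (ispsi t th).
have {}th : 0 <= t <= h by move: th; rewrite in_itv/= => /andP[/ltW-> /ltW->].
exists (x + s *: ei + t *: ej); first exact: inB.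
move: E1 E2; rewrite /phi /dphi /psi !subr0 !scale0r !addr0 => -> ->.
by rewrite -mulrA.
Qed.

Lemma eq_at_limit (V : normedModType R) (g1 g2 : V -> R) (x : V) (r : R) : 0 < r ->
  {for x, continuous g1} -> {for x, continuous g2} ->
  (forall e, 0 < e -> e <= r -> exists p q, [/\ ball x e p, ball x e q & g1 p = g2 q]) ->
  g1 x = g2 x.
Proof.
move=> r0 c1 c2 h; apply/eqP; apply/negPn/negP => neq.
pose e := `|g1 x - g2 x| / 2.
have e0 : 0 < e by rewrite divr_gt0// normr_gt0 subr_eq0.
have /nbhs_ballP[r1 /= r10 r1P] : \forall y \near x, `|g1 x - g1 y| < e by move/cvgrPdist_lt : c1; exact.
have /nbhs_ballP[r2 /= r20 r2P] : \forall y \near x, `|g2 x - g2 y| < e by move/cvgrPdist_lt : c2; exact.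
have [||p [q [xp xq pq]]] := h (Num.min r (Num.min r1 r2)).
- by rewrite !lt_min r0 r10.
- by rewrite ge_min lexx.
have p1 : `|g1 x - g1 p| < e by apply/r1P/(le_ball _ xp); rewrite !ge_min lexx orbT.
have q2 : `|g2 x - g2 q| < e by apply/r2P/(le_ball _ xq); rewrite !ge_min lexx !orbT.
have : `|g1 x - g2 x| < e + e.
  by rewrite -(subrKA (g1 p) (g1 x)) (le_lt_trans (ler_normD _ _))// ltrD// pq distrC.
by rewrite /e -splitr ltxx.
Qed.

(** Both mixed derivatives represent the same second-order difference at points arbitrarily close to
    [x]; continuity does the rest. *)
Lemma derive_swap d (U : set 'rV[R]_d) (f : 'rV[R]_d -> R) x (i j : 'I_d) :
  open U -> CkR 2 U f -> U x ->
  'D_(delta_mx 0 j) ('D_(delta_mx 0 i) f) x = 'D_(delta_mx 0 i) ('D_(delta_mx 0 j) f) x.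
Proof.
move=> oU C2 Ux.
have /nbhs_ballP[r /= r0 rU] : nbhs x U by exact: open_nbhs_nbhs.
apply: (@eq_at_limit _ ('D_(delta_mx 0 j) ('D_(delta_mx 0 i) f))
  ('D_(delta_mx 0 i) ('D_(delta_mx 0 j) f)) x r r0).
- exact: (C2.2 i).2.
- exact: (C2.2 j).2.
move=> e e0 er.
have eU : ball x e `<=` U by apply: subset_trans rU; exact: le_ball.
have h0 : 0 < e / 3 by rewrite divr_gt0.
have hr : 2 * (e / 3) < e.
  by rewrite mulrCA gtr_pMr// ltr_pdivrMr// mul1r ltr_nat.
have [p xp E1] := mixed_difference i j oU C2 eU h0 hr.
have [q xq E2] := mixed_difference j i oU C2 eU h0 hr.
exists p, q; apply: And3; [exact: xp|exact: xq|].
apply: (mulIf (_ : (e / 3) ^+ 2 != 0)); first by rewrite expf_neq0// gt_eqF.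
apply: etrans (esym E1) (etrans _ E2).
rewrite (addrAC x (_ *: delta_mx 0 j)).
by move: (f _) (f _) (f _) => a b c; ring.
Qed.

Definition setrow m n (i : 'I_m) (v : 'rV[R]_n) (M : 'M[R]_(m, n)) : 'M[R]_(m, n) :=
  \matrix_(j, l) if j == i then v 0 l else M j l.

Lemma is_derive_prod (V : normedModType R) (I : eqType) (s : seq I) (f : I -> V -> R)
    (df : I -> R) (x v : V) : uniq s ->
  (forall i, i \in s -> is_derive x v (f i) (df i)) ->
  is_derive x v (fun y => \prod_(i <- s) f i y)
    (\sum_(i <- s) df i * \prod_(j <- s | j != i) f j x).
Proof.
elim: s => [_ _|a s IH /= /andP[as_ us] dfs].
  rewrite big_nil (_ : (fun _ => _) = cst 1); last by apply/funext => y; rewrite big_nil.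
  exact: is_derive_cst.
have d1 : is_derive x v (f a) (df a) by apply: dfs; rewrite mem_head.
have d2 : is_derive x v (fun y => \prod_(i <- s) f i y)
    (\sum_(i <- s) df i * \prod_(j <- s | j != i) f j x).
  by apply: IH => // i is_; apply: dfs; rewrite in_cons is_ orbT.
rewrite (_ : (fun _ => _) = f a * (fun y => \prod_(i <- s) f i y)); last first.
  by apply/funext => y; rewrite big_cons.
apply: is_derive_eq; rewrite big_cons big_cons eqxx /= addrC; congr (_ + _).
  rewrite [LHS]mulrC; congr (_ * _); rewrite [RHS]big_seq_cond [LHS]big_seq.
  apply: eq_bigl => j; case: (boolP (j \in s)) => //= js.
  by apply/esym; apply: contraNneq as_ => <-.
rewrite /GRing.scale /= mulr_sumr; apply: eq_big_seq => i is_.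
rewrite big_cons ifT; first by rewrite mulrCA.
by apply: contraNneq as_ => ->.
Qed.

Lemma is_derive_bigsum (V : normedModType R) (I : Type) (s : seq I) (f : I -> V -> R)
    (df : I -> R) (x v : V) : (forall i, is_derive x v (f i) (df i)) ->
  is_derive x v (fun y => \sum_(i <- s) f i y) (\sum_(i <- s) df i).
Proof.
move=> dfs; elim: s => [|a s IH].
  rewrite big_nil (_ : (fun _ => _) = cst 0); last by apply/funext => y; rewrite big_nil.
  exact: is_derive_cst.
rewrite big_cons (_ : (fun _ => _) = f a + (fun y => \sum_(i <- s) f i y)).
  exact: is_deriveD.
by apply/funext => y; rewrite big_cons.
Qed.

(** Jacobi's formula in row form: in the Leibniz expansion, the summand [i] collects the terms whose
    factor from row [i] is differentiated. In this form the second derivatives of a chart can be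
    paired by exchanging two rows. *)
Lemma is_derive_det (V : normedModType R) n (M : V -> 'M[R]_n) (dM : 'M[R]_n) (x v : V) :
  (forall i j, is_derive x v (fun y => M y i j) (dM i j)) ->
  is_derive x v (fun y => \det (M y)) (\sum_i \det (setrow i (row i dM) (M x))).
Proof.
move=> dMP.
have dp (s : 'S_n) : is_derive x v (fun y => \prod_i M y i (s i))
   (\sum_i dM i (s i) * \prod_(j | j != i) M x j (s j)).
  by apply: (@is_derive_prod _ _ (index_enum 'I_n) (fun i y => M y i (s i))
    (fun i => dM i (s i))) => //; exact: index_enum_uniq.
have dsum : is_derive x v (fun y => \sum_(s : 'S_n) (-1) ^+ s * \prod_i M y i (s i))
   (\sum_(s : 'S_n) (-1) ^+ s * \sum_i dM i (s i) * \prod_(j | j != i) M x j (s j)).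
  apply: is_derive_bigsum => s.
apply: is_derive_eq.
rewrite /determinant exchange_big /=.
apply: eq_bigr => s _; rewrite mulr_sumr; apply: eq_bigr => i _; congr (_ * _).
rewrite [RHS](bigD1 i)//= !mxE eqxx; congr (_ * _).
by apply: eq_bigr => j ji; rewrite mxE (negbTE ji).
Qed.

Lemma mulmx_norm_le d e (v : 'rV[R]_d) (B : 'M[R]_(d, e)) :
  `|v *m B| <= (\sum_i \sum_j `|B i j|) * `|v|.
Proof.
have S0 : 0 <= (\sum_i \sum_j `|B i j|) * `|v|.
  by rewrite mulr_ge0// sumr_ge0// => i _; rewrite sumr_ge0.
rewrite [leLHS]mx_normrE; apply/bigmax_leP; split => // -[i j] _ /=.
rewrite ord1 mxE (le_trans (ler_norm_sum _ _ _))// mulr_suml ler_sum// => k _.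
rewrite normrM mulrC ler_pM//.
  by rewrite (bigD1 j)//= lerDl sumr_ge0.
by rewrite [leRHS]mx_normrE (le_trans _ (le_bigmax _ _ (0, k))).
Qed.

Lemma continuous_mulmxr d e (B : 'M[R]_(d, e)) : continuous (mulmxr B : 'rV[R]_d -> 'rV[R]_e).
Proof.
move=> x; apply: continuous_rV => j.
rewrite (_ : (fun _ => _) = fun y : 'rV[R]_d => \sum_k y 0 k * B k j); last first.
  by apply/funext => y; rewrite /= mxE.
apply: (CkR_sum openT (k := 0)) => // k _.
by apply: (CkR_mul openT); [exact: (CkR_coord openT)|exact: (CkR_cst openT)].
Qed.

(** Differentiability part of the inverse function theorem, for a local inverse [c] already known to
    be continuous. Applying [B] to the expansion of [f] at [c y] shows that [k = c z - c y] differs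
    from [(z - y) *m B] by a small multiple of [|k|]; absorbing it bounds [|k|] by a multiple of
    [|z - y|], and the same estimate then gives the derivative. *)
Lemma left_inverse_differentiable d (f c : 'rV[R]_d -> 'rV[R]_d) (y : 'rV[R]_d)
    (B : 'M[R]_d) :
  differentiable f (c y) -> {for y, continuous c} ->
  (\forall z \near y, f (c z) = z) -> 'J f (c y) *m B = 1%:M ->
  differentiable c y /\ forall v, 'D_v c y = v *m B.
Proof.
move=> df cc fc JB.
pose K := \sum_i \sum_j `|B i j| + 1.
have K0 : 0 < K by rewrite ltr_wpDl// sumr_ge0// => i _; rewrite sumr_ge0.
have KP (v : 'rV[R]_d) : `|v *m B| <= K * `|v|.
  by rewrite (le_trans (mulmx_norm_le _ _))// ler_wpM2r// lerDl.
have [dc dE] : differentiable c y /\ 'd c y = mulmxr B :> (_ -> _); last first.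
  by split => // v; rewrite deriveE// dE.
apply: differentiable_eps; first exact: continuous_mulmxr.
(* The first bound gives [K * e' <= 1 / 2], which absorbs [|k|]; the second makes the final error
   factor [2 * K ^ 2 * e'] at most [e]. *)
move=> e e0; pose e' := Num.min (2 * K)^-1 (e / (2 * K ^+ 2)).
have e'0 : 0 < e' by rewrite lt_min invr_gt0 mulr_gt0//= divr_gt0// mulr_gt0// exprn_gt0.
have := cc _ (differentiable_epsP df e'0); rewrite /= => near1.
near=> z.
have fz : f (c z) = z by near: z.
have fy : f (c y) = y by exact: nbhs_singleton fc.
have : `|f (c z) - f (c y) - 'd f (c y) (c z - c y)| <= e' * `|c z - c y| by near: z.
rewrite fz fy; set k := c z - c y.
have -> : 'd f (c y) k = k *m 'J f (c y) by rewrite /jacobian mul_rV_lin1.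
move=> h1; have h2 : `|(z - y) *m B - k| <= K * (e' * `|k|).
  rewrite -[X in _ - X](mulmx1 k) -JB mulmxA -mulmxBl.
  by rewrite (le_trans (KP _))// ler_pM2l.
have Ke' : K * e' <= 2^-1.
  apply: (@le_trans _ _ (K * (2 * K)^-1)); first by rewrite ler_pM2l// ge_min lexx.
  by rewrite invfM mulrCA mulfV ?mulr1// gt_eqF.
have h3 : `|k| <= 2 * (K * `|z - y|).
  have : `|k| <= K * `|z - y| + 2^-1 * `|k|.
    rewrite -[in leLHS](subKr ((z - y) *m B) k) (le_trans (ler_normB _ _))// lerD//.
    by rewrite (le_trans h2)// mulrA ler_wpM2r.
  by move=> ?; lra.
rewrite distrC (le_trans h2)// mulrA (le_trans (ler_wpM2l _ h3))//.
  by rewrite mulr_ge0 ?ltW.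
rewrite [leLHS](_ : _ = K * e' * 2 * K * `|z - y|); last by ring.
rewrite ler_wpM2r//.
have : e' <= e / (2 * K ^+ 2) by rewrite ge_min lexx orbT.
by rewrite ler_pdivlMr ?mulr_gt0// ?exprn_gt0// => /(le_trans _); apply; rewrite le_eqVlt; apply/orP; left; apply/eqP; ring.
Unshelve. all: by end_near. Qed.

End Calculus.

(** * Lebesgue measure on row vectors *)

Section BorelMeasurability.
Context {R : realType}.

Lemma borel_open d (A : set 'rV[R]_d) : open A -> measurable (A : set (borel d)).
Proof. by move=> oA; exact: sub_sigma_algebra. Qed.

Lemma borel_closed d (A : set 'rV[R]_d) : closed A -> measurable (A : set (borel d)).
Proof.
move=> cA; have /borel_open : open (~` A) by exact: closed_openC.
by move/measurableC; rewrite setCK.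
Qed.

Lemma measurable_fun_opens d (T : measurableType d) (D : set T) (f : T -> R) :
  (forall O : set R, open O -> measurable (D `&` f @^-1` O)) ->
  measurable_fun D f.
Proof.
move=> h; apply: (measurability _ (measurable_realfun.RGenOpens.measurableE R)).
by move=> _ [_ [a [b ->] <-]]; apply: h; exact: interval_open.
Qed.

Lemma continuous_borel_measurable d (f : 'rV[R]_d -> R) :
  continuous f -> measurable_fun setT (f : borel d -> R).
Proof.
move=> cf; apply: measurable_fun_opens => O oO; rewrite setTI.
by apply: borel_open; move/continuousP : cf; exact.
Qed.

Lemma mx_norm_le m n (M : 'M[R]_(m, n)) (e : R) : 0 <= e ->
  (`|M| <= e) <-> (forall i j, `|M i j| <= e).
Proof.
move=> e0; rewrite [`|M|]mx_normrE; split.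
  move=> h i j; apply: le_trans h.
  by rewrite (le_trans _ (le_bigmax _ _ (i, j))).
by move=> h; apply/bigmax_leP; split => // -[i j] _ /=.
Qed.

Lemma rV_ballE d (x : 'rV[R]_d) (e : R) : 0 < e ->
  ball x e = [set y | forall i, `|x 0 i - y 0 i| < e].
Proof.
move=> e0; apply/seteqP; split => y; rewrite -ball_normE /ball_ /=.
  by move/(mx_norm_lt _ e0) => + i => /(_ 0 i); rewrite !mxE.
move=> h; apply/mx_norm_lt => // i j; rewrite !ord1 !mxE; exact: h.
Qed.

(** An open set is a countable union of sup-norm balls with rational centre and radius
    [1 / (N + 1)], and the preimage of such a ball is a finite intersection of conditions on single
    coordinates. *)
Lemma measurable_fun_rV d (T : measurableType d) d' (g : T -> 'rV[R]_d') :
  (forall i, measurable_fun setT (fun t => g t 0 i)) ->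
  measurable_fun setT (g : T -> borel d').
Proof.
move=> mg; apply: (@measurability _ _ T (@borel R d') setT g (@open 'rV[R]_d')) => // _ [U oU <-].
rewrite setTI.
pose B (q : 'rV[rat]_d' * nat) : set 'rV[R]_d' :=
  ball (map_mx ratr q.1 : 'rV[R]_d') q.2.+1%:R^-1.
pose F q : set T := if `[< B q `<=` U >] then g @^-1` B q else set0.
suff -> : g @^-1` U = \bigcup_q F q.
  apply: countable_bigcupT_measurable => // q; rewrite /F; case: ifPn => // _.
  rewrite /B rV_ballE ?invr_gt0//.
  rewrite (_ : _ @^-1` _ = \bigcap_(i in [set: 'I_d'])
      [set t | `|(map_mx ratr q.1 : 'rV[R]_d') 0 i - g t 0 i| < q.2.+1%:R^-1]).
    apply: fin_bigcap_measurable => // i _; rewrite -[X in measurable X]setTI.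
    have : measurable_fun setT (fun t => `|(map_mx ratr q.1 : 'rV[R]_d') 0 i - g t 0 i|).
      by apply: measurableT_comp => //; exact: measurable_funB.
    move=> /(_ measurableT _ (measurable_itv `]-oo, q.2.+1%:R^-1[)).
    by rewrite preimage_itvNyo.
  by apply/seteqP; split => t /= h i; [move=> _|]; apply: h.
apply/seteqP; split => [t Ut|t [q _]]; last first.
  by rewrite /F; case: asboolP => // + /=; apply.
have : nbhs (g t) U by exact: open_nbhs_nbhs.
move=> /nbhs_ballP[e /= e0 eU].
have [N Ne] : exists N : nat, N.+1%:R^-1 < e / 2.
  have /ltr_add_invr[N] : 0 < e / 2 by rewrite divr_gt0.
  by rewrite add0r => h; exists N.
have qP i : exists q : rat, `|ratr q - g t 0 i| < N.+1%:R^-1.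
  have /rat_in_itvoo[q] : g t 0 i - N.+1%:R^-1 < g t 0 i + N.+1%:R^-1.
    by rewrite ltrD2l gtrN// invr_gt0.
  by rewrite in_itv/= => qq; exists q; rewrite distrC ltr_distlC.
pose q := \row_i sval (cid (qP i)).
have Bt : B (q, N) (g t).
  rewrite /B rV_ballE ?invr_gt0//= => i; rewrite !mxE; exact: svalP (cid (qP i)).
exists (q, N) => //; rewrite /F; case: asboolP => // -[] y By.
apply: eU; rewrite [e]splitr.
apply: (@ball_triangle _ _ (map_mx ratr q : 'rV[R]_d')).
  by apply: ball_sym; apply: le_ball Bt; exact/ltW.
by apply: le_ball By; exact/ltW.
Qed.

Lemma measurable_row_mx d :
  measurable_fun setT (fun z : measurableTypeR R * borel d =>
    (row_mx (z.1%:M : 'rV[R]_1) (z.2 : 'rV[R]_d) : borel (1 + d))).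
Proof.
apply: measurable_fun_rV => i; rewrite -(splitK i); case: (fintype.split i) => j /=.
  under eq_fun do rewrite row_mxEl ord1 mxE eqxx mulr1n.
  exact: measurable_fst.
under eq_fun do rewrite row_mxEr.
apply: (@measurableT_comp _ _ _ _ _ _ (fun y : borel d => (y : 'rV[R]_d) 0 j)) => //.
  by apply: continuous_borel_measurable; exact: coord_continuous.
Qed.

Lemma row_mx_ball d (x : 'rV[R]_(1 + d)) (e : R) : 0 < e ->
  (fun z : R * 'rV[R]_d => row_mx (z.1%:M : 'rV[R]_1) z.2) @^-1` (ball x e) =
  ball (x 0 0) e `*` ball (rsubmx x) e.
Proof.
move=> e0; rewrite !rV_ballE//; apply/seteqP; split => -[t y] /=.
  move=> h; split.
    have := h (lshift _ 0); rewrite row_mxEl mxE eqxx mulr1n.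
    rewrite -ball_normE /ball_ /=; congr (`|x _ _ - _| < _); exact: val_inj.
  by move=> i; have := h (rshift _ i); rewrite row_mxEr mxE.
move=> [] + h i; rewrite -ball_normE /ball_ /= => h0.
rewrite -(splitK i); case: (fintype.split i) => j /=.
  rewrite row_mxEl mxE ord1 eqxx mulr1n; move: h0.
  congr (`|x _ _ - _| < _); exact: val_inj.
by rewrite row_mxEr; have := h j; rewrite mxE.
Qed.

Lemma row_mx_head d (w : 'rV[R]_(1 + d)) : w = row_mx (w 0 0)%:M (rsubmx w).
Proof.
rewrite -[LHS]hsubmxK; congr row_mx; apply/rowP => j.
by rewrite !mxE ord1 eqxx mulr1n; congr (w _ _); exact: val_inj.
Qed.

(** Fubini's theorem takes a bundled sigma-finite measure; a transported measure has to be bundled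
    anew. *)
Lemma sigma_finite_measure_ex d (T : measurableType d)
    (m : {measure set T -> \bar R}) : sigma_finite setT m ->
  exists m' : {sigma_finite_measure set T -> \bar R}, m' = m :> (set T -> \bar R).
Proof.
move=> sf.
pose H1 := @isSFinite.Build _ _ _ _ (sfinite_measure_sigma_finite sf).
pose H2 := @isSigmaFinite.Build _ _ _ _ sf.
pose m' : {sigma_finite_measure set T -> \bar R} := HB.pack_for (SigmaFiniteMeasure.type T R) (Measure.sort m) H1 H2.
by exists m'.
Qed.

(** The iterated integral is the integral of one Borel measure, the product measure transported by
    [row_mx], so the general integration theory applies. The volume of balls is part of the
    induction because it yields sigma-finiteness, on which Fubini's theorem relies in the next
    dimension. *)
Lemma lebesgue_intP d : exists m : {sigma_finite_measure set (@borel R d) -> \bar R},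
  (forall f : @borel R d -> \bar R, measurable_fun setT f ->
     (forall x, (0 <= f x)%E) -> lebesgue_int f = (\int[m]_x f x)%E) /\
  (forall (x : 'rV[R]_d) e, 0 < e -> m (ball x e) = ((2 * e) ^+ d)%:E).
Proof.
elim: d => [|d [m [mf mball]]].
  pose m' : {sigma_finite_measure set (@borel R 0) -> \bar R} := dirac (0 : @borel R 0).
  exists m'; split => [f f0 fm|x e e0].
    rewrite /= integral_dirac//= diracT mul1e//.
  by rewrite expr0 /m' /= diracE mem_set// !thinmx0; exact: ballxx.
pose phi := fun z : measurableTypeR R * borel d =>
    (row_mx (z.1%:M : 'rV[R]_1) (z.2 : 'rV[R]_d) : borel (1 + d)).
have mphi : measurable_fun setT phi by exact: measurable_row_mx.
pose m1 : {measure set (@borel R (1 + d)) -> \bar R} :=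
  measure_function_pushforward__canonical__measure_function_Measure
    (@lebesgue_measure R \x m)%E mphi.
have m1ball (x : 'rV[R]_(1 + d)) e : 0 < e -> m1 (ball x e) = ((2 * e) ^+ d.+1)%:E.
  move=> e0; rewrite /m1 /= /pushforward row_mx_ball//.
  rewrite product_measure1E//=; last first.
  - by apply: borel_open; exact: ball_open.
  - by apply: measurable_ball.
  rewrite mball// lebesgue_measure_ball//; last exact: ltW.
  by rewrite -EFinM exprS mulr_natl.
have sf : sigma_finite setT m1.
  exists (fun k => ball (0 : 'rV[R]_(1 + d)) k.+1%:R).
    apply/seteqP; split => // x _; exists (Num.truncn `|x|) => //.
    rewrite -ball_normE /ball_ /= sub0r normrN; exact: truncnS_gt.
  move=> k; split; first by apply: borel_open; exact: ball_open.
  by rewrite m1ball// ltry.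
have [m' m'E] := sigma_finite_measure_ex sf.
exists m'; split => [f f0 fm /=|x e e0]; last by rewrite m'E m1ball.
transitivity (\int[m1]_x f x)%E; last first.
  by apply: eq_measure_integral => A _ _; exact: esym (congr1 (fun h : set _ -> _ => h A) m'E).

rewrite /m1 ge0_integral_pushforward//= preimage_setT.
rewrite (fubini_tonelli1 (f \o phi))//=; last exact: measurableT_comp.
apply: eq_integral => x _; rewrite mf//.
apply: (measurableT_comp f0).
exact: (measurableT_comp mphi (pair1_measurable x)).
Qed.

Definition lebesgue_rV d : {sigma_finite_measure set (@borel R d) -> \bar R} :=
  sval (cid (lebesgue_intP d)).

Lemma lebesgue_intE d (f : @borel R d -> \bar R) : measurable_fun setT f ->
  (forall x, (0 <= f x)%E) -> lebesgue_int f = (\int[lebesgue_rV d]_x f x)%E.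
Proof. by rewrite /lebesgue_rV; case: (cid _) => m /= [h _]; exact: h. Qed.

Lemma lebesgue_rV_ball d (x : 'rV[R]_d) e : 0 < e -> lebesgue_rV d (ball x e) = ((2 * e) ^+ d)%:E.
Proof. by rewrite /lebesgue_rV; case: (cid _) => m /= [_ h]; exact: h. Qed.

Lemma borel_ball d (x : 'rV[R]_d) e : measurable (ball x e : set (borel d)).
Proof. by apply: borel_open; exact: ball_open. Qed.

(** Lebesgue measure is determined by its values on half-open intervals, whose length a translation
    preserves. *)
Lemma lebesgue_measureD (c : R) (A : set (measurableTypeR R)) : measurable A ->
  pushforward (@lebesgue_measure R) (fun x : measurableTypeR R => x + c : measurableTypeR R) A =
  lebesgue_measure A.
Proof.
have mc : measurable_fun setT (fun x : measurableTypeR R => x + c : measurableTypeR R).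
  by apply: measurable_funD.
move=> mA; apply/esym.
pose m1 : {measure set (measurableTypeR R) -> \bar R} :=
  measure_function_pushforward__canonical__measure_function_Measure
    (@lebesgue_measure R) mc.
rewrite -[RHS]/(m1 A); apply: lebesgue_measure_unique => //.
move=> _ [[a b]] _ <- /=; rewrite /m1 /= /pushforward.
rewrite (_ : _ @^-1` _ = `](a - c), (b - c)]%classic); last first.
  by apply/seteqP; split => x /=; rewrite !in_itv/= ltrBlDr lerBrDr.
by rewrite !lebesgue_measure_itv/= !lte_fin ltrD2r -!EFinB opprB addrA subrK.
Qed.

Lemma lebesgue_int_translate d (f : @borel R d -> \bar R) (w : 'rV[R]_d) :
  measurable_fun setT f -> (forall x, (0 <= f x)%E) ->
  lebesgue_int (fun x => f (x + w)) = lebesgue_int f.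
Proof.
elim: d f w => [|d IH] f w mf f0 /=; first by rewrite (thinmx0 (0 + w)).
pose G (x : measurableTypeR R) := lebesgue_int (fun y : 'rV[R]_d =>
  f (row_mx (x%:M : 'rV[R]_1) y : 'rV[R]_(1 + d))).
have mfx (x : measurableTypeR R) : measurable_fun setT (fun y : @borel R d =>
  f (row_mx (x%:M : 'rV[R]_1) (y : 'rV[R]_d) : 'rV[R]_(1 + d))).
  apply: (measurableT_comp mf).
  exact: (measurableT_comp (@measurable_row_mx d) (pair1_measurable x)).
have mc : measurable_fun setT (fun x : measurableTypeR R => x + w 0 0 : measurableTypeR R).
  by apply: measurable_funD.
have mG : measurable_fun setT G.
  rewrite (_ : G = fun x => (\int[lebesgue_rV d]_y f (row_mx (x%:M : 'rV[R]_1) y))%E).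
    apply: (measurable_fun_fubini_tonelli_F (fun z : measurableTypeR R * borel d =>
      f (row_mx (z.1%:M : 'rV[R]_1) (z.2 : 'rV[R]_d) : 'rV[R]_(1 + d)))) => //.
    apply: (measurableT_comp mf); exact: (@measurable_row_mx d).
  by apply/funext => x; rewrite /G lebesgue_intE.
transitivity (\int[@lebesgue_measure R]_x G (x + w 0 0)%R)%E.
  apply: eq_integral => x _.
  rewrite /G -[RHS](IH _ (rsubmx (w : 'rV[R]_(1 + d))))//.
  congr lebesgue_int; apply/funext => y; congr f.
  have wE : (w : 'rV[R]_(1 + d)) = row_mx (w 0 0)%:M (rsubmx (w : 'rV[R]_(1 + d))).
    exact: row_mx_head.
  transitivity (row_mx x%:M y + row_mx (w 0 0)%:M (rsubmx (w : 'rV[R]_(1 + d)))).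
    by rewrite -wE.
  by rewrite add_row_mx -raddfD.
transitivity (\int[pushforward (@lebesgue_measure R)
    (fun x : measurableTypeR R => (x + w 0 0)%R : measurableTypeR R)]_x G x)%E.
  rewrite ge0_integral_pushforward// => x _; rewrite /G lebesgue_intE//.
  exact: integral_ge0.
by apply: eq_measure_integral => A mA _; exact: lebesgue_measureD.
Qed.

Lemma measurable_translate d (w : 'rV[R]_d) :
  measurable_fun setT (fun x : @borel R d => ((x : 'rV[R]_d) + w : borel d)).
Proof.
apply: measurable_fun_rV => i; apply: continuous_borel_measurable.
move=> x; rewrite (_ : (fun _ => _) = fun x : 'rV[R]_d => x 0 i + w 0 i); last first.
  by apply/funext => y; rewrite mxE.
apply: (@continuousD _ _ _ (fun y : 'rV[R]_d => y 0 i) (cst (w 0 i)) x).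
  exact: coord_continuous.
exact: cst_continuous.
Qed.

Lemma lebesgue_rV_translate d (w : 'rV[R]_d) (A : set (@borel R d)) : measurable A ->
  pushforward (lebesgue_rV d) (fun x : @borel R d => ((x : 'rV[R]_d) + w : borel d)) A = lebesgue_rV d A.
Proof.
move=> mA; have mi : measurable_fun setT (fun x : @borel R d => (\1_A x : R)%:E).
  by apply/measurable_EFinP; exact: measurable_indic.
have i0 (x : @borel R d) : (0 <= (\1_A x : R)%:E)%E by rewrite lee_fin.
have mi' := measurableT_comp mi (measurable_translate w).
have := lebesgue_int_translate w mi i0.
rewrite (lebesgue_intE mi i0) (lebesgue_intE mi')//.
rewrite [X in _ = X -> _]integral_indic// setIT => <-.
rewrite -[X in pushforward _ _ X]setIT -integral_indic//.
- exact: measurable_translate.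
- by move=> mt; rewrite ge0_integral_pushforward.
- by move=> x /=; rewrite lee_fin.
Qed.

Lemma integral_translate d (w : 'rV[R]_d) (f : @borel R d -> R) :
  (lebesgue_rV d).-integrable setT (EFin \o f) ->
  (lebesgue_rV d).-integrable setT (fun x => (f (x + w))%:E) /\
  (\int[lebesgue_rV d]_x (f (x + w))%:E = \int[lebesgue_rV d]_x (f x)%:E)%E.
Proof.
move=> fi; have mt := measurable_translate w.
have mf := measurable_int _ fi.
have fi' : (lebesgue_rV d).-integrable setT ((EFin \o f) \o
    (fun x : @borel R d => ((x : 'rV[R]_d) + w : borel d))).
  apply/integrableP; split; first exact: measurableT_comp.
  move/integrableP : fi => [_ fi]; apply: le_lt_trans fi.
  rewrite -[X in (_ <= X)%E](@eq_measure_integral _ _ _ _ _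
    (measure_function_pushforward__canonical__measure_function_Measure (lebesgue_rV d) mt)).
    by rewrite ge0_integral_pushforward//; exact: measurableT_comp.
  by move=> A mA _; exact: lebesgue_rV_translate.
split; first exact: fi'.
have := integral_pushforward mt mf fi' measurableT.
rewrite preimage_setT => <-//.
by apply: eq_measure_integral => A mA _; exact: lebesgue_rV_translate.
Qed.

Lemma continuous_compact_bounded d (f : 'rV[R]_d -> R) (K : set 'rV[R]_d) :
  compact K -> {within K, continuous f} ->
  exists C, 0 <= C /\ forall x, K x -> `|f x| <= C.
Proof.
move=> cK cf.
have [M [Mr MP]] := compact_bounded (continuous_compact cf cK).
exists (`|M| + 1); split; first by rewrite addr_ge0.
move=> x Kx; apply: MP; last by exists x.
by apply: (le_lt_trans (ler_norm _)); rewrite ltrDl.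
Qed.

Lemma integrable_bounded_support d (f : @borel R d -> R) (C r : R) :
  measurable_fun setT f ->
  (forall x, `|f x| <= C * \1_(ball (0 : 'rV[R]_d) r) x) ->
  (lebesgue_rV d).-integrable setT (EFin \o f).
Proof.
move=> mf fC; have mb := borel_ball (0 : 'rV[R]_d) r.
apply: (@le_integrable _ _ _ _ _ _ _
    (fun x : borel d => (C * \1_(ball (0 : 'rV[R]_d) r) x)%:E)) => //.
- exact/measurable_EFinP.
- move=> x _ /=; rewrite lee_fin (le_trans (fC x))// ler_norm//.
rewrite (_ : (fun _ => _) = fun x : borel d => (C%:E * (\1_(ball (0 : 'rV[R]_d) r) x)%:E)%E)//.
apply: integrableZl => //; apply/integrableP; split.
  by apply/measurable_EFinP; exact: measurable_indic.
under eq_integral do rewrite gee0_abs ?lee_fin//.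
rewrite integral_indic// setIT.
have [r0|r0] := ltP 0 r; last first.
  rewrite (_ : ball _ _ = set0) ?measure0//; apply/seteqP; split => // x.
  rewrite -ball_normE /ball_ /= => /lt_le_trans /(_ r0).
  by rewrite normr_lt0.
by rewrite [X in (X < _)%E](lebesgue_rV_ball (0 : 'rV[R]_d))// ltry.
Qed.

Lemma continuous_support_integrable d (h : 'rV[R]_d -> R) (M : R) : continuous h ->
  (forall x, M <= `|x| -> h x = 0) -> (lebesgue_rV d).-integrable setT (EFin \o (h : borel d -> R)).
Proof.
move=> ch h0; pose B := closed_ball (0 : 'rV[R]_d) (`|M| + 1).
have BE x : B x = (`|x| <= `|M| + 1) :> Prop.
  by rewrite /B closed_ballE// /closed_ball_ /= sub0r normrN.
have cB : compact B.
  apply: bounded_closed_compact; last exact: closed_ball_closed.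
  exists (`|M| + 1); split => // y /ltW My x; rewrite BE => /le_trans; exact.
have [C [C0 CP]] : exists C, 0 <= C /\ forall x, B x -> `|h x| <= C.
  by apply: continuous_compact_bounded => //; exact: continuous_subspaceT.
apply: (@integrable_bounded_support _ _ C (`|M| + 1)).
  exact: continuous_borel_measurable.
move=> x; rewrite indicE; case: (boolP (_ \in _)); rewrite ?mulr1 ?mulr0.
  by rewrite inE -ball_normE /ball_ /= sub0r normrN => xM; apply: CP; rewrite BE ltW.
move/negP; rewrite inE -ball_normE /ball_ /= sub0r normrN => /negP.
rewrite -leNgt => Mx; rewrite h0 ?normr0//.
by apply: le_trans Mx; rewrite (le_trans (ler_norm _))// lerDl.
Qed.

(** The difference quotients of [h] have integral [0] by translation invariance, and they converge
    to the derivative under a bound by a multiple of the indicator of a fixed ball. *)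
Lemma integral_derive_eq0 d (h : 'rV[R]_d -> R) (e : 'rV[R]_d) (M : R) :
  (forall x, differentiable h x) -> continuous ('D_e h) ->
  (forall x, M <= `|x| -> h x = 0) ->
  (\int[lebesgue_rV d]_x ('D_e h x)%:E = 0)%E.
Proof.
move=> dh cD h0.
have ch : continuous h by move=> x; exact/differentiable_continuous.
have dhe x : derivable h x e by exact: diff_derivable.
pose t (N : nat) : R := N.+1%:R^-1.
have t0 N : 0 < t N by rewrite invr_gt0.
have t1 N : t N <= 1 by rewrite invf_le1// ler1n.
have K0 : 0 < `|M| + `|e| + `|e| + 1 by rewrite ltr_wpDl// !addr_ge0.
(* The quotient at [x] vanishes unless [|x| < |M| + |e| + 1], and the mean value point is at
   distance at most [|e|] from [x]. *)
pose B := closed_ball (0 : 'rV[R]_d) (`|M| + `|e| + `|e| + 1).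
have BE x : B x = (`|x| <= `|M| + `|e| + `|e| + 1) :> Prop.
  by rewrite /B closed_ballE// /closed_ball_ /= sub0r normrN.
have cB : compact B.
  apply: bounded_closed_compact; last exact: closed_ball_closed.
  exists (`|M| + `|e| + `|e| + 1); split => // y /ltW My x; rewrite BE => /le_trans; exact.
have [C [C0 CP]] : exists C, 0 <= C /\ forall x, B x -> `|'D_e h x| <= C.
  by apply: continuous_compact_bounded => //; exact: continuous_subspaceT.
pose q N (x : borel d) : R := (t N)^-1 * (h ((x : 'rV[R]_d) + t N *: e) - h x).
have norm_te N : `|t N *: e| <= `|e|.
  by rewrite normrZ (ger0_norm (ltW (t0 N))) ler_piMl.
have supp x s : 0 <= s <= 1 -> `|M| + `|e| < `|x| -> h (x + s *: e) = 0.
  move=> /andP[s0 s1] Mx; apply: h0; rewrite -(opprK (s *: e)).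
  apply: le_trans (lerB_dist _ _); rewrite normrN normrZ lerBrDr (ger0_norm s0).
  apply: ltW; apply: le_lt_trans Mx.
  by rewrite lerD ?ler_norm// ler_piMl.
have qC N x : `|q N x| <= C * \1_(ball (0 : 'rV[R]_d) (`|M| + `|e| + 1)) x.
  rewrite indicE; case: (boolP (_ \in _)); rewrite ?mulr1 ?mulr0; last first.
    move/negP; rewrite inE -ball_normE /ball_ /= sub0r normrN => /negP.
    rewrite -leNgt => Mx.
    have Mx' : `|M| + `|e| < `|x : 'rV[R]_d| by apply: lt_le_trans Mx; rewrite ltrDl.
    rewrite /q supp ?(ltW (t0 N)) ?t1//.
    rewrite h0 ?subrr ?mulr0 ?normr0//.
    by apply: le_trans (ltW Mx'); rewrite (le_trans (ler_norm _))// lerDl.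
  rewrite inE -ball_normE /ball_ /= sub0r normrN => xM.
  have dl (s : R) := line_is_derive (dhe (x + s *: e)).
  have cl : continuous (fun s : R => h ((x : 'rV[R]_d) + s *: e)).
    by move=> s; apply/differentiable_continuous/derivable1_diffP; exact: ex_derive.
  have [c /itvP ct cE] := MVT (t0 N) (fun s _ => dl s) (continuous_subspaceT cl).
  rewrite subr0 scale0r addr0 in cE.
  rewrite /q cE mulrC mulfK ?gt_eqF// CP// BE.
  apply: le_trans (ler_normD _ _) _.
  rewrite -addrA [`|e| + 1]addrC addrA lerD ?(ltW xM)//.
  by rewrite normrZ ler_piMl// ger0_norm ?ct//; apply: le_trans (t1 N); rewrite ct.
have q_cvg x : q N x @[N --> \oo] --> 'D_e h x.
  have tcvg : t @ \oo --> (0 : R)^'.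
    move=> A A0; have := cvg_harmonic A0; rewrite /nbhs /=.
    by apply: filterS => N /(_ _); apply; rewrite gt_eqF.
  have /= := cvg_comp _ _ tcvg (dhe x).
  apply: cvg_trans; apply: near_eq_cvg; near=> N => /=.
  by rewrite /q [t N *: e + _]addrC.
have ctr (w : 'rV[R]_d) : continuous (fun y : 'rV[R]_d => h (y + w)).
  move=> y; apply: (@continuous_comp _ _ _ (fun y : 'rV[R]_d => y + w) h); last exact: ch.
  by apply: (@continuousD _ _ _ id (cst w) y); [exact: cvg_id|exact: cst_continuous].
have mq N : measurable_fun setT (q N).
  apply: measurable_funM => //; apply: measurable_funB.
    exact: (continuous_borel_measurable (ctr _)).
  exact: continuous_borel_measurable.
have mD : measurable_fun setT ('D_e h : borel d -> R).
  exact: continuous_borel_measurable.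
have hi := continuous_support_integrable ch h0.
have q0 N : (\int[lebesgue_rV d]_x (q N x)%:E = 0)%E.
  have [i1 i2] := integral_translate (t N *: e) hi.
  rewrite (_ : (fun _ => _) = fun x => ((t N)^-1%:E * ((h ((x : 'rV[R]_d) + t N *: e))%:E - (h x)%:E))%E)//.
  rewrite integralZl//; last exact: integrableB.
  by rewrite integralB// i2 subee ?mule0//; exact: integrable_fin_num.
have [] := @dominated_convergence _ _ _ (lebesgue_rV d) setT measurableT
  (fun N x => (q N x)%:E) (fun x => ('D_e h x)%:E)
  (fun x => (C * \1_(ball (0 : 'rV[R]_d) (`|M| + `|e| + 1)) x)%:E).
- by move=> N; exact/measurable_EFinP.
- exact/measurable_EFinP.
- by apply: aeW => x _; apply: cvg_EFin; [exact: nearW|exact: q_cvg].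
- apply: (@integrable_bounded_support _ _ C (`|M| + `|e| + 1)).
    apply: measurable_funM => //; apply: measurable_indic; exact: borel_ball.
  by move=> x; rewrite ger0_norm// mulr_ge0.
- by apply: aeW => x N _; rewrite lee_fin.
move=> _ _; under [X in X @ _ --> _]eq_fun do rewrite /= q0.
by move=> /(cvg_lim (@ereal_hausdorff _)) <-; exact: lim_cst.
Unshelve. all: by end_near. Qed.

End BorelMeasurability.

(** * Convex bodies and outward normals *)

Section Dot.
Context {R : realType}.

Lemma dotE d (v w : 'rV[R]_d) : dot v w = \sum_i v 0 i * w 0 i.
Proof. by rewrite /dot mxE; apply: eq_bigr => i _; rewrite mxE. Qed.

Lemma dotC d (v w : 'rV[R]_d) : dot v w = dot w v.
Proof. by rewrite !dotE; apply: eq_bigr => i _; rewrite mulrC. Qed.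

Lemma dotDl d (u v w : 'rV[R]_d) : dot (u + v) w = dot u w + dot v w.
Proof. by rewrite /dot mulmxDl mxE. Qed.

Lemma dotNl d (v w : 'rV[R]_d) : dot (- v) w = - dot v w.
Proof. by rewrite /dot mulNmx mxE. Qed.

Lemma dotBl d (u v w : 'rV[R]_d) : dot (u - v) w = dot u w - dot v w.
Proof. by rewrite dotDl dotNl. Qed.

Lemma dotZl d a (v w : 'rV[R]_d) : dot (a *: v) w = a * dot v w.
Proof. by rewrite /dot -scalemxAl mxE. Qed.

Lemma dotDr d (u v w : 'rV[R]_d) : dot w (u + v) = dot w u + dot w v.
Proof. by rewrite dotC dotDl !(dotC _ w). Qed.

Lemma dotNr d (v w : 'rV[R]_d) : dot w (- v) = - dot w v.
Proof. by rewrite dotC dotNl (dotC v). Qed.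

Lemma dotBr d (u v w : 'rV[R]_d) : dot w (u - v) = dot w u - dot w v.
Proof. by rewrite dotDr dotNr. Qed.

Lemma dotZr d a (v w : 'rV[R]_d) : dot w (a *: v) = a * dot w v.
Proof. by rewrite dotC dotZl (dotC v). Qed.

Lemma dot0l d (v : 'rV[R]_d) : dot 0 v = 0.
Proof. by rewrite /dot mul0mx mxE. Qed.

Lemma dot0r d (v : 'rV[R]_d) : dot v 0 = 0.
Proof. by rewrite dotC dot0l. Qed.

Lemma dot_delta d (v : 'rV[R]_d) i : dot v (delta_mx 0 i) = v 0 i.
Proof.
rewrite dotE (bigD1 i)//= big1 ?addr0; last first.
  by move=> j ji; rewrite mxE (negbTE ji) andbF mulr0.
by rewrite mxE !eqxx mulr1.
Qed.

Lemma dot_ge0 d (v : 'rV[R]_d) : 0 <= dot v v.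
Proof. by rewrite dotE sumr_ge0// => i _; rewrite -expr2 sqr_ge0. Qed.

Lemma dot_eq0 d (v : 'rV[R]_d) : (dot v v == 0) = (v == 0).
Proof.
apply/idP/eqP => [|->]; last by rewrite dot0l.
rewrite dotE psumr_eq0; last by move=> i _; rewrite -expr2 sqr_ge0.
move=> /allP h; apply/rowP => i; rewrite mxE.
by have := h i (mem_index_enum _); rewrite mulf_eq0 orbb => /eqP.
Qed.

Lemma dot_gt0 d (v : 'rV[R]_d) : (0 < dot v v) = (v != 0).
Proof. by rewrite lt_neqAle dot_ge0 andbT eq_sym dot_eq0. Qed.

Lemma enorm_ge0 d (v : 'rV[R]_d) : 0 <= enorm v.
Proof. exact: sqrtr_ge0. Qed.

Lemma sqr_enorm d (v : 'rV[R]_d) : enorm v ^+ 2 = dot v v.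
Proof. by rewrite sqr_sqrtr// dot_ge0. Qed.

Lemma enorm_le d (v : 'rV[R]_d) r : 0 <= r -> (enorm v <= r) = (dot v v <= r ^+ 2).
Proof. by move=> r0; rewrite -sqr_enorm ler_pXn2r// nnegrE enorm_ge0. Qed.

Lemma enorm_eq1 d (v : 'rV[R]_d) : enorm v = 1 <-> dot v v = 1.
Proof.
rewrite /enorm; split => [h|->]; last by rewrite sqrtr1.
by rewrite -sqr_enorm /enorm h expr1n.
Qed.

Lemma enorm_normalize d (v : 'rV[R]_d) : v != 0 -> enorm ((enorm v)^-1 *: v) = 1.
Proof.
move=> v0; apply/enorm_eq1; rewrite dotZl dotZr -sqr_enorm.
have e0 : enorm v != 0 by rewrite -sqrf_eq0 sqr_enorm dot_eq0.
by field.
Qed.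

Lemma continuous_dot (T : topologicalType) d (f g : T -> 'rV[R]_d) x :
  {for x, continuous f} -> {for x, continuous g} ->
  {for x, continuous (fun y => dot (f y) (g y))}.
Proof.
move=> cf cg; rewrite /prop_for /continuous_at /=.
rewrite (_ : (fun y => dot (f y) (g y)) = \sum_i (fun y => f y 0 i * g y 0 i)); last first.
  by apply/funext => y; rewrite dotE fct_sumE.
rewrite dotE.
elim/big_rec2 : _ => [|i a h _ IH]; first exact: cvg_cst.
apply: cvgD => //; apply: cvgM.
  apply: (@continuous_comp _ _ _ f (fun M : 'rV[R]_d => M 0 i)) => //; exact: coord_continuous.
apply: (@continuous_comp _ _ _ g (fun M : 'rV[R]_d => M 0 i)) => //; exact: coord_continuous.
Qed.

Lemma enorm_ge_norm d (v : 'rV[R]_d) : `|v| <= enorm v.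
Proof.
rewrite [leLHS]mx_normrE; apply/bigmax_leP; split; first exact: enorm_ge0.
move=> [i j] _ /=; rewrite ord1 -sqrtr_sqr ler_wsqrtr// dotE (bigD1 j)//= -expr2 lerDl.
by rewrite sumr_ge0// => k _; rewrite -expr2 sqr_ge0.
Qed.

Lemma dot_residual d (p v : 'rV[R]_d) : dot v v = 1 ->
  dot (p - dot p v *: v) (p - dot p v *: v) = dot p p - dot p v ^+ 2.
Proof.
move=> v1; rewrite !dotBl !dotBr !dotZl !dotZr v1 (dotC v p) mulr1 expr2; ring.
Qed.

Lemma dot_unit_le d (p v : 'rV[R]_d) : dot v v = 1 -> dot p v <= enorm p.
Proof.
move=> v1; rewrite (le_trans (ler_norm _))// -sqrtr_sqr ler_wsqrtr//.
by rewrite -subr_ge0 -(dot_residual _ v1) dot_ge0.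
Qed.

End Dot.

(** * Frames and the generalised cross product *)

Section Frame.
Context {R : realType} {n : nat}.
Implicit Types (v w : 'rV[R]_n.+1) (P : 'M[R]_(n, n.+1)).

Definition frame v P : 'M[R]_n.+1 :=
  \matrix_(i, j) if unlift ord0 i is Some a then P a j else v 0 j.

Lemma frame0 v P j : frame v P 0 j = v 0 j.
Proof. by rewrite mxE unlift_none. Qed.

Lemma frameS v P a j : frame v P (lift ord0 a) j = P a j.
Proof. by rewrite mxE liftK. Qed.

Lemma row_frame0 v P : row 0 (frame v P) = v.
Proof. by apply/rowP => j; rewrite mxE frame0. Qed.

Lemma row_frameS v P a : row (lift ord0 a) (frame v P) = row a P.
Proof. by apply/rowP => j; rewrite mxE frameS mxE. Qed.

(** Generalised cross product of the [n] rows of [P]: the cofactors along the first row of a frame.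
    The row [0] is a placeholder which these cofactors do not see; [dot_cross] is the characteristic
    property. *)
Definition cross P : 'rV[R]_n.+1 := \row_j cofactor (frame 0 P) 0 j.

Lemma cofactor_frame v w P j : cofactor (frame v P) 0 j = cofactor (frame w P) 0 j.
Proof.
rewrite /cofactor; congr (_ * \det _); apply/matrixP => a b.
by rewrite !mxE liftK.
Qed.

Lemma dot_cross P v : dot (cross P) v = \det (frame v P).
Proof.
rewrite dotE (expand_det_row _ 0); apply: eq_bigr => j _.
by rewrite mulrC mxE frame0 (cofactor_frame 0 v).
Qed.

Lemma det_frame_row P a : \det (frame (row a P) P) = 0.
Proof.
apply: (determinant_alternate (i1 := 0) (i2 := lift ord0 a)) => // j.
by rewrite frame0 frameS mxE.
Qed.

Lemma mul_cross P : P *m (cross P)^T = 0.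
Proof.
apply/colP => a; rewrite !mxE; have := det_frame_row P a.
by rewrite -dot_cross dotC dotE => E; rewrite -[RHS]E; apply: eq_bigr => j _; rewrite !mxE.
Qed.

Lemma dot_mulmx_cross P (c : 'rV[R]_n) : dot (c *m P) (cross P) = 0.
Proof. by rewrite /dot -mulmxA mul_cross mulmx0 mxE. Qed.

(** Some basis vector lies outside the row space of [P]. Together with the independent rows of [P]
    it forms a basis, whose determinant would vanish with the cross product. *)
Lemma cross_neq0 P : \rank P = n -> cross P != 0.
Proof.
move=> rP; apply/eqP => c0.
have [j nj] : exists j, ~~ ((delta_mx 0 j : 'rV[R]_n.+1) <= P)%MS.
  apply/existsP; rewrite -negb_forall; apply/negP => /forallP h.
  have : (1%:M <= P)%MS.
    by apply/row_subP => j; rewrite rowE mulmx1; exact: h.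
  by move=> /mxrankS; rewrite mxrank1 rP ltnn.
have : \det (frame (delta_mx 0 j) P) = 0 by rewrite -dot_cross c0 dot0l.
move/eqP/det0P => [u u0 uM].
have uE : u *m frame (delta_mx 0 j) P = u 0 0 *: delta_mx 0 j + (\row_a u 0 (lift ord0 a)) *m P.
  apply/rowP => l; rewrite mxE big_ord_recl frame0 !mxE.
  by congr (_ + _); apply: eq_bigr => a _; rewrite frameS !mxE.
have [u00|u00] := eqVneq (u 0 0) 0.
  move: uE; rewrite uM u00 scale0r add0r => /esym/eqP.
  have fP : row_free P by rewrite /row_free rP.
  rewrite mulmx_free_eq0// => /eqP ru; case/eqP: u0; apply/rowP => i; rewrite mxE.
  have [a ->|->] := unliftP ord0 i; last by [].
  by move/rowP : ru => /(_ a); rewrite !mxE.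
case/negP: nj; move: uE; rewrite uM => /esym/eqP; rewrite addr_eq0 => /eqP E.
rewrite -[delta_mx 0 j](scalerK u00) E scalemx_sub// eqmx_opp submxMl//.
Qed.

Lemma orthogonal_cross P w : \rank P = n -> dot (cross P) w = 0 -> exists c, w = c *m P.
Proof.
move=> rP h; apply/submxP.
have K : (P <= kermx (cross P)^T)%MS by apply/sub_kermxP; exact: mul_cross.
have rk : \rank (kermx (cross P)^T) = n.
  rewrite mxrank_ker mxrank_tr; have : (\rank (cross P) <= 1)%N by exact: rank_leq_row.
  have : (0 < \rank (cross P))%N by rewrite lt0n mxrank_eq0 cross_neq0.
  by case: (\rank _) => [//|[|//]] _ _; rewrite subn1.
have /eqmxP/eqmx_sym E : (P == kermx (cross P)^T)%MS by rewrite -(geq_leqif (mxrank_leqif_eq K)) rk rP.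
rewrite -E; apply/sub_kermxP; apply/rowP => i; rewrite !ord1 mxE [RHS]mxE.
by rewrite -[RHS]h dotC /dot mxE.
Qed.

Lemma parallel_cross P w : \rank P = n -> (forall c, dot w (c *m P) = 0) ->
  exists l, w = l *: cross P.
Proof.
move=> rP h; have N0 : dot (cross P) (cross P) != 0 by rewrite dot_eq0 cross_neq0.
pose l := dot w (cross P) / dot (cross P) (cross P); exists l.
have [c cE] : exists c, w - l *: cross P = c *m P.
  apply: orthogonal_cross => //; rewrite dotBr dotZr dotC.
  by rewrite /l divfK// subrr.
apply/eqP; rewrite -subr_eq0 -dot_eq0 [X in dot _ X]cE dotBl h dotZl.
by rewrite (dotC (cross P)) dot_mulmx_cross mulr0 subrr.
Qed.

End Frame.

Lemma row_jacobian {R : realType} m d (f : 'rV[R]_m -> 'rV[R]_d) x i : differentiable f x ->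
  row i ('J f x) = 'D_(delta_mx 0 i) f x.
Proof. by move=> df; rewrite deriveEjacobian// rowE. Qed.

Section Convex.
Context {R : realType} {n : nat} (Omega : set 'rV[R]_n.+1).
Hypothesis oO : open Omega.
Hypothesis cO : @convex_set R 'rV[R]_n.+1 Omega.
Implicit Types a b p w z v : 'rV[R]_n.+1.

Lemma convexE a b t : 0 <= t -> t <= 1 -> Omega a -> Omega b ->
  Omega (t *: a + (1 - t) *: b).
Proof.
move=> t0 t1 Oa Ob.
have tt : 0 <= t <= 1 by rewrite t0 t1.
by have := cO (Itv01 t0 t1) (mem_set Oa) (mem_set Ob); rewrite inE.
Qed.

Lemma boundaryP p : boundary Omega p <-> closure Omega p /\ ~ Omega p.
Proof. by rewrite /boundary /setD /mkset ((interior_id _).1 oO). Qed.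

(** Replacing [a] by a nearby point [a'] of Omega is compensated by moving [b] to [b'], which stays
    in Omega because Omega is open. *)
Lemma half_open a b t : closure Omega a -> Omega b -> 0 < t -> t <= 1 ->
  Omega ((1 - t) *: a + t *: b).
Proof.
move=> ca Ob t0 t1.
have /nbhs_ballP[e /= e0 eO] : nbhs b Omega by exact: open_nbhs_nbhs.
have [a' [Oa' aa']] := ca _ (nbhsx_ballx a (e * t) (mulr_gt0 e0 t0)).
pose b' := b + ((1 - t) / t) *: (a - a').
have Ob' : Omega b'.
  apply: eO; rewrite -ball_normE /ball_ /= /b' opprD addNKr normrN normrZ.
  rewrite ger0_norm ?divr_ge0 ?subr_ge0 ?(ltW t0)//.
  rewrite mulrAC ltr_pdivrMr//; move: aa'; rewrite -ball_normE /ball_ /=.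
  by apply: le_lt_trans; rewrite ler_piMl// gerBl ltW.
have -> : (1 - t) *: a + t *: b = t *: b' + (1 - t) *: a'.
  by apply/rowP => i; rewrite /b' !mxE; field; rewrite gt_eqF.
by apply: convexE => //; exact: ltW.
Qed.

Lemma tangentN S p w : tangent S p w -> tangent S p (- w).
Proof.
move=> [g [g0 Sg dg]]; exists (fun t => g (- t)); split.
- by rewrite oppr0.
- by have := @opp_continuous R^o 0; rewrite /continuous_at oppr0 => /(_ _ Sg).
- have dg1 : differentiable g (- 0 : R) by rewrite oppr0; apply/derivable1_diffP; case: dg.
  have dc : differentiable (g \o -%R) (0 : R) by exact: differentiable_comp.
  apply: DeriveDef; first exact/derivable1_diffP.
  rewrite -[(fun t => _)]/(g \o -%R) deriveE// diff_comp//= oppr0.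
  rewrite -(@derive_val _ _ _ _ _ _ _ dg) deriveE; last by rewrite -oppr0.
  by rewrite (_ : 'd -%R (0 : R) 1 = - 1) ?linearN// diff_val.
Qed.

(** The point is a convex combination of the boundary point [g t] and of a point [b] near [z]: the
    curve deviates from its tangent by [o(t)], while the weight [t * l] of [b] is of order [t]. Then
    [half_open] applies. *)
Lemma tangent_inward p w z l : tangent (boundary Omega) p w -> Omega z -> 0 < l ->
  \forall t \near (0 : R)^'+, Omega (p + t *: (w + l *: (z - p))).
Proof.
move=> [g [g0 Sg [dg dgw]]] Oz l0.
have /nbhs_ballP[e /= e0 eO] : nbhs z Omega by exact: open_nbhs_nbhs.
have cg : {for 0, continuous g} by exact/differentiable_continuous/derivable1_diffP.
have gq : (fun t : R => t^-1 *: (g t - p)) @ 0^' --> w.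
  rewrite -dgw (_ : (fun t => _) = (fun h => h^-1 *: ((g \o shift 0) (h *: 1) - g 0))).
    exact: dg.
  by apply/funext => h; rewrite /= addr0 /GRing.scale /= mulr1 g0.
have n1 : \forall t \near (0 : R)^'+, `|w - t^-1 *: (g t - p)| < l * (e / 2).
  have le0 : 0 < l * (e / 2) by rewrite mulr_gt0// divr_gt0.
  have gq' := cvg_dnbhs_at_right gq.
  by have /cvgrPdist_lt/(_ _ le0) := gq'.
have n2 : \forall t \near (0 : R)^'+, `|p - g t| < e / 2.
  have e20 : 0 < e / 2 by rewrite divr_gt0.
  have /cvgrPdist_lt/(_ _ e20) := cg; rewrite g0.
  exact: cvg_within.
have n3 : \forall t \near (0 : R)^'+, boundary Omega (g t) by exact: cvg_within Sg.
have n4 : \forall t \near (0 : R)^'+, t < l^-1 by apply: nbhs_right_lt; rewrite invr_gt0.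
near=> t.
have t0 : 0 < t by [].
pose b := z + (g t - p) + l^-1 *: (w - t^-1 *: (g t - p)).
have Ob : Omega b.
  apply: eO; rewrite -ball_normE /ball_ /= /b -addrA opprD addNKr normrN.
  rewrite [e]splitr (le_lt_trans (ler_normD _ _))// ltrD//.
    by rewrite distrC; near: t.
  rewrite normrZ gtr0_norm ?invr_gt0// ltr_pdivrMl//.
  by near: t.
have tl : t * l <= 1.
  by rewrite -ler_pdivlMr// div1r; apply: ltW; near: t.
have -> : p + t *: (w + l *: (z - p)) = (1 - t * l) *: g t + (t * l) *: b.
  by apply/rowP => i; rewrite !mxE; field; rewrite !gt_eqF.
apply: half_open => //; last by rewrite mulr_gt0.
have : boundary Omega (g t) by near: t.
by move/boundaryP => [].
Unshelve. all: by end_near. Qed.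

Lemma closure_halfspace v p y : (forall z, Omega z -> dot v (z - p) < 0) ->
  closure Omega y -> dot v (y - p) <= 0.
Proof.
move=> h cy; rewrite leNgt; apply/negP => pos.
have c : {for y, continuous (fun z => dot v (z - p))}.
  apply: continuous_dot; first exact: cst_continuous.
  by apply: (@continuousB _ _ _ id (cst p)); [exact: cvg_id|exact: cst_continuous].
have : nbhs y (fun z => 0 < dot v (z - p)) by exact: cvgr_gt c _ pos.
by move=> /cy [z [Oz]] /(lt_trans (h _ Oz)); rewrite ltxx.
Qed.

Lemma supporting_tangent v p w z0 : Omega z0 ->
  (forall z, Omega z -> dot v (z - p) <= 0) ->
  tangent (boundary Omega) p w -> dot v w = 0.
Proof.
move=> Oz0; wlog suff: w / (forall z, Omega z -> dot v (z - p) <= 0) ->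
    tangent (boundary Omega) p w -> dot v w <= 0.
  move=> H h tw; apply/eqP; rewrite eq_le H// -oppr_le0 -dotNr.
  by rewrite H//; exact: tangentN.
move=> h tw; rewrite leNgt; apply/negP => pos.
(* So small that the inward correction cannot change the sign of [dot v w]. *)
pose l := dot v w / 2 / (`|dot v (z0 - p)| + 1).
have D0 : 0 < `|dot v (z0 - p)| + 1 by rewrite ltr_wpDl.
have l0 : 0 < l by rewrite !divr_gt0.
have /filter_ex[t [Ot t0]] : \forall t \near (0 : R)^'+,
    Omega (p + t *: (w + l *: (z0 - p))) /\ 0 < t.
  near=> t; split; last by [].
  by near: t; exact: tangent_inward.
have := h _ Ot; rewrite addrC addKr dotZr pmulr_rle0// dotDr dotZr leNgt => /negP; apply.
have : `|l * dot v (z0 - p)| < dot v w.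
  rewrite normrM gtr0_norm// /l; set D := `|_| in D0 *.
  have -> : dot v w / 2 / (D + 1) * D = dot v w / 2 * (D / (D + 1)) by ring.
  apply: (@le_lt_trans _ _ (dot v w / 2)); last by rewrite ltr_pdivrMr// ltr_pMr// ltr1n.
  by rewrite ler_piMr ?divr_ge0 ?(ltW pos)// ler_pdivrMr// mul1r lerDl.
rewrite ltr_norml => /andP[+ _]; lra.
Unshelve. all: by end_near. Qed.

Section Chart.
Variables (U : set 'rV[R]_n) (phi : 'rV[R]_n -> 'rV[R]_n.+1).
Hypothesis chart : local_param (boundary Omega) U phi.

Let oU : open U. Proof. by case: chart. Qed.

Lemma chart_boundary x : U x -> boundary Omega (phi x).
Proof.
move=> Ux; case: chart => _ _ _ _ /(_ U oU (@subset_refl _ _)) [V _ VE].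
have : (phi @` U) (phi x) by exists x.
by rewrite VE => -[].
Qed.

Lemma chart_CkR k j : CkR k U (fun x => phi x 0 j).
Proof. by case: chart => _ /(_ k) /(Ck_coordP _ _ oU). Qed.

Lemma chart_differentiable x : U x -> differentiable phi x.
Proof. by move=> Ux; case: chart => _ /(_ 1%N) [+ _] _ _ _; exact. Qed.

Lemma chart_rank x : U x -> \rank ('J phi x) = n.
Proof. by case: chart => _ _ _ + _; exact. Qed.

Lemma chart_curve x c : U x ->
  curve_in (boundary Omega) (phi x) (fun t : R => phi (x + t *: c)) (c *m 'J phi x).
Proof.
move=> Ux; have dphi := chart_differentiable Ux.
split.
- by rewrite scale0r addr0.
- have cl : {for 0, continuous (fun t : R => x + t *: c)}.
    apply: (@continuousD _ _ _ (cst x) (fun t : R => t *: c)); first exact: cst_continuous.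
    by apply: (@continuousZl _ _ _ id c); exact: cvg_id.
  have : nbhs (x + 0 *: c) U by rewrite scale0r addr0; exact: open_nbhs_nbhs.
  by move=> /cl Ut; near=> t; apply: chart_boundary; near: t.
- have dl : is_diff (0 : R) (fun t : R => x + t *: c) (fun t : R => t *: c).
    have -> : (fun t : R => t *: c) = cst 0 + (fun t : R => t *: c) by rewrite add0r.
    by apply: (@is_diffD _ _ _ (cst x) (fun t : R => t *: c)).
  have dphi' : differentiable phi (x + 0 *: c) by rewrite scale0r addr0.
  have dc : differentiable (phi \o (fun t : R => x + t *: c)) (0 : R).
    exact: differentiable_comp.
  apply: DeriveDef; first exact/derivable1_diffP.
  rewrite -[(fun t => _)]/(phi \o (fun t : R => x + t *: c)) deriveE// diff_comp//=.
  by rewrite diff_val scale1r /jacobian mul_rV_lin1 scale0r addr0.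
Unshelve. all: by end_near. Qed.

Lemma chart_tangent x c : U x -> tangent (boundary Omega) (phi x) (c *m 'J phi x).
Proof. by move=> Ux; eexists; exact: chart_curve. Qed.

(** If [z - phi x] were tangent, [tangent_inward] with the opposite tangent vector and [l = 1] would
    place [phi x] itself in Omega. *)
Lemma chart_side x z : U x -> Omega z -> dot (cross ('J phi x)) (z - phi x) != 0.
Proof.
move=> Ux Oz; apply/eqP => E.
have [c cE] := orthogonal_cross (chart_rank Ux) E.
have /filter_ex[t] := tangent_inward (chart_tangent (- c) Ux) Oz ltr01.
by rewrite mulNmx -cE scale1r addNr scaler0 addr0; have /boundaryP[] := chart_boundary Ux.
Qed.

(** The sign of the cross product depends on the chart. The factor, nonzero for [z0] in Omega by
    [chart_side], turns the vector away from [z0] and depends smoothly on [x]. *)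
Definition outer z0 x : 'rV[R]_n.+1 :=
  - dot (cross ('J phi x)) (z0 - phi x) *: cross ('J phi x).

(** Were [z] and [z0] on different sides of the tangent hyperplane, the segment joining them would
    meet it inside Omega, contrary to [chart_side]. *)
Lemma outer_lt0 z0 z x : U x -> Omega z0 -> Omega z -> dot (outer z0 x) (z - phi x) < 0.
Proof.
move=> Ux Oz0 Oz; rewrite /outer dotZl mulNr oppr_lt0.
set N := cross _; set p := phi x.
have a0 : dot N (z0 - p) != 0 by exact: chart_side.
have a1 : dot N (z - p) != 0 by exact: chart_side.
rewrite lt_neqAle eq_sym mulf_neq0//= leNgt; apply/negP => neg.
pose d := dot N (z - p) - dot N (z0 - p).
have d0 : d != 0.
  rewrite subr_eq0; apply: contraTneq neg => ->; rewrite -leNgt -expr2; exact: sqr_ge0.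
pose t := dot N (z - p) / d.
have t01 : 0 <= t /\ t <= 1.
  have d2 : 0 < d ^+ 2 by rewrite lt_neqAle eq_sym sqrf_eq0 d0 sqr_ge0.
  have tE : t = dot N (z - p) * d / d ^+ 2 by rewrite /t; field.
  rewrite tE; split; first by rewrite divr_ge0 ?(ltW d2)// /d; nra.
  by rewrite ler_pdivrMr// mul1r /d; nra.
have := chart_side Ux (convexE t01.1 t01.2 Oz0 Oz); case/eqP.
rewrite -/N -/p (_ : _ - p = t *: (z0 - p) + (1 - t) *: (z - p)); last first.
  by apply/rowP => i; rewrite !mxE; ring.
by rewrite dotDr !dotZr /t /d; field.
Qed.

Lemma outer_neq0 z0 x : U x -> Omega z0 -> outer z0 x != 0.
Proof.
move=> Ux Oz; have := outer_lt0 Ux Oz Oz.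
by apply: contraTneq => ->; rewrite dot0l ltxx.
Qed.

Lemma outer_orth z0 x c : dot (outer z0 x) (c *m 'J phi x) = 0.
Proof. by rewrite /outer dotZl [X in _ * X]dotC dot_mulmx_cross mulr0. Qed.

Lemma chart_tangentP x w : U x ->
  dot (cross ('J phi x)) w = 0 -> tangent (boundary Omega) (phi x) w.
Proof.
by move=> Ux /(orthogonal_cross (chart_rank Ux))[c ->]; exact: chart_tangent.
Qed.

(** An outward normal is a multiple [m *: W] of [W = outer phi z0 x]. For [m < 0] it would be the
    sum of a tangent vector and an inward one, and would enter Omega. *)
Lemma chart_normal z0 x : U x -> Omega z0 ->
  normal Omega (phi x) = (enorm (outer z0 x))^-1 *: outer z0 x.
Proof.
move=> Ux Oz0; set W := outer z0 x; set p := phi x.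
have W0 : W != 0 by exact: outer_neq0.
have eW0 : 0 < enorm W by rewrite lt_neqAle enorm_ge0 andbT eq_sym -sqrf_eq0 sqr_enorm dot_eq0.
have Wlt z : Omega z -> dot W (z - p) < 0 by exact: outer_lt0.
apply: xget_unique.
  split.
  - exact: enorm_normalize.
  - move=> w tw; rewrite dotZl (supporting_tangent Oz0 _ tw) ?mulr0// => z Oz.
    exact/ltW/Wlt.
  - near=> t => /(closure_halfspace Wlt).
    rewrite addrC addKr dotZr dotZr -sqr_enorm leNgt => /negP; apply.
    by rewrite !mulr_gt0 ?invr_gt0 ?exprn_gt0.
move=> v [v1 vt vo].
have [l lE] : exists l, v = l *: cross ('J phi x).
  apply: parallel_cross; first exact: chart_rank.
  by move=> c; apply: vt; exact: chart_tangent.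
have h0 : - dot (cross ('J phi x)) (z0 - p) != 0 by rewrite oppr_eq0; exact: chart_side.
pose m := l / (- dot (cross ('J phi x)) (z0 - p)).
have vE : v = m *: W by rewrite lE /W /outer scalerA /m divfK.
have mW : `|m| = (enorm W)^-1.
  move/enorm_eq1 : v1; rewrite vE dotZl dotZr -sqr_enorm => E.
  apply: (mulIf (lt0r_neq0 eW0)); rewrite mulVf ?gt_eqF//.
  rewrite -[enorm W]ger0_norm ?enorm_ge0// -normrM.
  by apply/eqP; rewrite -sqrp_eq1// real_normK ?num_real// exprMn expr2 -mulrA E.
have m0 : 0 < m.
  rewrite ltNge; apply/negP => mle.
  have {}mle : m < 0.
    by rewrite lt_neqAle mle andbT -normr_eq0 mW invr_eq0 gt_eqF.
  (* Chosen so that [v - k *: (z0 - p)] is orthogonal to [W], hence tangent. *)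
  pose k := m * dot W W / dot W (z0 - p).
  have k0 : 0 < k.
    rewrite /k nmulr_rgt0 ?invr_lt0 ?Wlt//.
    by rewrite nmulr_rlt0// dot_gt0.
  have tw : tangent (boundary Omega) p (v - k *: (z0 - p)).
    apply: chart_tangentP => //; apply: (mulfI h0); rewrite mulr0 -dotZl -/(outer z0 x) -/W.
    rewrite dotBr dotZr /k divfK ?lt_eqF ?Wlt// vE dotZr subrr//.
  have /filter_ex[t [Ot nt]] : \forall t \near (0 : R)^'+,
      Omega (p + t *: v) /\ ~ closure Omega (p + t *: v).
    near=> t; split; near: t; last exact: vo.
    have := tangent_inward tw Oz0 k0.
    by rewrite subrK.
  by apply: nt; exact: subset_closure.
by rewrite vE -mW gtr0_norm.
Unshelve. all: by end_near. Qed.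

Lemma chart_normal_CkR k j : Omega !=set0 -> CkR k U (fun x => normal Omega (phi x) 0 j).
Proof.
move=> [z0 Oz0].
have CJ i l : CkR k U (fun x => 'J phi x i l).
  apply: CkR_eq ((chart_CkR k.+1 l).2 i) => // x Ux.
  rewrite -derive_entry; last exact/diff_derivable/chart_differentiable.
  by rewrite -row_jacobian ?mxE//; exact: chart_differentiable.
have Cc l : CkR k U (fun x => cross ('J phi x) 0 l).
  pose f x := (-1) ^+ l * \det (row' 0 (col' l (frame 0 ('J phi x)))).
  apply: (@CkR_eq _ _ _ oU _ f) => [x Ux|]; first by rewrite mxE /cofactor add0n.
  apply: CkR_mul => //; first exact: CkR_cst.
  apply: CkR_det => // a b.
  apply: CkR_eq (CJ a (lift l b)) => // x Ux.
  by rewrite [RHS]mxE [RHS]mxE frameS.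
pose h x := - (\sum_l cross ('J phi x) 0 l * (z0 0 l - phi x 0 l)).
have Ch : CkR k U h.
  apply: CkR_opp => //; apply: CkR_sum => // l _; apply: CkR_mul => //.
  by apply: CkR_sub => //; [exact: CkR_cst|exact: chart_CkR].
have Co l : CkR k U (fun x => outer z0 x 0 l).
  apply: CkR_eq (CkR_mul oU Ch (Cc l)) => // x Ux.
  rewrite /outer [RHS]mxE /h dotE; congr (- _ * _); apply: eq_bigr => i _.
  by rewrite [(z0 - _) 0 i]mxE [(- phi x) 0 i]mxE.
pose q x := \sum_l outer z0 x 0 l * outer z0 x 0 l.
have Cq : CkR k U q by apply: CkR_sum => // l _; exact: CkR_mul.
have Cs : CkR k U (fun x => (Num.sqrt (q x))^-1).
  apply: CkR_inv => // [x Ux|].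
    by rewrite gt_eqF// sqrtr_gt0 /q -dotE dot_gt0 outer_neq0.
  apply: CkR_sqrt => // x Ux; by rewrite /q -dotE dot_gt0 outer_neq0.
apply: CkR_eq (CkR_mul oU Cs (Co j)) => // x Ux.
by rewrite (chart_normal Ux Oz0) [RHS]mxE /enorm dotE.
Qed.

End Chart.

Section Boundary.
Hypothesis sS : smooth_hypersurface (boundary Omega).
Hypothesis O0 : Omega !=set0.

(** The last clause is how normals are identified later: any nonzero [v] whose hyperplane supports
    Omega at [p] is a positive multiple of the normal. *)
Lemma normal_spec p : boundary Omega p ->
  [/\ dot (normal Omega p) (normal Omega p) = 1,
     (forall z, Omega z -> dot (normal Omega p) (z - p) < 0) &
     (forall v, (forall z, Omega z -> dot v (z - p) <= 0) -> v != 0 ->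
        normal Omega p = (enorm v)^-1 *: v)].
Proof.
move=> /sS[U [phi [ch [x Ux <-]]]]; have [z0 Oz0] := O0.
set W := outer phi z0 x.
have W0 : W != 0 by exact: (outer_neq0 ch).
have eW0 : 0 < enorm W by rewrite lt_neqAle enorm_ge0 andbT eq_sym -sqrf_eq0 sqr_enorm dot_eq0.
have nE := chart_normal ch Ux Oz0; rewrite -/W in nE.
have h1 z : Omega z -> dot (normal Omega (phi x)) (z - phi x) < 0.
  by move=> Oz; rewrite nE dotZl pmulr_rlt0 ?invr_gt0// (outer_lt0 ch).
have h2 : dot (normal Omega (phi x)) (normal Omega (phi x)) = 1.
  by apply/enorm_eq1; rewrite nE enorm_normalize.
split => // v vle v0.
have [l lE] : exists l, v = l *: cross ('J phi x).
  apply: parallel_cross; first exact: (chart_rank ch).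
  by move=> c; apply: (supporting_tangent Oz0 vle); exact: (chart_tangent ch).
have d0 : - dot (cross ('J phi x)) (z0 - phi x) != 0.
  by rewrite oppr_eq0; exact: (chart_side ch).
pose m := l / (- dot (cross ('J phi x)) (z0 - phi x)).
have vE : v = m *: W by rewrite lE /W /outer scalerA /m divfK.
have m0 : 0 < m.
  rewrite lt_neqAle; apply/andP; split.
    by rewrite eq_sym; apply: contraNneq v0 => m0; rewrite vE m0 scale0r.
  have := vle _ Oz0; rewrite vE dotZl.
  by rewrite nmulr_lle0// (outer_lt0 ch).
rewrite nE vE /enorm dotZl dotZr mulrA -expr2 sqrtrM ?sqr_ge0// sqrtr_sqr gtr0_norm//.
rewrite [RHS]scalerA; move: eW0; rewrite /enorm; set e := Num.sqrt _ => e0.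
by have -> : (m * e)^-1 * m = e^-1 by field; rewrite !gt_eqF.
Qed.

(** With the right [l > 0], the vector [v] is the sum of a tangent vector and of [l *: (z0 - p)]. *)
Lemma inward p v : boundary Omega p -> dot (normal Omega p) v < 0 ->
  exists2 t, 0 < t & Omega (p + t *: v).
Proof.
move=> bp nv; have [n1 nlt _] := normal_spec bp.
have [z0 Oz0] := O0.
move: (bp) => /sS[U [phi [ch [x Ux xE]]]].
pose l := dot (normal Omega p) v / dot (normal Omega p) (z0 - p).
have l0 : 0 < l by rewrite /l nmulr_rgt0 ?invr_lt0// nlt.
have tw : tangent (boundary Omega) p (v - l *: (z0 - p)).
  rewrite -xE; apply: (chart_tangentP ch Ux).
  have nE := chart_normal ch Ux Oz0.
  pose k := (enorm (outer phi z0 x))^-1 * - dot (cross ('J phi x)) (z0 - phi x).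
  have nk : normal Omega p = k *: cross ('J phi x).
    by rewrite -xE nE /outer scalerA.
  have k0 : k != 0.
    by apply: contra_eq_neq n1 => k0; rewrite nk k0 scale0r dot0l eq_sym oner_eq0.
  apply: (mulfI k0); rewrite mulr0 -dotZl -nk xE dotBr dotZr /l divfK ?subrr//.
  by rewrite lt_eqF// nlt.
have /filter_ex[t [Ot t0]] : \forall t \near (0 : R)^'+, Omega (p + t *: v) /\ 0 < t.
  near=> t; split; last by [].
  by near: t; have := tangent_inward tw Oz0 l0; rewrite subrK.
by exists t.
Unshelve. all: by end_near. Qed.

Lemma segment_boundary a b : Omega a -> ~ Omega b ->
  exists s, [/\ 0 < s, s <= 1 & boundary Omega ((1 - s) *: a + s *: b)].
Proof.
move=> Oa nOb.
pose c s : 'rV[R]_n.+1 := (1 - s) *: a + s *: b.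
have cc : continuous c.
  rewrite (_ : c = fun s : R => a + s *: (b - a)); last first.
    by apply/funext => s; apply/rowP => i; rewrite /c !mxE; ring.
  move=> s; apply: (@continuousD _ _ _ (cst a) (fun t : R => t *: (b - a))).
    exact: cst_continuous.
  by apply: (@continuousZl _ _ _ id (b - a)); exact: cvg_id.
pose S := [set s : R | 0 <= s <= 1 /\ Omega (c s)].
have c0 : c 0 = a by rewrite /c subr0 scale1r scale0r addr0.
have c1 : c 1 = b by rewrite /c subrr scale1r scale0r add0r.
have S0 : S 0 by split; rewrite ?lexx ?ler01// c0.
have uS : ubound S 1 by move=> s [/andP[]].
have hS : has_sup S by split; [exists 0|exists 1].
have s1 : sup S <= 1 by apply: ge_sup => //; exists 0.
have s0 : 0 <= sup S by apply: ub_le_sup => //; exists 1.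
have nO : ~ Omega (c (sup S)).
  move=> Oc; have slt : sup S < 1.
    by rewrite lt_neqAle s1 andbT; apply/eqP => E; rewrite E c1 in Oc.
  have : nbhs (sup S) (c @^-1` Omega) by apply: cc; exact: open_nbhs_nbhs.
  move=> /nbhs_ballP[e /= e0 eO].
  pose s := Num.min (sup S + e / 2) 1.
  have ss : sup S < s by rewrite lt_min slt ltrDl divr_gt0.
  have : S s.
    split; first by rewrite (ltW (le_lt_trans s0 ss))/= ge_min lexx orbT.
    apply: eO; rewrite -ball_normE /ball_ /= distrC gtr0_norm ?subr_gt0//.
    rewrite ltrBlDl (@le_lt_trans _ _ (sup S + e / 2))//; first by rewrite ge_min lexx.
    by rewrite ltrD2l ltr_pdivrMr// ltr_pMr// ltr1n.
  move=> Ss; have : s <= sup S by apply: ub_le_sup => //; exists 1.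
  by rewrite leNgt ss.
exists (sup S); split => //.
  by rewrite lt_neqAle s0 andbT; apply/eqP => E; apply: nO; rewrite -E c0.
apply/boundaryP; split => // B /(cc _) /nbhs_ballP[e /= e0 eB].
have [s Ss se] := sup_adherent e0 hS.
exists (c s); split; first exact: Ss.2.
apply: eB; rewrite -ball_normE /ball_ /= ger0_norm ?subr_ge0; last by apply: ub_le_sup => //; exists 1.
by rewrite ltrBlDr -ltrBlDl.
Qed.

Lemma boundary_closed : closed (boundary Omega).
Proof.
rewrite /boundary setDE; apply: closedI; first exact: closed_closure.
by apply: open_closedC; exact: open_interior.
Qed.

Hypothesis bO : bounded_set Omega.

Lemma boundary_compact : compact (boundary Omega).
Proof.
apply: bounded_closed_compact; last exact: boundary_closed.
have [M [Mr MO]] := bO; exists M; split => // m Mm p /boundaryP[cp _].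
have cl : closed [set x : 'rV[R]_n.+1 | `|x| <= m].
  rewrite (_ : [set x | _] = (fun x : 'rV[R]_n.+1 => `|x|) @^-1` [set y | y <= m])//.
  by apply: closed_comp => [x _|]; [exact: norm_continuous|exact: closed_le].
apply: cl; apply: closureS cp => x Ox; exact: MO.
Qed.

Lemma ray_boundary y : Omega y -> y != 0 -> exists2 t, 1 <= t & boundary Omega (t *: y).
Proof.
move=> Oy y0; have [M [Mr MO]] := bO.
have ny : 0 < `|y| by rewrite normr_gt0.
pose t := (`|M| + 2) / `|y| + 1.
have t1 : 1 <= t by rewrite lerDr divr_ge0// addr_ge0.
have nO : ~ Omega (t *: y).
  have M1 : M < `|M| + 1 by rewrite (le_lt_trans (ler_norm _))// ltrDl.
  move=> /(MO _ M1) /=; rewrite normrZ ger0_norm; last exact: le_trans ler01 t1.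
  rewrite /t mulrDl divfK ?gt_eqF// mul1r => h; lra.
have [s [s0 s1 bs]] := segment_boundary Oy nO.
exists (1 + s * (t - 1)); first by rewrite lerDl mulr_ge0 ?subr_ge0// ltW.
rewrite (_ : _ *: y = (1 - s) *: y + s *: (t *: y))//.
by rewrite scalerA -scalerDl; congr (_ *: _); ring.
Qed.

Lemma omega_enorm_le r y : 0 <= r -> (forall z, boundary Omega z -> enorm z <= r) ->
  Omega y -> enorm y <= r.
Proof.
move=> r0 h Oy; have [->|y0] := eqVneq y 0; first by rewrite /enorm dot0l sqrtr0.
have [t t1 bt] := ray_boundary Oy y0; apply: le_trans (h _ bt).
rewrite /enorm ler_wsqrtr// dotZl dotZr mulrA ler_peMl ?dot_ge0//.
by rewrite mulr_ege1.
Qed.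

(* Were 0 outside Omega, the touching points of the circumscribed sphere would lie
   strictly on one side of a hyperplane through 0, and moving the centre to that
   side would shrink the sphere. *)
Lemma circumcenter_inside r : is_circumscribed (boundary Omega) 0 r -> Omega 0.
Proof.
move=> [rP rmin]; apply: contrapT => nO.
have [z0 Oz0] := O0.
have [s [s0 s1 bp]] := segment_boundary Oz0 nO.
set p := (1 - s) *: z0 + s *: 0 in bp.
have pE : p = (1 - s) *: z0 by rewrite /p scaler0 addr0.
have [_ nlt _] := normal_spec bp.
pose v := - normal Omega p.
have vpos z : Omega z -> 0 < dot v z.
  move=> Oz; have := nlt _ Oz; have := nlt _ Oz0; rewrite /v dotNl !dotBr pE dotZr.
  by set A := dot _ z0; set B := dot _ z => h1 h2; nra.
have vge z : boundary Omega z -> 0 <= dot v z.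
  move=> /boundaryP[cz _].
  have h z' : Omega z' -> dot (- v) (z' - 0) < 0.
    by move=> Oz'; rewrite subr0 dotNl oppr_lt0; exact: vpos.
  by have := closure_halfspace h cz; rewrite subr0 dotNl oppr_le0.
have r0 : 0 <= r by apply: le_trans (rP _ bp); exact: enorm_ge0.
have inball y : Omega y -> dot y y <= r ^+ 2.
  by move=> Oy; rewrite -enorm_le//; apply: omega_enorm_le Oy => // q /rP; rewrite subr0.
have rP' z : boundary Omega z -> dot z z <= r ^+ 2.
  by move=> /rP; rewrite subr0 enorm_le.
(* On the boundary both parts are nonnegative, and [h] could vanish only at a touching point of the
   sphere on the hyperplane orthogonal to [v]. Its minimum measures how far the centre can be
   moved. *)
pose h z : R := r ^+ 2 - dot z z + dot v z.
have hpos z : boundary Omega z -> 0 < h z.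
  move=> bz; have h1 := rP' _ bz; have h2 := vge _ bz.
  rewrite /h lt_neqAle addr_ge0 ?subr_ge0// andbT eq_sym; apply/negP => /eqP E.
  have zr : dot z z = r ^+ 2 by lra.
  have vz : dot v z = 0 by lra.
  have [nz nzlt nzu] := normal_spec bz.
  have vn0 : - v != 0.
    by rewrite oppr_eq0; apply: contraTneq (vpos _ Oz0) => ->; rewrite dot0l ltxx.
  (* At a zero of [h] two supporting hyperplanes would determine the normal, that orthogonal to [v]
     through [0] and that tangent to the ball; but [dot v z = 0] makes their normals orthogonal. *)
  have n1 : normal Omega z = (enorm (- v))^-1 *: (- v).
    apply: nzu => // y Oy; rewrite dotNl dotBr vz subr0 oppr_le0; exact/ltW/vpos.
  have nz0 : dot (normal Omega z) z = 0 by rewrite n1 dotZl dotNl vz oppr0 mulr0.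
  have [z00|z00] := eqVneq z 0.
    have := inball _ Oz0; rewrite -zr z00 dot0l => zz.
    have {}zz : z0 = 0 by apply/eqP; rewrite -dot_eq0 eq_le zz dot_ge0.
    by have := vpos _ Oz0; rewrite zz dot0r ltxx.
  have n2 : normal Omega z = (enorm z)^-1 *: z.
    apply: nzu => // y Oy; have := inball _ Oy; have := dot_ge0 (y - z).
    by rewrite !(dotBr, dotBl) zr (dotC y z) => *; lra.
  have ez : enorm z != 0 by rewrite -sqrf_eq0 sqr_enorm dot_eq0.
  by move: nz0; rewrite n2 dotZl => /eqP; rewrite mulf_eq0 invr_eq0 (negbTE ez) dot_eq0 (negbTE z00).
have ch : {within boundary Omega, continuous h}.
  apply: continuous_subspaceT => z; rewrite /h.
  apply: (@continuousD _ _ _ (fun z : 'rV[R]_n.+1 => r ^+ 2 - dot z z) (dot v)).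
    apply: (@continuousB _ _ _ (cst (r ^+ 2)) (fun z => dot z z)); first exact: cst_continuous.
    by apply: continuous_dot; exact: cvg_id.
  by apply: continuous_dot; [exact: cst_continuous|exact: cvg_id].
have [m bm mP] := EVT_min_rV (ex_intro _ _ bp) boundary_compact ch.
(* With [2 * e <= 1] and [2 * e <= h z], moving the centre to [e *: v] lowers every squared distance
   to at most [r ^ 2 - e ^ 2]. *)
pose e := Num.min 1 (h m) / 2.
have e0 : 0 < e by rewrite divr_gt0// lt_min ltr01 hpos//; rewrite inE in bm.
have e1 : 2 * e <= 1 by rewrite /e mulrCA mulfV// mulr1 ge_min lexx.
have eh : 2 * e <= h m by rewrite /e mulrCA mulfV// mulr1 ge_min lexx orbT.
have v1 : dot v v = 1.
  by rewrite /v dotNl dotNr opprK; have [] := normal_spec bp.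
have key z : boundary Omega z -> dot (z - e *: v) (z - e *: v) <= r ^+ 2 - e ^+ 2.
  move=> bz; have := mP z (mem_set bz); have := rP' _ bz; have := vge _ bz.
  rewrite !(dotBr, dotBl, dotZr, dotZl) v1 (dotC z v) /h in eh *.
  set A := dot z z; set B := dot v z; set C := r ^+ 2 - _ + _ in eh * => h1 h2 h3.
  by nra.
have : r <= Num.sqrt (r ^+ 2 - e ^+ 2).
  by apply: (rmin (e *: v)) => z bz; rewrite /enorm ler_wsqrtr// key.
rewrite leNgt => /negP; apply.
rewrite -[ltRHS](ger0_norm r0) -sqrtr_sqr ltr_sqrt.
  by rewrite gtrDl oppr_lt0 exprn_gt0.
have := le_trans (dot_ge0 _) (key _ bp); have := exprn_gt0 2 e0; lra.
Qed.

End Boundary.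

End Convex.

(** * Newton tensors *)

Section DeterminantRows.
Context {R : realType} {m : nat}.
Implicit Types (M : 'M[R]_m) (v w : 'rV[R]_m).

Lemma row_setrow i v M : row i (setrow i v M) = v.
Proof. by apply/rowP => j; rewrite !mxE eqxx. Qed.

Lemma setrow_row i M : setrow i (row i M) M = M.
Proof. by apply/matrixP => a b; rewrite !mxE; case: eqP => // ->. Qed.

Lemma setrow_setrow i v w M : setrow i v (setrow i w M) = setrow i v M.
Proof. by apply/matrixP => a b; rewrite !mxE; case: eqP. Qed.

Lemma setrowC i j v w M : i != j -> setrow i v (setrow j w M) = setrow j w (setrow i v M).
Proof.
move=> ij; apply/matrixP => a b; rewrite !mxE.
by case: (eqVneq a i) => // ->; rewrite (negbTE ij).
Qed.

Lemma det_setrow i v M : \det (setrow i v M) = (v *m \adj M) 0 i.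
Proof.
rewrite (expand_det_row _ i) mxE; apply: eq_bigr => j _.
rewrite !mxE eqxx; congr (_ * _); rewrite /cofactor; congr (_ * \det _).
by apply/matrixP => a b; rewrite !mxE eq_sym (negbTE (neq_lift _ _)).
Qed.

Lemma det_setrowD i v w M :
  \det (setrow i (v + w) M) = \det (setrow i v M) + \det (setrow i w M).
Proof. by rewrite !det_setrow mulmxDl mxE. Qed.

Lemma det_setrowZ i c v M : \det (setrow i (c *: v) M) = c * \det (setrow i v M).
Proof. by rewrite !det_setrow -scalemxAl mxE. Qed.

Lemma det_setrow_swap i j v w M : i != j ->
  \det (setrow i v (setrow j w M)) = - \det (setrow i w (setrow j v M)).
Proof.
move=> ij.
have eq0 u : \det (setrow i u (setrow j u M)) = 0.
  apply: (determinant_alternate ij) => l; rewrite !mxE eqxx eq_sym (negbTE ij) eqxx//.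
have := eq0 (v + w); rewrite det_setrowD !(setrowC _ _ _ ij) !det_setrowD.
rewrite -!(setrowC _ _ _ ij) !eq0 add0r addr0 => /eqP; rewrite addr_eq0 => /eqP ->.
by [].
Qed.

Lemma det_orth_eq0 v M : v != 0 -> M *m v^T = 0 -> \det M = 0.
Proof.
move=> v0 Mv; rewrite -det_tr; apply/eqP/det0P; exists v => //.
by rewrite -[v]trmxK -trmx_mul Mv trmx0.
Qed.

Lemma mxtrace_mul_row M N : \tr (M *m N) = \sum_i (row i M *m N) 0 i.
Proof. by apply: eq_bigr => i _; rewrite -row_mul [RHS]mxE. Qed.

Lemma adj_unit M : M \in unitmx -> \adj M = \det M *: invmx M.
Proof. by move=> uM; rewrite /invmx uM scalerA mulrV ?scale1r// -unitmxE. Qed.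

End DeterminantRows.

(** * Pointwise algebra of the divergence on a parallel hypersurface *)

Section DivergenceAlgebra.
Context {R : realType} {n : nat}.
Variables (nu Z : 'rV[R]_n.+1) (P : 'M[R]_(n, n.+1)) (A DZ : 'M[R]_n.+1) (s : R).
Hypotheses (nu1 : dot nu nu = 1) (nuA : nu *m A = 0) (Anu : A *m nu^T = 0)
  (Pnu : P *m nu^T = 0).

(** [G] is the differential of [p + s nu p] along the hypersurface; [M0] and [M] are the frames of
    the hypersurface and of its parallel, which share the normal [nu]. *)
Let G := 1%:M + s *: A.
Let M0 := frame nu P.
Let M := frame nu (P *m G).
Hypotheses (uM0 : M0 \in unitmx) (uG : G \in unitmx).

Lemma frameE : M = M0 *m G.
Proof.
apply/row_matrixP => i; rewrite row_mul; have [a ->|->] := unliftP ord0 i.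
  by rewrite !row_frameS row_mul.
by rewrite !row_frame0 /G mulmxDr mulmx1 -scalemxAr nuA scaler0 addr0.
Qed.

Let uM : M \in unitmx.
Proof. by rewrite frameE unitmx_mul uM0. Qed.

Let adjM : \adj M = \det M *: (invmx G *m invmx M0).
Proof.
rewrite adj_unit//; congr (_ *: _); apply: (can_inj (mulKmx uM)).
by rewrite mulmxV// [in RHS]frameE mulmxA -(mulmxA M0) mulmxV// mulmx1 mulmxV.
Qed.

Let Mnu a : (M *m nu^T) (lift ord0 a) 0 = 0.
Proof.
have -> : (M *m nu^T) (lift ord0 a) 0 = (row a (P *m G) *m nu^T) 0 0.
  transitivity (row (lift ord0 a) (M *m nu^T) 0 0); first by rewrite [RHS]mxE.
  by rewrite row_mul /M row_frameS.
rewrite -row_mul -mulmxA /G mulmxDl mul1mx -scalemxAl Anu scaler0 addr0 Pnu.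
by rewrite !mxE.
Qed.

Let nu0 : nu != 0.
Proof. by rewrite -dot_eq0 nu1 oner_eq0. Qed.

(** Only the component of [v] along [nu] counts: without it all [n.+1] rows are orthogonal to [nu],
    hence dependent. *)
Lemma det_setrow0 v N : row 0 N = nu -> (forall a, row (lift ord0 a) N *m nu^T = 0) ->
  \det (setrow 0 v N) = dot v nu * \det N.
Proof.
move=> N0 NS; rewrite -{1}(subrK (dot v nu *: nu) v) det_setrowD det_setrowZ.
have -> : setrow 0 nu N = N by rewrite -{1}N0 setrow_row.
rewrite (@det_orth_eq0 _ _ nu) ?add0r ?nu0//.
apply/row_matrixP => i; rewrite row_mul row0; have [a ->|->] := unliftP ord0 i.
  by rewrite -(NS a); congr (_ *m _); apply/rowP => j; rewrite !mxE.
rewrite row_setrow; apply/rowP => j; rewrite !ord1 mxE [RHS]mxE.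
transitivity (dot (v - dot v nu *: nu) nu); last by rewrite dotBl dotZl nu1 mulr1 subrr.
by rewrite /dot [RHS]mxE.
Qed.

(** [dM a] is the derivative in direction [a] of the frame whose tangent row [a] is replaced by [Z].
    Its row [a] yields the trace of [DZ], its first row that of [A], and the other rows the second
    derivatives [S a b]: exchanging the rows [a] and [b] changes the sign, so these cancel in
    pairs. *)
Lemma divergence_rows (S : 'I_n -> 'I_n -> 'rV[R]_n.+1) (dM : 'I_n -> 'M[R]_n.+1) :
  (forall a b, S a b = S b a) ->
  (forall a, row 0 (dM a) = row a (P *m A)) ->
  (forall a, row (lift ord0 a) (dM a) = row a (P *m DZ)) ->
  (forall a b, b != a -> row (lift ord0 b) (dM a) = S a b) ->
  \sum_a \sum_i \det (setrow i (row i (dM a)) (setrow (lift ord0 a) Z M)) =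
  \det M * (\tr (DZ *m invmx G) - dot (nu *m DZ) nu - dot Z nu * \tr (A *m invmx G)).
Proof.
move=> SC d0 da db.
pose t a b := \det (setrow (lift ord0 b) (S a b) (setrow (lift ord0 a) Z M)).
have tN a b : b != a -> t a b = - t b a.
  move=> ba; rewrite /t det_setrow_swap ?(inj_eq lift_inj)// SC.
  by rewrite setrowC// (inj_eq lift_inj).
have Soff : \sum_a \sum_(b | b != a) t a b = 0.
  have E : \sum_a \sum_(b | b != a) t a b = - \sum_a \sum_(b | b != a) t a b.
    rewrite [in RHS](exchange_big_dep predT)//= -sumrN; apply: eq_bigr => a _.
    rewrite -sumrN; apply: eq_big => [b|b ba]; first by rewrite eq_sym.
    by rewrite -tN.
  by apply/eqP; move/eqP: E; rewrite -addr_eq0 -mulr2n mulrn_eq0.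
transitivity (\sum_a (\det (setrow 0 (row a (P *m A)) (setrow (lift ord0 a) Z M)) +
    (\det (setrow (lift ord0 a) (row a (P *m DZ)) M) + \sum_(b | b != a) t a b))).
  apply: eq_bigr => a _; rewrite big_ord_recl d0; congr (_ + _).
  rewrite (bigD1 a)//= da setrow_setrow; congr (_ + _).
  by apply: eq_bigr => b ba; rewrite db.
rewrite !big_split /= Soff addr0.
(* The sum over the tangent rows is the full trace less the contribution of the row [nu]. *)
have T (B : 'M[R]_n.+1) : \sum_a \det (setrow (lift ord0 a) (row a (P *m B)) M) =
    \det M * (\tr (B *m invmx G) - dot (nu *m B) nu).
  have E : \tr (M0 *m B *m \adj M) = \det M * \tr (B *m invmx G).
    rewrite adjM -scalemxAr mxtraceZ; congr (_ * _).
    by rewrite mulmxA mxtrace_mulC !mulmxA mulVmx// mul1mx.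
  rewrite mulrBr -E mxtrace_mul_row big_ord_recl row_mul row_frame0.
  rewrite -det_setrow det_setrow0; last 2 first.
  - exact: row_frame0.
  - by move=> a; apply/rowP => j; rewrite !ord1 -row_mul [LHS]mxE Mnu mxE.
  rewrite [dot _ _ * _]mulrC addrC addKr; apply: eq_bigr => a _.
  by rewrite det_setrow; congr ((_ *m _) 0 _); rewrite !row_mul row_frameS.
have S1 : \sum_a \det (setrow 0 (row a (P *m A)) (setrow (lift ord0 a) Z M)) =
   - (dot Z nu * (\det M * (\tr (A *m invmx G)))).
  have TA : \sum_a \det (setrow (lift ord0 a) (row a (P *m A)) M) =
      \det M * \tr (A *m invmx G) by rewrite T nuA dot0l subr0.
  rewrite -TA mulr_sumr -sumrN.
  apply: eq_bigr => a _; rewrite det_setrow_swap ?neq_lift//; congr (- _).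
  apply: det_setrow0.
    by rewrite -[RHS](row_frame0 nu (P *m G)); apply/rowP => j; rewrite !mxE.
  move=> b; have [->|ba] := eqVneq b a.
    by rewrite row_setrow row_mul -mulmxA Anu mulmx0.
  apply/rowP => j; rewrite !ord1 [RHS]mxE -(Mnu b) -row_mul [LHS]mxE [LHS]mxE [RHS]mxE.
  by apply: eq_bigr => l _; rewrite [in LHS]mxE (inj_eq lift_inj) (negbTE ba).
rewrite S1 T; ring.
Qed.

End DivergenceAlgebra.

(** * Elementary symmetric functions and the generating function of the Newton tensors *)

Section Symmetric.
Context {R : realType} {n : nat}.
Implicit Types (kappa : 'rV[R]_n) (A : 'M[R]_n.+1).

(** A ring morphism [f] lets the same expansion serve for numbers, in [det_addZ_sigma], and for
    polynomials, in [newton_last]. *)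
Lemma prod_add_sigma (S : comNzRingType) (f : {rmorphism R -> S}) kappa (a b : S) :
  \prod_i (a + b * f (kappa 0 i)) =
  \sum_(j < n.+1) b ^+ j * a ^+ (n - j) * f (sigma j kappa).
Proof.
under eq_bigr do rewrite addrC.
rewrite bigA_distr (partition_big (fun J : {set 'I_n} => inord #|J| : 'I_n.+1) predT)//=.
apply: eq_bigr => j _; rewrite /sigma rmorph_sum mulr_sumr.
have E (J : {set 'I_n}) : (inord #|J| == j) = (#|J| == j).
  by rewrite -val_eqE /= inordK// ltnS -[X in (_ <= X)%N](card_ord n) max_card.
apply: eq_big => [J|J]; rewrite E// => /eqP cJ.
rewrite rmorph_prod big_if /= big_split /= mulrAC; congr (_ * _ * _).
- by rewrite prodr_const cJ.
- rewrite (eq_bigl (mem (~: J))); last by move=> i; rewrite /= inE.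
  by rewrite prodr_const -[#|_|]/#|~: J| cardsCs finset.setCK card_ord cJ.
Qed.

Lemma sigma0 kappa : sigma 0 kappa = 1.
Proof.
rewrite /sigma (big_pred1 finset.set0); first by rewrite big_set0.
by move=> J; rewrite cards_eq0.
Qed.

Lemma sigma_over j kappa : (n < j)%N -> sigma j kappa = 0.
Proof.
move=> nj; rewrite /sigma big_pred0// => J; apply/negbTE.
by rewrite neq_ltn (leq_ltn_trans (max_card _))// card_ord.
Qed.

Lemma sigma_gt0 j kappa : (j <= n)%N -> (forall i, 0 < kappa 0 i) -> 0 < sigma j kappa.
Proof.
move=> jn k0; rewrite /sigma.
have [J cJ] : exists J : {set 'I_n}, #|J| == j.
  have : (0 < #|[set J : {set 'I_n} | #|J| == j]%SET|)%N.
    by rewrite card_draws card_ord bin_gt0.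
  by case/card_gt0P => J; rewrite inE => ?; exists J.
rewrite (bigD1 J)//= ltr_pwDl ?prodr_gt0//.
by apply: sumr_ge0 => K _; apply: prodr_ge0 => i _; exact: ltW.
Qed.

(** The integers from [1] to [m] are too many roots for a polynomial of degree below [m]. Only
    positive [s] are used because [1%:M + s *: A] is known to be invertible for [s >= 0]. *)
Lemma polynomial_pos_eq0 (a : nat -> R) m :
  (forall s, 0 < s -> \sum_(j < m) s ^+ j * a j = 0) -> forall j, (j < m)%N -> a j = 0.
Proof.
move=> H j jm; pose p := \poly_(j < m) a j.
have p0 : p = 0.
  apply: (@roots_geq_poly_eq0 _ _ [seq i.+1%:R | i <- iota 0 m]).
  - apply/allP => _ /mapP[i _ ->]; apply/rootP; rewrite horner_poly -[RHS](H i.+1%:R)//.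
    by apply: eq_bigr => l _; rewrite mulrC.
  - rewrite map_inj_uniq ?iota_uniq// => i l /eqP; rewrite eqr_nat eqSS => /eqP//.
  - by rewrite size_map size_iota size_poly.
by move: (coef_poly m a j); rewrite -/p p0 coef0 jm.
Qed.

Section CharPoly.
Variables (kappa : 'rV[R]_n) (A : 'M[R]_n.+1).
Hypothesis charA : char_poly A = 'X * \prod_(i < n) ('X - (kappa 0 i)%:P).

Lemma det_addZ s : \det (1%:M + s *: A) = \prod_i (1 + s * kappa 0 i).
Proof.
have [->|s0] := eqVneq s 0.
  by rewrite scale0r addr0 det1 big1// => i _; rewrite mul0r addr0.
have -> : 1%:M + s *: A = (- s) *: ((- s^-1)%:M - A).
  by rewrite scalerBr scale_scalar_mx mulrNN mulfV// scaleNr opprK.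
rewrite detZ.
have -> : \det ((- s^-1)%:M - A) = (char_poly A).[- s^-1].
  rewrite -horner_evalE /char_poly -det_map_mx; congr (\det _).
  by apply/matrixP => i j; rewrite !mxE /= horner_evalE !hornerE hornerMn hornerX.
(* The factor ['X], which stands for the normal line, absorbs one of the [n.+1] factors [- s]. *)
rewrite charA hornerM hornerX horner_prod exprS mulrACA mulrNN mulfV// mul1r.
rewrite -[X in (- s) ^+ X](card_ord n) -prodr_const -big_split /=.
by apply: eq_bigr => i _; rewrite !hornerE; field.
Qed.

Lemma det_addZ_sigma s : \det (1%:M + s *: A) = \sum_(j < n.+1) s ^+ j * sigma j kappa.
Proof.
rewrite det_addZ; have := prod_add_sigma (idfun : {rmorphism R -> R}) kappa 1 s.
by move=> /= ->; apply: eq_bigr => j _; rewrite expr1n mulr1.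
Qed.

End CharPoly.

Lemma scalemx1_ring (c : R) : c *: (1 : 'M[R]_n.+1) = c%:M.
Proof. exact: scalemx1. Qed.

Lemma is_derive_affine (c a s : R) : is_derive s 1 (fun x : R => c + x * a) a.
Proof.
have H := is_deriveD (is_derive_cst c s 1) (is_deriveZ a (is_derive_id s 1)).
rewrite (_ : (fun _ => _) = cst c + a *: id); last by apply/funext => x; rewrite /= mulrC.
by apply: is_derive_eq; rewrite add0r /GRing.scale /= mulr1.
Qed.

Lemma is_derive_monomial (c s : R) j :
  is_derive s 1 (fun x : R => x ^+ j * c) (j%:R * s ^+ j.-1 * c).
Proof.
have H := is_deriveZ c (is_deriveX j (is_derive_id s 1)).
rewrite (_ : (fun _ => _) = c *: (id ^+ j)); last first.
  by apply/funext => x; rewrite /= exprfctE mulrC.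
by apply: is_derive_eq; rewrite /GRing.scale /= mulr1 mulr_natl; ring.
Qed.

Section Newton.
Variables (Omega : set 'rV[R]_n.+1) (p : 'rV[R]_n.+1).
Let kappa := curvatures Omega p.
Let A := Defs.shape Omega p.
Let T j := newton j Omega p.
Hypothesis charA : is_principal_curvatures Omega p kappa.

Lemma newton_comm j : A *m T j = T j *m A.
Proof.
elim: j => [|j IH]; first by rewrite /T /= mul1mx mulmx1.
by rewrite /T /= mulmxBr mulmxBl -/(T j) -/A scalar_mxC mulmxA IH.
Qed.

(** Cayley-Hamilton, once [T n] is written as an alternating sum of powers of [A]. The factor ['X]
    of the characteristic polynomial is the reason why [A] remains as a factor. *)
Lemma newton_last : T n *m A = 0.
Proof.
have TE j : T j = \sum_(i < j.+1) (-1) ^+ (j - i) *: (sigma i kappa *: A ^+ (j - i)).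
  elim: j => [|j IH]; first by rewrite big_ord1 /T /= sigma0 !scale1r.
  rewrite big_ord_recr /= subnn !expr0 !scale1r scalemx1_ring.
  rewrite /T /= -/(T j) -/A -/kappa addrC; congr (_ + _); rewrite IH mulmx_suml -sumrN.
  apply: eq_bigr => i _; rewrite subSn ?exprS ?mulN1r ?scaleNr; last by rewrite -ltnS.
  by rewrite -!scalemxAl -[_ *m A]/(_ * A) -exprSr -exprS.
have := Cayley_Hamilton A; rewrite charA rmorphM /= horner_mx_X.
have := prod_add_sigma (polyC : {rmorphism R -> {poly R}}) kappa 'X (-1).
under eq_bigr do rewrite mulN1r.
move=> -> ; rewrite rmorph_sum /= => H.
have -> : T n *m A = (-1) ^+ n *: (A * \sum_(j < n.+1)
    horner_mx A ((-1) ^+ j * 'X^(n - j) * (sigma j kappa)%:P)).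
  rewrite TE mulmx_suml mulr_sumr scaler_sumr; apply: eq_bigr => j _.
  have -> : (-1) ^+ j * 'X^(n - j) * (sigma j kappa)%:P =
      ((-1) ^+ j * sigma j kappa) *: 'X^(n - j) :> {poly R}.
    by rewrite -mul_polyC polyCM rmorphXn /= polyCN; ring.
  rewrite [horner_mx A (_ *: _)]linearZ /= rmorphXn /= horner_mx_X -!scalemxAl -[_ *m A]/(_ * A) -scalerAr -exprSr.
  rewrite -exprS !scalerA mulrA -exprD; congr ((_ * _) *: _).
  by rewrite -signr_odd -[in RHS]signr_odd oddB ?oddD// -ltnS.
by rewrite H scaler0.
Qed.

(** The product telescopes by the recursion for [T], and its last term vanishes by [newton_last].
    The Newton tensors are thus the coefficients of the adjugate of [1%:M + s *: A]. *)
Lemma newton_sum s : (\sum_(j < n.+1) s ^+ j *: T j) *m (1%:M + s *: A) =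
  (\det (1%:M + s *: A))%:M.
Proof.
have E m : (\sum_(j < m.+1) s ^+ j *: T j) *m (1%:M + s *: A) =
    (\sum_(j < m.+1) s ^+ j * sigma j kappa)%:M + s ^+ m.+1 *: (T m *m A).
  elim: m => [|m IH].
    by rewrite !big_ord1 expr0 scale1r mul1r sigma0 expr1 /T /= !mul1mx.
  have C : s ^+ m.+1 *: T m.+1 *m (1%:M + s *: A) =
     (s ^+ m.+1 * sigma m.+1 kappa)%:M - s ^+ m.+1 *: (T m *m A) + s ^+ m.+2 *: (T m.+1 *m A).
    rewrite mulmxDr mulmx1 -scalemxAr -scalemxAl scalerA -exprS; congr (_ + _).
    by rewrite {1}/T /= scalerBr scale_scalar_mx.
  rewrite big_ord_recr mulmxDl IH C [in RHS]big_ord_recr /= [(_ + _ * _)%:M]raddfD /=.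
  by rewrite addrA; congr (_ + _); rewrite -addrA; congr (_ + _); rewrite addrCA subrr addr0.
by rewrite E newton_last scaler0 addr0 (det_addZ_sigma charA).
Qed.

Lemma adj_newton s : \det (1%:M + s *: A) != 0 ->
  \det (1%:M + s *: A) *: invmx (1%:M + s *: A) = \sum_(j < n.+1) s ^+ j *: T j.
Proof.
move=> d0; have uG : 1%:M + s *: A \in unitmx by rewrite unitmxE unitfE.
by rewrite -[RHS](mulmxK uG) newton_sum mul_scalar_mx.
Qed.

Hypothesis kappa_gt0 : forall i, 0 < kappa 0 i.

Lemma det_addZ_gt0 s : 0 <= s -> 0 < \det (1%:M + s *: A).
Proof.
by move=> s0; rewrite (det_addZ charA) prodr_gt0// => i _; rewrite ltr_wpDr// mulr_ge0// ltW.
Qed.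

(** The derivative of [\det (1%:M + s *: A)] in [s], computed by rows, is the trace of [A] times the
    adjugate; computed from its expansion, it has the coefficients [(j + 1) sigma_{j+1}]. *)
Lemma trace_shape_newton j : (j <= n)%N -> \tr (A *m T j) = j.+1%:R * sigma j.+1 kappa.
Proof.
move=> jn; apply/eqP; rewrite -subr_eq0; apply/eqP; move: j jn.
pose a j := \tr (A *m T j) - j.+1%:R * sigma j.+1 kappa.
apply: (@polynomial_pos_eq0 a n.+1); move=> s' s'0; pose s : R := s'; have s0 : 0 < s := s'0; rewrite -[s']/s.
have dp := det_addZ_gt0 (ltW s0).
have D1 : is_derive s 1 (fun t : R => \det (1%:M + t *: A))
    (\sum_i \det (setrow i (row i A) (1%:M + s *: A))).
  apply: (@is_derive_det _ R _ (fun t => 1%:M + t *: A) A s 1) => i j.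
  under eq_fun do rewrite !mxE.
  exact: is_derive_affine.
have D2 : is_derive s 1 (fun t : R => \det (1%:M + t *: A))
    (\sum_(j < n.+1) s ^+ j * (j.+1%:R * sigma j.+1 kappa)).
  under eq_fun do rewrite (det_addZ_sigma charA).
  rewrite [X in is_derive _ _ _ X](_ : _ = \sum_(j < n.+1) (j%:R * s ^+ j.-1 * sigma j kappa)).
    by apply: is_derive_bigsum => j; exact: is_derive_monomial.
  rewrite big_ord_recr /= sigma_over// !mulr0 addr0 [RHS]big_ord_recl !mul0r add0r.
  by apply: eq_bigr => j _; rewrite mulrCA mulrA.
have := @derive_val _ _ _ _ _ _ _ D1; rewrite (@derive_val _ _ _ _ _ _ _ D2) => E.
under eq_bigr do rewrite mulrBr.
rewrite sumrB E; apply/eqP; rewrite subr_eq0; apply/eqP.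
transitivity (\tr (A *m \adj (1%:M + s *: A))).
  rewrite adj_unit ?unitmxE ?unitfE ?gt_eqF// adj_newton ?gt_eqF// mulmx_sumr raddf_sum.
  by apply: eq_bigr => j _; rewrite /= -scalemxAr mxtraceZ.
by apply: eq_bigr => i _; rewrite det_setrow -row_mul [RHS]mxE.
Qed.

(** The factor is [n + 1 - j] and not the usual [n - j], because the trace is taken over the ambient
    space and includes the normal line. *)
Lemma trace_newton j : (j <= n)%N -> \tr (T j) = (n.+1%:R - j%:R) * sigma j kappa.
Proof.
case: j => [|j] jn; first by rewrite /T /= mxtrace1 sigma0 subr0 mulr1.
rewrite /T /= raddfB /= mxtrace_scalar -/A -/(T j) -newton_comm trace_shape_newton 1?ltnW//.
by rewrite -[RHS]mulrC mulrBr mulr_natr [X in _ - X]mulrC.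
Qed.

End Newton.

End Symmetric.

(** * Calculus on the hypersurface *)

Section Gram.
Context {R : realType} {n : nat}.
Implicit Types (v : 'rV[R]_n.+1) (P : 'M[R]_(n, n.+1)).

(** [frame v P] times its transpose is block diagonal, with blocks [1] and [P *m P^T]. The area
    density is thereby compared with the determinant that occurs in [flux_divergence]. *)
Lemma sqrt_det_gram v P : dot v v = 1 -> P *m v^T = 0 ->
  Num.sqrt (\det (P *m P^T)) = `|\det (frame v P)|.
Proof.
move=> v1 Pv; rewrite -sqrtr_sqr expr2; congr Num.sqrt.
rewrite -[X in _ = _ * X]det_tr -det_mulmx [RHS](expand_det_row _ 0) big_ord_recl.
have rE i j : (frame v P *m (frame v P)^T) i j = dot (row i (frame v P)) (row j (frame v P)).
  by rewrite dotE mxE; apply: eq_bigr => l _; rewrite !mxE.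
rewrite rE !row_frame0 v1 mul1r big1 ?addr0 => [|b _]; last first.
  rewrite rE row_frame0 row_frameS dotC /dot -row_mul Pv.
  by rewrite !mxE mul0r.
rewrite /cofactor expr0 mul1r; congr (\det _); apply/matrixP => a b.
rewrite [RHS]mxE [RHS]mxE rE !row_frameS dotE [LHS]mxE.
by apply: eq_bigr => l _; rewrite !mxE.
Qed.

Lemma frame_unit v P : \rank P = n -> dot v v = 1 -> P *m v^T = 0 -> frame v P \in unitmx.
Proof.
move=> rP v1 Pv; rewrite unitmxE unitfE -dot_cross.
have [l vE] : exists l, v = l *: cross P.
  apply: parallel_cross => // c; rewrite dotC /dot -mulmxA Pv mulmx0 mxE//.
apply/eqP => E; move: v1; rewrite {1}vE dotZl E mulr0 => /esym/eqP.
by rewrite oner_eq0.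
Qed.

End Gram.

Record convex_body {R : realType} {n : nat} (Omega : set 'rV[R]_n.+1) : Prop := ConvexBody {
  body_dim : (0 < n)%N;
  body_open : open Omega;
  body_neq0 : Omega !=set0;
  body_bounded : bounded_set Omega;
  body_convex : @convex_set R 'rV[R]_n.+1 Omega;
  body_smooth : smooth_hypersurface (boundary Omega);
  body_curved : strictly_convex Omega }.

Section Body.
Context {R : realType} {n : nat} (Omega : set 'rV[R]_n.+1).
Hypothesis body : convex_body Omega.
Let oO := body_open body.
Let cO := body_convex body.
Let O0 := body_neq0 body.
Let bO := body_bounded body.
Let sS := body_smooth body.
Implicit Types (p v : 'rV[R]_n.+1).

Let nu := normal Omega.
Let A := Defs.shape Omega.
Let kappa := curvatures Omega.

Lemma curvatures_gt0 p i : boundary Omega p -> 0 < kappa p 0 i.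
Proof. by move=> bp; exact: (body_curved body). Qed.

(* Were there no such vector, the [xget] default would give a zero curvature,
   contradicting strict convexity; likewise for the shape operator. *)
Lemma curvatures_spec p : boundary Omega p -> is_principal_curvatures Omega p (kappa p).
Proof.
move=> bp; rewrite /kappa /curvatures; case: xgetP => [x -> //|nP].
have := curvatures_gt0 (Ordinal (body_dim body)) bp.
rewrite /kappa /curvatures; case: xgetP => [x _ /nP//|_].
by rewrite mxE ltxx.
Qed.

Lemma shape_spec p : boundary Omega p -> is_shape_operator Omega p (A p).
Proof.
move=> bp; have := curvatures_spec bp; rewrite /is_principal_curvatures /A /Defs.shape.
case: xgetP => [x -> //|nP] E; exfalso.
(* With the default [0] the characteristic polynomial would be a power of ['X], which has no
   positive root. *)
pose i0 : 'I_n := Ordinal (body_dim body).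
have := congr1 (horner^~ (kappa p 0 i0)) E; rewrite hornerM hornerX horner_prod.
rewrite (bigD1 i0)//= hornerXsubC subrr mul0r mulr0.
rewrite /char_poly /char_poly_mx map_mx0 subr0 det_scalar hornerXn => /eqP.
by rewrite expf_eq0 /= gt_eqF// curvatures_gt0.
Qed.

Lemma normal_unit p : boundary Omega p -> dot (nu p) (nu p) = 1.
Proof. by move=> /(normal_spec oO cO sS O0)[]. Qed.

Lemma normal_shape p : boundary Omega p -> nu p *m A p = 0.
Proof. by move=> /shape_spec[]. Qed.

Section Chart.
Variables (U : set 'rV[R]_n) (phi : 'rV[R]_n -> 'rV[R]_n.+1).
Hypothesis chart : local_param (boundary Omega) U phi.

Let oU : open U. Proof. by case: chart. Qed.
Let bphi x : U x -> boundary Omega (phi x).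
Proof. exact: (chart_boundary chart). Qed.

Lemma chart_normal_orth x : U x -> 'J phi x *m (nu (phi x))^T = 0.
Proof.
move=> Ux; have [z0 Oz0] := O0; rewrite /nu (chart_normal oO cO chart Ux Oz0).
apply/colP => a; rewrite [RHS]mxE; have := outer_orth phi z0 x (delta_mx 0 a).
rewrite -rowE dotC /dot => E; rewrite linearZ /= -scalemxAr [LHS]mxE.
transitivity ((enorm (outer phi z0 x))^-1 * (row a ('J phi x) *m (outer phi z0 x)^T) 0 0).
  by rewrite -row_mul [X in _ = _ * X]mxE.
by rewrite E mulr0.
Qed.

Lemma chart_frame_unit x : U x -> frame (nu (phi x)) ('J phi x) \in unitmx.
Proof.
move=> Ux; apply: frame_unit; first exact: (chart_rank chart).
- exact/normal_unit/bphi.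
- exact: chart_normal_orth.
Qed.

Lemma chart_normal_differentiable x : U x -> differentiable (nu \o phi) x.
Proof.
move=> Ux; apply: differentiable_rV => j.
by have [+ _] := chart_normal_CkR oO cO chart 1 j O0; exact.
Qed.

Lemma chart_shape x : U x -> 'J (nu \o phi) x = 'J phi x *m A (phi x).
Proof.
move=> Ux; have dN := chart_normal_differentiable Ux.
apply/row_matrixP => a; rewrite [RHS]row_mul [LHS]row_jacobian.
  have [+ _] := shape_spec (bphi Ux) => /(_ _ _ (chart_curve chart (delta_mx 0 a) Ux)).
  rewrite -rowE; set g := _ \o _ => dg.
  apply/rowP => j; rewrite derive_entry; last exact: diff_derivable.
  have <- : 'D_1 g 0 = row a ('J phi x) *m A (phi x) by exact: derive_val.
  rewrite derive_entry; last exact: ex_derive.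
  have := @line_is_derive _ _ (fun y => nu (phi y) 0 j) x (delta_mx 0 a) 0.
  rewrite scale0r addr0 => -[|_ <-//].
  apply: diff_derivable; exact: differentiable_entry.
exact: dN.
Qed.

(** Differentiating [dot nu nu = 1] along the chart treats the tangent rows of the frame; the normal
    row is killed by [A], and the frame is invertible. *)
Lemma shape_normal x : U x -> A (phi x) *m (nu (phi x))^T = 0.
Proof.
move=> Ux; set N := nu (phi x); have uF := chart_frame_unit Ux.
apply: (can_inj (mulKmx uF)); rewrite mulmx0 mulmxA.
apply/row_matrixP => i; rewrite row0 row_mul row_mul; have [a ->|->] := unliftP ord0 i; last first.
  by rewrite row_frame0 normal_shape ?mul0mx//; exact: bphi.
rewrite row_frameS -[X in X *m _ = _]row_mul -chart_shape//.
rewrite row_jacobian; last exact: chart_normal_differentiable.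
have dN := chart_normal_differentiable Ux.
have dNj j : differentiable (fun y => nu (phi y) 0 j) x by exact: differentiable_entry.
pose q y := \sum_j nu (phi y) 0 j * nu (phi y) 0 j.
pose dq := \sum_j (N 0 j * 'D_(delta_mx 0 a) (fun y => nu (phi y) 0 j) x +
                   N 0 j * 'D_(delta_mx 0 a) (fun y => nu (phi y) 0 j) x).
have qE : is_derive x (delta_mx 0 a) q dq.
  apply: is_derive_bigsum => j; apply: is_deriveM; exact/derivableP/diff_derivable.
have N1 : \forall y \near x, cst (1 : R) y = q y.
  apply: filterS (open_nbhs_nbhs (conj oU Ux)) => y Uy.
  by rewrite /q -dotE normal_unit//; exact: bphi.
have dq0 : dq = 0.
  have <- : 'D_(delta_mx 0 a) q x = dq by exact: derive_val.
  rewrite -(near_eq_derive (delta_mx 0 a) N1).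
  exact: derive_cst.
apply/rowP => l; rewrite ord1 [RHS]mxE [LHS]mxE.
apply: (@mulfI R 2); first by rewrite pnatr_eq0.
rewrite [RHS]mulr0 -[RHS]dq0 mulr_sumr; apply: eq_bigr => j _.
rewrite [N^T _ _]mxE derive_entry; last exact: diff_derivable.
by rewrite mulr_natl mulrC mulr2n.
Qed.

Lemma jacobian_CkR k (f : 'rV[R]_n -> 'rV[R]_n.+1) a b :
  (forall x, U x -> differentiable f x) ->
  (forall j, CkR k.+1 U (fun x => f x 0 j)) -> CkR k U (fun x => 'J f x a b).
Proof.
move=> df Cf; have [_ /(_ a)] := Cf b; apply: CkR_eq => // x Ux.
by rewrite -derive_entry; [rewrite -row_jacobian ?mxE//; exact: df|exact/diff_derivable/df].
Qed.

Lemma chart_frame_CkR k a b : CkR k U (fun x => frame (nu (phi x)) ('J phi x) a b).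
Proof.
have [c ->|->] := unliftP ord0 a.
  have C : CkR k U (fun x => 'J phi x c b).
    by apply: jacobian_CkR => [x|l]; [exact: (chart_differentiable chart)|exact: (chart_CkR chart)].
  by apply: CkR_eq C => // x _; rewrite frameS.
apply: CkR_eq (chart_normal_CkR oO cO chart k b O0) => // x _; by rewrite frame0.
Qed.

(** The shape operator is a choice made point by point. Its regularity comes from solving the linear
    system that it satisfies: it sends the chart's tangent rows to the derivatives of the normal,
    and the normal to [0]. *)
Lemma chart_shape_CkR k i j : CkR k U (fun x => A (phi x) i j).
Proof.
pose M x := frame (nu (phi x)) ('J phi x).
pose N x := frame 0 ('J (nu \o phi) x).
have E x : U x -> A (phi x) = invmx (M x) *m N x.
  move=> Ux; apply: (can_inj (mulKmx (chart_frame_unit Ux))).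
  rewrite mulKVmx ?chart_frame_unit//; apply/row_matrixP => l; rewrite row_mul.
  have [a ->|->] := unliftP ord0 l.
    rewrite [in RHS]/N [RHS]row_frameS chart_shape// row_frameS.
    by rewrite [RHS]row_mul.
  rewrite [in RHS]/N [RHS]row_frame0 row_frame0; exact/normal_shape/bphi.
have CM a b : CkR k U (fun x => M x a b) by exact: chart_frame_CkR.
have CN a b : CkR k U (fun x => N x a b).
  have [c ->|->] := unliftP ord0 a.
    have C : CkR k U (fun x => 'J (nu \o phi) x c b).
      apply: jacobian_CkR => [x|l]; first exact: chart_normal_differentiable.
      exact: (chart_normal_CkR oO cO chart).
    by apply: CkR_eq C => // x _; rewrite /N frameS.
  by apply: CkR_eq (CkR_cst oU k 0) => // x _; rewrite /N frame0 mxE.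
have CI := CkR_invmx oU (fun x => @chart_frame_unit x) CM.
apply: (@CkR_eq _ _ _ oU _ (fun x => \sum_l invmx (M x) i l * N x l j)) => [x Ux|].
  by rewrite E// mxE.
by apply: (CkR_sum oU) => l _; apply: (CkR_mul oU); [exact: CI|exact: CN].
Qed.

End Chart.

End Body.

(** * Regular functions, gradients and the flux through parallel hypersurfaces *)

Section SurfaceCalculus.
Context {R : realType} {n : nat} (Omega : set 'rV[R]_n.+1).
Hypothesis body : convex_body Omega.
Let oO := body_open body.
Let cO := body_convex body.
Let O0 := body_neq0 body.
Let bO := body_bounded body.
Let sS := body_smooth body.
Implicit Types (p : 'rV[R]_n.+1) (f : 'rV[R]_n.+1 -> R).

Let nu := normal Omega.
Let A := Defs.shape Omega.
Let kappa := curvatures Omega.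
Let T j := newton j Omega.
Notation Sigma := (boundary Omega).

Definition surface_Ck k f := forall U phi, local_param Sigma U phi -> CkR k U (f \o phi).

Lemma surface_Ck_eq k f g : (forall p, Sigma p -> f p = g p) -> surface_Ck k f -> surface_Ck k g.
Proof.
move=> fg Cf U phi ch; have [oU _ _ _ _] := ch; apply: (CkR_eq oU) (Cf _ _ ch) => x Ux.
by apply: fg; exact: (chart_boundary ch).
Qed.

Lemma surface_Ck_cst k (c : R) : surface_Ck k (fun=> c).
Proof. by move=> U phi [oU _ _ _ _]; exact: (CkR_cst oU). Qed.

Lemma surface_Ck_coord k j : surface_Ck k (fun p => p 0 j).
Proof. by move=> U phi ch; exact: (chart_CkR ch). Qed.

Lemma surface_Ck_normal k j : surface_Ck k (fun p => nu p 0 j).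
Proof. by move=> U phi ch; exact: (chart_normal_CkR oO cO ch). Qed.

Lemma surface_Ck_shape k i j : surface_Ck k (fun p => A p i j).
Proof. by move=> U phi ch; exact: (chart_shape_CkR body ch). Qed.

Lemma surface_Ck_add k f g : surface_Ck k f -> surface_Ck k g -> surface_Ck k (fun p => f p + g p).
Proof. by move=> Cf Cg U phi ch; case: (ch) => oU _ _ _ _; apply: (CkR_add oU); [exact: Cf|exact: Cg]. Qed.

Lemma surface_Ck_mul k f g : surface_Ck k f -> surface_Ck k g -> surface_Ck k (fun p => f p * g p).
Proof. by move=> Cf Cg U phi ch; case: (ch) => oU _ _ _ _; apply: (CkR_mul oU); [exact: Cf|exact: Cg]. Qed.

Lemma surface_Ck_sub k f g : surface_Ck k f -> surface_Ck k g -> surface_Ck k (fun p => f p - g p).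
Proof. by move=> Cf Cg U phi ch; case: (ch) => oU _ _ _ _; apply: (CkR_sub oU); [exact: Cf|exact: Cg]. Qed.

Lemma surface_Ck_sum k (I : Type) (s : seq I) (P : pred I) (f : I -> 'rV[R]_n.+1 -> R) :
  (forall i, P i -> surface_Ck k (f i)) -> surface_Ck k (fun p => \sum_(i <- s | P i) f i p).
Proof.
move=> Cf U phi ch; case: (ch) => oU _ _ _ _; apply: (CkR_sum oU) => i Pi; exact: Cf.
Qed.

Lemma surface_C0_comp f (h : R -> R) : surface_Ck 0 f ->
  (forall p, Sigma p -> {for f p, continuous h}) -> surface_Ck 0 (h \o f).
Proof.
move=> Cf ch U phi ph x Ux; apply: (@continuous_comp _ _ _ (f \o phi) h); first exact: (Cf _ _ ph).
by apply: ch; exact: (chart_boundary ph).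
Qed.

Lemma surface_Ck_dot k (v w : 'rV[R]_n.+1 -> 'rV[R]_n.+1) :
  (forall j, surface_Ck k (fun p => v p 0 j)) -> (forall j, surface_Ck k (fun p => w p 0 j)) ->
  surface_Ck k (fun p => dot (v p) (w p)).
Proof.
move=> Cv Cw; apply: (@surface_Ck_eq _ (fun p => \sum_j v p 0 j * w p 0 j)).
  by move=> p _; rewrite dotE.
by apply: surface_Ck_sum => j _; apply: surface_Ck_mul.
Qed.

Lemma surface_Ck_mulmx k d e l (M : 'rV[R]_n.+1 -> 'M[R]_(d, e)) (N : 'rV[R]_n.+1 -> 'M[R]_(e, l)) :
  (forall i j, surface_Ck k (fun p => M p i j)) -> (forall i j, surface_Ck k (fun p => N p i j)) ->
  forall i j, surface_Ck k (fun p => (M p *m N p) i j).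
Proof.
move=> CM CN i j; apply: (@surface_Ck_eq _ (fun p => \sum_a M p i a * N p a j)).
  by move=> p _; rewrite mxE.
by apply: surface_Ck_sum => a _; apply: surface_Ck_mul.
Qed.

Lemma surface_Ck_support k : surface_Ck k (Defs.support Omega).
Proof. by apply: surface_Ck_dot => j; [exact: surface_Ck_coord|exact: surface_Ck_normal]. Qed.

(** The curvatures are enumerated arbitrarily at each point, so a single one need not be continuous.
    Their symmetric functions are recovered from traces: [sigma j.+1] is the trace of [A *m T j]
    over [j + 1], in a simultaneous induction with [T]. *)
Lemma surface_Ck_newton_sigma k j :
  (forall a b, surface_Ck k (fun p => T j p a b)) /\ surface_Ck k (fun p => sigma j (kappa p)).
Proof.
elim: j => [|j [CT Cs]].
  split=> [a b|]; first exact: surface_Ck_cst.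
  by apply: surface_Ck_eq (surface_Ck_cst k 1) => p _; rewrite sigma0.
have Cs1 : surface_Ck k (fun p => sigma j.+1 (kappa p)).
  have [jn|nj] := leqP j n; last first.
    by apply: surface_Ck_eq (surface_Ck_cst k 0) => p _; rewrite sigma_over// ltnW.
  apply: (@surface_Ck_eq _ (fun p => j.+1%:R^-1 * \sum_i (A p *m T j p) i i)) => [p bp|].
    rewrite -/(\tr (A p *m T j p)) trace_shape_newton//; last 2 first.
    - exact: curvatures_spec.
    - by move=> i; exact: curvatures_gt0.
    by rewrite mulKf// pnatr_eq0.
  apply: surface_Ck_mul; first exact: surface_Ck_cst.
  by apply: surface_Ck_sum => i _; apply: surface_Ck_mulmx => // a b; exact: surface_Ck_shape.
split=> // a b.
apply: (@surface_Ck_eq _ (fun p => sigma j.+1 (kappa p) * (a == b)%:R - (T j p *m A p) a b)) => [p _|].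
  rewrite /T /= [RHS]mxE [X in _ = X + _]mxE [X in _ = _ + X]mxE.
  by rewrite mulr_natr.
apply: surface_Ck_sub; first by apply: surface_Ck_mul => //; exact: surface_Ck_cst.
by apply: surface_Ck_mulmx => // i l; exact: surface_Ck_shape.
Qed.

(* [g] is a gradient up to an arbitrary normal component. *)
Definition has_gradient f (g : 'rV[R]_n.+1 -> 'rV[R]_n.+1) :=
  [/\ surface_Ck 1 f, forall j, surface_Ck 0 (fun p => g p 0 j) &
    forall U phi, local_param Sigma U phi -> forall x, U x -> forall a,
      'D_(delta_mx 0 a) (f \o phi) x = dot (row a ('J phi x)) (g (phi x))].

Lemma derive_chart U phi (ch : local_param Sigma U phi) x (Ux : U x) a j :
  'D_(delta_mx 0 a) (fun y => phi y 0 j) x = 'J phi x a j.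
Proof.
rewrite -derive_entry; last exact/diff_derivable/(chart_differentiable ch).
by rewrite -row_jacobian ?mxE//; exact: (chart_differentiable ch).
Qed.

Lemma derive_chart_normal U phi (ch : local_param Sigma U phi) x (Ux : U x) a j :
  'D_(delta_mx 0 a) (fun y => nu (phi y) 0 j) x = ('J phi x *m A (phi x)) a j.
Proof.
have dN := chart_normal_differentiable body ch Ux.
rewrite -(chart_shape body ch Ux).
rewrite -(derive_entry j (diff_derivable dN)) -row_jacobian; last exact: dN.
by rewrite mxE.
Qed.

Lemma surface_C1_derivable f U phi (ch : local_param Sigma U phi) x (Ux : U x) v :
  surface_Ck 1 f -> derivable (f \o phi) x v.
Proof. by move=> /(_ _ _ ch)[df _]; exact/diff_derivable/df. Qed.

Lemma has_gradient_cst c : has_gradient (fun=> c) (fun=> 0).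
Proof.
split=> [|j|U phi ch x Ux a]; first exact: surface_Ck_cst.
- by apply: surface_Ck_eq (surface_Ck_cst 0 0) => p _; rewrite mxE.
- by rewrite dot0r; exact: derive_cst.
Qed.

Lemma has_gradient_coord j : has_gradient (fun p => p 0 j) (fun=> delta_mx 0 j).
Proof.
split=> [|i|U phi ch x Ux a]; first exact: surface_Ck_coord.
- exact: surface_Ck_cst.
- by rewrite dot_delta mxE; exact: (derive_chart ch).
Qed.

Lemma has_gradient_normal j : has_gradient (fun p => nu p 0 j) (fun p => (col j (A p))^T).
Proof.
split=> [|i|U phi ch x Ux a]; first exact: surface_Ck_normal.
- by apply: surface_Ck_eq (surface_Ck_shape 0 i j) => p _; rewrite !mxE.
- rewrite dotE; transitivity (('J phi x *m A (phi x)) a j).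
    exact: (derive_chart_normal ch).
  by rewrite mxE; apply: eq_bigr => i _; rewrite !mxE.
Qed.

Lemma has_gradient_add f1 f2 g1 g2 : has_gradient f1 g1 -> has_gradient f2 g2 ->
  has_gradient (fun p => f1 p + f2 p) (fun p => g1 p + g2 p).
Proof.
move=> [C1 c1 d1] [C2 c2 d2]; split=> [|j|U phi ch x Ux a]; first exact: surface_Ck_add.
- by apply: surface_Ck_eq (surface_Ck_add (c1 j) (c2 j)) => p _; rewrite mxE.
- rewrite dotDr -(d1 _ _ ch)// -(d2 _ _ ch)//.
  apply: (@deriveD _ _ _ (f1 \o phi) (f2 \o phi)).
    exact: (surface_C1_derivable ch Ux).
  exact: (surface_C1_derivable ch Ux).
Qed.

Lemma has_gradient_mul f1 f2 g1 g2 : has_gradient f1 g1 -> has_gradient f2 g2 ->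
  has_gradient (fun p => f1 p * f2 p) (fun p => f1 p *: g2 p + f2 p *: g1 p).
Proof.
move=> [C1 c1 d1] [C2 c2 d2].
split=> [|j|U phi ch x Ux a]; first exact: surface_Ck_mul.
- have C0 f : surface_Ck 1 f -> surface_Ck 0 f by move=> Cf U phi ch; exact/CkR_pred/Cf.
  apply: surface_Ck_eq (surface_Ck_add (surface_Ck_mul (C0 _ C1) (c2 j))
    (surface_Ck_mul (C0 _ C2) (c1 j))) => p _; by rewrite !mxE.
- rewrite dotDr !dotZr -(d1 _ _ ch)// -(d2 _ _ ch)//.
  apply: (@deriveM _ _ (f1 \o phi) (f2 \o phi)).
    exact: (surface_C1_derivable ch Ux).
  exact: (surface_C1_derivable ch Ux).
Qed.

Lemma has_gradient_sum (I : Type) (s : seq I) (f : I -> 'rV[R]_n.+1 -> R) g :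
  (forall i, has_gradient (f i) (g i)) ->
  has_gradient (fun p => \sum_(i <- s) f i p) (fun p => \sum_(i <- s) g i p).
Proof.
move=> H; elim: s => [|i s IH].
  under eq_fun do rewrite big_nil.
  under [X in has_gradient _ X]eq_fun do rewrite big_nil.
  exact: has_gradient_cst.
under eq_fun do rewrite big_cons.
under [X in has_gradient _ X]eq_fun do rewrite big_cons.
exact: has_gradient_add.
Qed.

Lemma has_gradient_comp f g (h dh : R -> R) : has_gradient f g ->
  (forall p, Sigma p -> is_derive (f p) 1 h (dh (f p)) /\ {for f p, continuous dh}) ->
  has_gradient (h \o f) (fun p => dh (f p) *: g p).
Proof.
move=> [Cf Cg d] H.
have C0 : surface_Ck 0 f by move=> U phi ch; exact/CkR_pred/Cf.
have Cdh : surface_Ck 0 (fun p => dh (f p)).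
  by apply: (surface_C0_comp C0) => p bp; have [] := H p bp.
have D U phi (ch : local_param Sigma U phi) x (Ux : U x) v :
    differentiable (h \o (f \o phi)) x /\
    'D_v (h \o (f \o phi)) x = dh (f (phi x)) * 'D_v (f \o phi) x.
  have [df _] := Cf _ _ ch.
  by apply: derive_compR; [have [] := H _ (chart_boundary ch Ux)|exact: df].
split=> [U phi ch|j|U phi ch x Ux a].
- case: (ch) => oU _ _ _ _; split=> [x Ux|i].
    by have [] := D _ _ ch x Ux 0.
  have [_ /(_ i) Di] := Cf _ _ ch.
  apply: (@CkR_eq _ _ _ oU 0 (fun x => dh (f (phi x)) * 'D_(delta_mx 0 i) (f \o phi) x)).
    by move=> x Ux; have [_ <-] := D _ _ ch x Ux (delta_mx 0 i).
  exact: (@CkR_mul _ _ _ oU 0 _ _ (Cdh _ _ ch) Di).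
- by apply: surface_Ck_eq (surface_Ck_mul Cdh (Cg j)) => p _; rewrite mxE.
- have [_ E] := D _ _ ch x Ux (delta_mx 0 a).
  by rewrite dotZr -(d _ _ ch)//; exact: E.
Qed.

(** In the derivative of [dot p (nu p)], the term where the position is differentiated vanishes, its
    derivative being tangent. *)
Lemma has_gradient_support : has_gradient (Defs.support Omega) (fun p => p *m (A p)^T).
Proof.
have := @has_gradient_sum _ (index_enum 'I_n.+1) _ _ (fun j =>
  has_gradient_mul (has_gradient_coord j) (has_gradient_normal j)).
rewrite (_ : (fun p => \sum_j p 0 j * nu p 0 j) = Defs.support Omega); last first.
  by apply/funext => p; rewrite /Defs.support dotE.
move=> [C1 _ D]; split=> // [j|U phi ch x Ux a].
  apply: surface_Ck_mulmx => // i l; first by rewrite ord1; exact: surface_Ck_coord.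
  by apply: surface_Ck_eq (surface_Ck_shape 0 l i) => p _; rewrite mxE.
rewrite (D _ _ ch)// big_split /= dotDr addrC.
have -> : \sum_j nu (phi x) 0 j *: delta_mx 0 j = nu (phi x) by rewrite -row_sum_delta.
have := chart_normal_orth body ch Ux => /(congr1 (row a)).
rewrite row_mul row0 => E; rewrite {1}/dot E mxE add0r; congr dot.
apply/rowP => i; rewrite summxE mxE; apply: eq_bigr => j _; by rewrite !mxE.
Qed.

(* The coefficient of [s ^ j] in the divergence of [Z] along the parallel
   hypersurfaces [p + s nu p]; [DZ] is a differential of [Z], of which only the
   restriction to the tangent space matters. *)
Definition newton_divergence j (Z : 'rV[R]_n.+1 -> 'rV[R]_n.+1)
    (DZ : 'rV[R]_n.+1 -> 'M[R]_n.+1) p :=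
  \tr (DZ p *m T j p) - sigma j (kappa p) * dot (nu p *m DZ p) (nu p)
  - dot (Z p) (nu p) * (j.+1%:R * sigma j.+1 (kappa p)).

Definition has_differential (Z : 'rV[R]_n.+1 -> 'rV[R]_n.+1) (DZ : 'rV[R]_n.+1 -> 'M[R]_n.+1) :=
  forall j, has_gradient (fun p => Z p 0 j) (fun p => (col j (DZ p))^T).

Section Divergence.
Variables (Z : 'rV[R]_n.+1 -> 'rV[R]_n.+1) (DZ : 'rV[R]_n.+1 -> 'M[R]_n.+1) (s : R).
Hypotheses (dZ : has_differential Z DZ) (s0 : 0 <= s).
Variables (U : set 'rV[R]_n) (phi : 'rV[R]_n -> 'rV[R]_n.+1).
Hypothesis ch : local_param Sigma U phi.

Let oU : open U. Proof. by case: ch. Qed.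
Let psi b (y : 'rV[R]_n) : R := phi y 0 b + s * nu (phi y) 0 b.
Let Q (y : 'rV[R]_n) : 'M[R]_(n, n.+1) := \matrix_(a, b) 'D_(delta_mx 0 a) (psi b) y.

Let Cpsi k b : CkR k U (psi b).
Proof.
apply: (CkR_add oU); first exact: (chart_CkR ch).
apply: (CkR_mul oU); first exact: (CkR_cst oU).
exact: (chart_normal_CkR oO cO ch).
Qed.

(* Expanding [sum_a d_a (flux a)] row by row, the second derivatives of the
   parallel hypersurface [phi + s nu] cancel by symmetry. *)
Definition flux a y := \det (setrow (lift ord0 a) (Z (phi y)) (frame (nu (phi y)) (Q y))).

Let CkR_Q k a b : CkR k U (fun y => Q y a b).
Proof.
have [_ /(_ a)] := Cpsi k.+1 b; apply: (CkR_eq oU) => y Uy; by rewrite mxE.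
Qed.

Let CkR_entry a i j :
  CkR 1 U (fun y => setrow (lift ord0 a) (Z (phi y)) (frame (nu (phi y)) (Q y)) i j).
Proof.
have [->|ia] := eqVneq i (lift ord0 a).
  by have [Cj _ _] := dZ j; apply: (CkR_eq oU) (Cj _ _ ch) => y Uy; rewrite mxE eqxx.
have [b|] := unliftP ord0 i => ib.
  apply: (CkR_eq oU) (CkR_Q 1 b j) => y Uy.
  by rewrite [RHS]mxE (negbTE ia) ib frameS.
apply: (CkR_eq oU) (chart_normal_CkR oO cO ch 1 j O0) => y Uy.
by rewrite [RHS]mxE (negbTE ia) ib frame0.
Qed.

Lemma flux_CkR a : CkR 1 U (flux a).
Proof. by apply: (CkR_det oU) => i j; exact: CkR_entry. Qed.

Let QE x : U x -> Q x = 'J phi x *m (1%:M + s *: A (phi x)).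
Proof.
move=> Ux; apply/matrixP => a b; rewrite mulmxDr mulmx1 -scalemxAr mxE [RHS]mxE [X in _ = _ + X]mxE.
rewrite -(derive_chart ch Ux) -(derive_chart_normal ch Ux).
have d1 : derivable (fun y => phi y 0 b) x (delta_mx 0 a).
  exact/diff_derivable/differentiable_entry/(chart_differentiable ch).
have d2 : derivable (fun y => nu (phi y) 0 b) x (delta_mx 0 a).
  exact/diff_derivable/differentiable_entry/(chart_normal_differentiable body ch).
have H := is_deriveD (derivableP d1) (is_deriveZ s (derivableP d2)).
exact: (@derive_val _ _ _ _ _ _ _ H).
Qed.

(** [divergence_rows] gives the divergence in terms of the inverse of [1%:M + s *: A]; multiplied by
    the determinant, this inverse is the generating polynomial of the Newton tensors. *)
Lemma flux_divergence x : U x ->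
  \sum_a 'D_(delta_mx 0 a) (flux a) x =
  \det (frame (nu (phi x)) ('J phi x)) *
  \sum_(j < n.+1) s ^+ j * newton_divergence j Z DZ (phi x).
Proof.
move=> Ux; have bp := chart_boundary ch Ux; set p := phi x; set P := 'J phi x.
have kp i : 0 < kappa p 0 i by exact: curvatures_gt0.
pose E a y := setrow (lift ord0 a) (Z (phi y)) (frame (nu (phi y)) (Q y)).
have [dM dME] : exists dM : 'I_n -> 'M[R]_n.+1, forall a i j,
    dM a i j = 'D_(delta_mx 0 a) (fun y => E a y i j) x.
  by exists (fun a => \matrix_(i, j) 'D_(delta_mx 0 a) (fun y => E a y i j) x) => a i j; exact: mxE.
have DE a : 'D_(delta_mx 0 a) (flux a) x =
    \sum_i \det (setrow i (row i (dM a)) (E a x)).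
  apply: (@derive_val _ _ _ _ _ _ _ (is_derive_det (dM := dM a) (M := E a) _)) => i j.
  rewrite dME; apply/derivableP/diff_derivable.
  by have [+ _] := CkR_entry a i j; exact.
under eq_bigr do rewrite DE.
have uG : 1%:M + s *: A p \in unitmx.
  by rewrite unitmxE unitfE gt_eqF// (det_addZ_gt0 (curvatures_spec body bp)).
rewrite /E QE//.
have [S SE] : exists S : 'I_n -> 'I_n -> 'rV[R]_n.+1, forall a b j,
    S a b 0 j = 'D_(delta_mx 0 a) ('D_(delta_mx 0 b) (psi j)) x.
  exists (fun a b => \row_j 'D_(delta_mx 0 a) ('D_(delta_mx 0 b) (psi j)) x) => a b j.
  exact: mxE.
rewrite (@divergence_rows _ _ _ _ _ (A p) (DZ p) s _ _ _ _ _ _ S).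
- rewrite frameE ?normal_shape// det_mulmx -mulrA; congr (_ * _).
  have d0 : \det (1%:M + s *: A p) != 0 by rewrite -unitfE -unitmxE.
  have tE (B : 'M[R]_n.+1) : \det (1%:M + s *: A p) * \tr (B *m invmx (1%:M + s *: A p)) =
      \sum_(j < n.+1) s ^+ j * \tr (B *m T j p).
    rewrite -mxtraceZ scalemxAr (adj_newton (curvatures_spec body bp) d0) mulmx_sumr raddf_sum.
    by apply: eq_bigr => j _; rewrite -scalemxAr -mxtraceZ.
  rewrite !mulrBr tE mulrCA tE (det_addZ_sigma (curvatures_spec body bp)).
  rewrite mulr_suml mulr_sumr -!sumrB; apply: eq_bigr => j _.
  rewrite trace_shape_newton//; last 2 first.
  - exact: curvatures_spec.
  - by rewrite -ltnS.
  by rewrite /newton_divergence; ring.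
- exact: normal_unit.
- exact: normal_shape.
- exact: (shape_normal body ch).
- exact: (chart_normal_orth body ch).
- exact: (chart_frame_unit body ch).
- exact: uG.
- move=> a b; apply/rowP => j; rewrite (SE a b) (SE b a).
  exact: (derive_swap _ _ oU (Cpsi 2 j) Ux).
- move=> a; apply/rowP => j; rewrite [LHS]mxE dME [RHS]mxE -(derive_chart_normal ch Ux).
  by congr ('D__ _ x); apply/funext => y; rewrite /E mxE frame0.
- move=> a; apply/rowP => j; rewrite [LHS]mxE dME.
  have [_ _ D] := dZ j; transitivity (dot (row a P) (col j (DZ p))^T).
    rewrite -(D _ _ ch)//; congr ('D__ _ x); apply/funext => y.
    by rewrite /E mxE eqxx.
  by rewrite dotE !mxE; apply: eq_bigr => i _; rewrite !mxE.
- move=> a b ba; apply/rowP => j; rewrite [LHS]mxE dME (SE a b); congr ('D__ _ x).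
  by apply/funext => y; rewrite /E mxE (inj_eq lift_inj) (negbTE ba) frameS mxE.
Qed.

End Divergence.

End SurfaceCalculus.

(** * The divergence theorem for Newton tensors *)

Section Transport.
Import HBNNSimple.
Local Open Scope ereal_scope.
Context {R : realType} d1 d2 (T1 : measurableType d1) (T2 : measurableType d2).
Variables (m1 : {measure set T1 -> \bar R}) (m2 : {measure set T2 -> \bar R}).
Variables (D : set T2) (g : T1 -> T2) (w : T1 -> R).
Hypotheses (mD : measurable D) (mg : measurable_fun setT g) (mw : measurable_fun setT w).
Hypothesis w0 : forall x, (0 <= w x)%R.
Hypothesis H : forall E, measurable E -> m2 (E `&` D) = \int[m1]_x (\1_E (g x) * w x)%:E.

(** Simple functions carry the change of variables from sets, where it is the hypothesis [H], to
    nonnegative functions. *)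
Lemma ge0_integral_transport (f : T2 -> R) : measurable_fun setT f -> (forall y, (0 <= f y)%R) ->
  \int[m2]_(y in D) (f y)%:E = \int[m1]_x (f (g x) * w x)%:E.
Proof.
move=> mf f0; have mf' : measurable_fun setT (EFin \o f) by exact/measurable_EFinP.
pose f_ := nnsfun_approx measurableT mf'.
have f'0 (x : T2) : setT x -> 0 <= (EFin \o f) x by rewrite lee_fin.
have mfg (n : nat) : measurable_fun setT (fun x => f_ n (g x)).
  exact: (measurableT_comp (measurable_funP (f_ n)) mg).
transitivity (limn (fun n => \int[m2]_(x in D) (f_ n x)%:E)).
  rewrite -monotone_convergence//.
  - by apply: eq_integral => y _; apply/esym/cvg_lim => //; exact: cvg_nnsfun_approx.
  - by move=> n; apply/measurable_EFinP; apply: measurable_funTS; exact: measurable_funP.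
  - by move=> n y _; rewrite lee_fin.
  - by move=> y _ m n mn; rewrite lee_fin; exact/lefP/nd_nnsfun_approx.
transitivity (limn (fun n => \int[m1]_x (f_ n (g x) * w x)%:E)); last first.
  rewrite -monotone_convergence//.
  - apply: eq_integral => x _; apply/cvg_lim => //.
    under eq_fun do rewrite EFinM.
    rewrite EFinM; apply: cvgeZr => //.
    exact: (cvg_nnsfun_approx measurableT mf' f'0 (x := g x) I).
  - by move=> n; apply/measurable_EFinP; exact: measurable_funM.
  - by move=> n x _; rewrite lee_fin mulr_ge0.
  - move=> x _ m n mn; rewrite lee_fin ler_wpM2r//.
    by move: (g x); exact/lefP/nd_nnsfun_approx.
congr (limn _); apply/funext => n.
have mfn r : measurable (f_ n @^-1` [set r]) by [].
transitivity (\sum_(k \in range (f_ n))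
    \int[m2]_(x in D) (k * \1_(f_ n @^-1` [set k]) x)%:E).
  under eq_integral do rewrite fimfunE -fsumEFin//.
  rewrite ge0_integral_fsum//.
  - by move=> y; apply/measurable_EFinP; apply: measurable_funTS; exact: measurable_funM.
  - by move=> y x _; rewrite nnfun_muleindic_ge0.
have nn k x : 0 <= (k * \1_(f_ n @^-1` [set k]) (g x) * w x)%:E.
  rewrite EFinM; apply: mule_ge0; last by rewrite lee_fin.
  by rewrite nnfun_muleindic_ge0.
have mi k : measurable_fun setT (fun x => \1_(f_ n @^-1` [set k]) (g x) : R).
  by apply: (measurableT_comp _ mg); exact: measurable_indic.
transitivity (\sum_(k \in range (f_ n))
    \int[m1]_x (k * \1_(f_ n @^-1` [set k]) (g x) * w x)%:E); last first.
  rewrite -ge0_integral_fsum//.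
  - apply: eq_integral => x _; rewrite fsumEFin//; congr EFin.
    by rewrite fimfunE mulr_fsuml.
  - move=> k; apply/measurable_EFinP; apply: measurable_funM => //.
    by apply: measurable_funM => //; exact: mi.
apply: eq_fsbigr => r _; rewrite integralZl_indic_nnsfun// integral_indic// H//.
have [r0|r0] := ltP r 0%R.
  rewrite preimage_nnfun0// !integral0_eq ?mule0// => x _; rewrite indic0 ?mulr0 ?mul0r//.
rewrite -ge0_integralZl_EFin//.
- by apply: eq_integral => x _; rewrite -EFinM mulrA.
- by move=> x _; rewrite lee_fin mulr_ge0.
- by apply/measurable_EFinP; apply: measurable_funM => //; exact: mi.
Qed.

Lemma integral_transport (f : T2 -> R) : measurable_fun setT f ->
  \int[m2]_(y in D) (f y)%:E = \int[m1]_x (f (g x) * w x)%:E.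
Proof.
move=> mf; rewrite integralE [RHS]integralE.
have E1 : \int[m2]_(y in D) (fun y => (f y)%:E)^\+ y =
    \int[m1]_x (fun x => (f (g x) * w x)%:E)^\+ x.
  transitivity (\int[m2]_(y in D) (Num.max (f y) 0)%:E).
    by apply: eq_integral => y _; rewrite funeposE EFin_max.
  rewrite ge0_integral_transport//; last 2 first.
  - by apply: measurable_maxr.
  - by move=> y; rewrite le_max lexx orbT.
  by apply: eq_integral => x _; rewrite funeposE -EFin_max maxr_pMl// mul0r.
have E2 : \int[m2]_(y in D) (fun y => (f y)%:E)^\- y =
    \int[m1]_x (fun x => (f (g x) * w x)%:E)^\- x.
  transitivity (\int[m2]_(y in D) (Num.max (- f y) 0)%:E).
    by apply: eq_integral => y _; rewrite funenegE EFin_max.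
  rewrite ge0_integral_transport//; last 2 first.
  - by apply: measurable_maxr => //; exact: measurableT_comp.
  - by move=> y; rewrite le_max lexx orbT.
  by apply: eq_integral => x _; rewrite funenegE -EFinN -EFin_max -mulNr maxr_pMl// mul0r.
by rewrite E1 E2.
Qed.

End Transport.

Lemma measurable_indic_mul {R : realType} d (U E : set 'rV[R]_d) (f : 'rV[R]_d -> R) :
  open U -> (forall x, U x -> {for x, continuous f}) ->
  measurable (E : set (borel d)) -> E `<=` U ->
  measurable_fun setT (fun x : borel d => \1_E x * f x).
Proof.
move=> oU cf mE EU; apply: measurable_fun_opens => O oO; rewrite setTI.
have oW : open (U `&` f @^-1` O).
  rewrite openE => x [Ux Ox]; apply: filterI; first exact: open_nbhs_nbhs.
  by apply: (cf x Ux); exact: open_nbhs_nbhs.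
have -> : (fun x : borel d => \1_E x * f x) @^-1` O =
    (E `&` (U `&` f @^-1` O)) `|` (~` E `&` [set x | O 0]).
  apply/seteqP; split=> x /=.
    have [Ex|nEx] := pselect (E x).
      by rewrite indicE mem_set// mul1r => Ox; left; split => //; split => //; exact: EU.
    by rewrite indicE memNset// mul0r => O0; right.
  move=> [[Ex [_ Ox]]|[nEx O0]]; first by rewrite indicE mem_set// mul1r.
  by rewrite indicE memNset// mul0r.
apply: measurableU; first by apply: measurableI => //; exact: borel_open.
apply: measurableI; first exact: measurableC.
have [Oz|nOz] := pselect (O 0).
  by rewrite (_ : [set _ | _] = setT) //; apply/seteqP; split.
by rewrite (_ : [set _ | _] = set0) //; apply/seteqP; split.
Qed.

Section SurfaceMeasure.
Context {R : realType} {n : nat} (Omega : set 'rV[R]_n.+1).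
Variable mu : {measure set (@borel R n.+1) -> \bar R}.
Hypothesis body : convex_body Omega.
Let oO := body_open body.
Let cO := body_convex body.
Let O0 := body_neq0 body.
Let bO := body_bounded body.
Let sS := body_smooth body.
Implicit Types (p : 'rV[R]_n.+1) (f : 'rV[R]_n.+1 -> R).

Let nu := normal Omega.
Notation Sigma := (boundary Omega).
Hypothesis mu_area : is_area_measure Sigma mu.

(** Charts are open maps into the hypersurface, so a function continuous in every chart is
    continuous for the induced topology. *)
Lemma surface_C0_open f (O : set R) : surface_Ck Omega 0 f -> open O ->
  exists2 V, open V & V `&` Sigma = f @^-1` O `&` Sigma.
Proof.
move=> Cf oO'; exists (\bigcup_(V in [set V | open V /\ V `&` Sigma `<=` f @^-1` O]) V).
  by apply: bigcup_open => V [].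
apply/seteqP; split=> p [].
  by move=> [V [_ VO] Vp] Sp; split => //; apply: VO.
move=> Op Sp; split=> //; have [U [phi [ch [x Ux xp]]]] := sS Sp.
have [oU _ _ _ op] := ch.
have oW : open (U `&` (f \o phi) @^-1` O).
  rewrite openE => y [Uy Oy]; apply: filterI; first exact: open_nbhs_nbhs.
  by apply: (Cf _ _ ch y Uy); exact: open_nbhs_nbhs.
have [V oV VE] := op _ oW (@subIsetl _ _ _).
exists V.
  by split => // q; rewrite -VE => -[y [Uy Oy] <-].
have : (V `&` Sigma) p by rewrite -VE; exists x => //; split => //=; rewrite xp.
by case.
Qed.

Lemma measurable_boundary : measurable (Sigma : set (borel n.+1)).
Proof. by apply: borel_closed; exact: boundary_closed. Qed.

Lemma surface_C0_measurable f : surface_Ck Omega 0 f ->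
  measurable_fun (Sigma : set (borel n.+1)) (f : borel n.+1 -> R).
Proof.
move=> Cf; apply: measurable_fun_opens => O oO'.
have [V oV E] := surface_C0_open Cf oO'.
by rewrite setIC -E; apply: measurableI; [exact: borel_open|exact: measurable_boundary].
Qed.

Lemma surface_C0_bounded f : surface_Ck Omega 0 f ->
  exists C, 0 <= C /\ forall p, Sigma p -> `|f p| <= C.
Proof.
move=> Cf; apply: continuous_compact_bounded; first exact: boundary_compact.
apply/continuousP => O oO'; apply/open_subspaceP; exact: surface_C0_open.
Qed.

Section ChartIntegral.
Variables (U : set 'rV[R]_n) (phi : 'rV[R]_n -> 'rV[R]_n.+1).
Hypothesis ch : local_param Sigma U phi.

Let oU : open U. Proof. by case: ch. Qed.

Definition gram (x : 'rV[R]_n) := Num.sqrt (\det ('J phi x *m ('J phi x)^T)).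

Lemma gramE x : U x -> gram x = `|\det (frame (nu (phi x)) ('J phi x))|.
Proof.
move=> Ux; apply: sqrt_det_gram; first exact/(normal_unit body)/(chart_boundary ch).
exact: (chart_normal_orth body ch).
Qed.

Lemma gram_gt0 x : U x -> 0 < gram x.
Proof.
move=> Ux; rewrite gramE// normr_gt0.
by have := chart_frame_unit body ch Ux; rewrite unitmxE unitfE.
Qed.

Lemma gram_continuous x : U x -> {for x, continuous gram}.
Proof.
have C0 : CkR 0 U (fun x => \det (frame (nu (phi x)) ('J phi x))).
  by apply: (CkR_det oU) => i j; exact: (chart_frame_CkR body ch).
have C1 : CkR 0 U (fun x => `|\det (frame (nu (phi x)) ('J phi x))|).
  move=> y Uy; apply: (@continuous_comp _ _ _ _ (fun z : R => `|z|)); first exact: C0.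
  exact: norm_continuous.
by move: x; apply: (CkR_eq oU (k := 0)) C1 => x Ux; rewrite gramE.
Qed.

Lemma area_image (E : set 'rV[R]_n) : measurable (E : set (borel n)) -> E `<=` U ->
  mu (phi @` E) = (\int[lebesgue_rV n]_x (\1_E x * gram x)%:E)%E.
Proof.
move=> mE EU; rewrite (mu_area.2 _ _ _ ch mE EU) lebesgue_intE//.
apply/measurable_EFinP; exact: (measurable_indic_mul oU gram_continuous).
Qed.

Lemma chart_integral (B : set 'rV[R]_n) f : open B -> B `<=` U -> surface_Ck Omega 0 f ->
  (\int[mu]_(p in phi @` B) (f p)%:E = \int[lebesgue_rV n]_x (\1_B x * (f (phi x) * gram x))%:E)%E.
Proof.
move=> oB BU Cf; have [_ _ _ _ /(_ B oB BU) [V oV VE]] := ch.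
have mB : measurable (B : set (borel n)) by exact: borel_open.
have BS : phi @` B `<=` Sigma by rewrite VE => ? [].
have mphiB : measurable (phi @` B : set (borel n.+1)).
  by rewrite VE; apply: measurableI; [exact: borel_open|exact: measurable_boundary].
(* Regularity of [phi] is known on [U] only. Cut off outside [B] it is measurable everywhere, and
   the weight [\1_B x * gram x] hides the values elsewhere. *)
pose g (x : borel n) : borel n.+1 := \1_B x *: phi x.
have mg : measurable_fun setT g.
  apply: measurable_fun_rV => j; rewrite (_ : (fun _ => _) = fun x => \1_B x * phi x 0 j).
    by apply: (measurable_indic_mul oU) => // x Ux; exact: (chart_CkR ch 0 j).
  by apply/funext => x; rewrite /g mxE.
have gE x : B x -> g x = phi x by move=> Bx; rewrite /g indicE mem_set// scale1r.
pose f' := f \_ (phi @` B).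
have mf' : measurable_fun setT (f' : borel n.+1 -> R).
  apply/(measurable_restrictT _ _).1 => //.
  by apply: measurable_funS (surface_C0_measurable Cf) => //; exact: measurable_boundary.
transitivity (\int[mu]_(p in phi @` B) (f' p)%:E)%E.
  by apply: eq_integral => p; rewrite inE /f' patchE => /mem_set ->.
rewrite (@integral_transport _ _ _ _ _ (lebesgue_rV n) _ _ g (fun x => \1_B x * gram x))//.
- apply: eq_integral => x _; congr EFin; have [Bx|nBx] := pselect (B x).
    rewrite gE// indicE mem_set// !mul1r /f' patchE mem_set//; by exists x.
  by rewrite indicE memNset// !mul0r mulr0.
- exact: (measurable_indic_mul oU gram_continuous).
- by move=> x; rewrite mulr_ge0// sqrtr_ge0.
move=> E mE; have [_ _ iphi _ _] := ch.
have EB : E `&` phi @` B = phi @` (B `&` g @^-1` E).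
  apply/seteqP; split=> p.
    by move=> [Ep [x Bx xp]]; exists x => //; split => //=; rewrite gE// xp.
  by move=> [x [Bx /= Ex] <-]; split; [rewrite -gE|exists x].
have mBE : measurable (B `&` g @^-1` E : set (borel n)).
  by apply: measurableI => //; rewrite -[X in measurable X]setTI; exact: mg.
rewrite EB area_image//; last by move=> x [/BU].
apply: eq_integral => x _; congr EFin.
by rewrite mulrA; congr (_ * _); rewrite indicI /= mulrC.
Qed.

End ChartIntegral.

End SurfaceMeasure.

Section ExtensionByZero.
Context {R : realType} {d : nat}.
Variables (U : set 'rV[R]_d) (f : 'rV[R]_d -> R) (x : 'rV[R]_d) (e : R).
Hypotheses (oU : open U) (e0 : 0 < e) (BU : ball x (e + e) `<=` U).
Hypotheses (Cf : CkR 1 U f) (f0 : forall y, U y -> ~ ball x e y -> f y = 0).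

(** [f] is controlled on [U] only, while [integral_derive_eq0] takes a function on the whole space.
    As the doubled ball lies in [U], a point outside [U] has a neighbourhood of radius [e] that
    misses [ball x e]; hence the extension is locally [f] or locally [0]. *)
Definition zero_extension y := \1_(ball x e) y * f y.
Local Notation h := zero_extension.

Lemma zero_extensionE y : U y -> h y = f y.
Proof.
move=> Uy; rewrite /h indicE; have [By|nBy] := pselect (ball x e y).
  by rewrite mem_set// mul1r.
by rewrite memNset// mul0r f0.
Qed.

Let near_in y : U y -> \forall z \near y, f z = h z.
Proof.
by move=> Uy; apply: filterS (open_nbhs_nbhs (conj oU Uy)) => z /zero_extensionE.
Qed.

Let near_out y : ~ U y -> \forall z \near y, cst (0 : R) z = h z.
Proof.
move=> nUy; apply: filterS (nbhsx_ballx y e e0) => z yz.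
rewrite /h indicE memNset ?mul0r// => xz; apply: nUy; apply: BU.
by apply: ball_triangle xz _; exact: ball_sym.
Qed.

Lemma zero_extension_differentiable y : differentiable h y.
Proof.
have [Uy|nUy] := pselect (U y); last first.
  exact: (near_eq_differentiable (near_out nUy) (differentiable_cst (0 : R) y)).1.
by apply: (near_eq_differentiable (near_in Uy) _).1; case: Cf => + _; exact.
Qed.

Lemma derive_zero_extension v y : U y -> 'D_v h y = 'D_v f y.
Proof. by move=> Uy; rewrite (near_eq_derive v (near_in Uy)). Qed.

Lemma derive_zero_extension_out v y : ~ U y -> 'D_v h y = 0.
Proof.
move=> nUy; rewrite -(near_eq_derive v (near_out nUy)).
exact: derive_cst.
Qed.

Lemma derive_zero_extension_continuous i : continuous ('D_(delta_mx 0 i) h).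
Proof.
move=> y; have [Uy|nUy] := pselect (U y).
  have [_ /(_ i) C0] := Cf.
  have near' : \forall z \near y, 'D_(delta_mx 0 i) f z = 'D_(delta_mx 0 i) h z.
    by apply: filterS (open_nbhs_nbhs (conj oU Uy)) => z /derive_zero_extension ->.
  rewrite /continuous_at -(nbhs_singleton near').
  exact: cvg_trans (@near_eq_cvg _ _ (nbhs y) _ _ _ near') (C0 y Uy).
have near' : \forall z \near y, cst (0 : R) z = 'D_(delta_mx 0 i) h z.
  apply: filterS (nbhs_interior (near_out nUy)) => z nz.
  by rewrite -(near_eq_derive _ nz); exact/esym/derive_cst.
rewrite /continuous_at -(nbhs_singleton near').
exact: cvg_trans (@near_eq_cvg _ _ (nbhs y) _ _ _ near') (cvg_cst _).
Qed.

Lemma zero_extension_support y : `|x| + e <= `|y| -> h y = 0.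
Proof.
move=> xy; rewrite /h indicE memNset ?mul0r//.
rewrite -ball_normE /ball_ /= => xye.
have := lerB_dist y x; rewrite distrC => /le_lt_trans/(_ xye).
by rewrite ltrBlDr addrC ltNge xy.
Qed.

Lemma integral_derive_extension i :
  (lebesgue_rV d).-integrable setT (fun y : borel d => ('D_(delta_mx 0 i) h y)%:E) /\
  (\int[lebesgue_rV d]_y ('D_(delta_mx 0 i) h y)%:E = 0)%E.
Proof.
have dh := zero_extension_differentiable.
have ch : continuous ('D_(delta_mx 0 i) h) by exact: derive_zero_extension_continuous.
split; last exact: integral_derive_eq0 zero_extension_support.
apply: (@continuous_support_integrable _ _ _ (`|x| + e + 1)) => // y xy.
have nb : \forall z \near y, cst (0 : R) z = h z.
  apply: filterS (nbhsx_ballx y 1 ltr01) => z; rewrite -ball_normE /ball_ /= => yz.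
  apply/esym/zero_extension_support.
  rewrite -(lerD2r 1) (le_trans xy)// -lerBlDl (le_trans (lerB_dist _ _))// ltW//.
rewrite -(near_eq_derive _ nb); exact: derive_cst.
Qed.

End ExtensionByZero.

Lemma integral_scaled_ball {R : realType} d (C : R) (x : 'rV[R]_d) (e : R) : 0 <= C -> 0 < e ->
  (\int[lebesgue_rV d]_y (C * \1_(ball x e) y)%:E = (C * (2 * e) ^+ d)%:E)%E.
Proof.
move=> C0 e0; have mB := borel_ball x e; under eq_integral do rewrite EFinM.
rewrite ge0_integralZl_EFin//; last by apply/measurable_EFinP; exact: measurable_indic.
by rewrite integral_indic// setIT [X in (_ * X)%E](lebesgue_rV_ball x).
Qed.

Section SurfaceDivergence.
Context {R : realType} {n : nat} (Omega : set 'rV[R]_n.+1).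
Variable mu : {measure set (@borel R n.+1) -> \bar R}.
Hypothesis body : convex_body Omega.
Let oO := body_open body.
Let cO := body_convex body.
Let O0 := body_neq0 body.
Let bO := body_bounded body.
Let sS := body_smooth body.
Implicit Types (p : 'rV[R]_n.+1) (f : 'rV[R]_n.+1 -> R).

Let nu := normal Omega.
Notation Sigma := (boundary Omega).
Hypothesis mu_area : is_area_measure Sigma mu.

Let mS := measurable_boundary Omega.

(** The doubled ball leaves room for an extension by zero, [rho] places the part of [Sigma] near [p]
    in the image of the inner ball, [C] bounds the area density, and [c] is the sign of the frame
    determinant, constant on the ball, which replaces the absolute value in [gramE]. *)
Lemma local_piece p : Sigma p -> exists U phi x (e rho c C : R),
  [/\ local_param Sigma U phi, U x & phi x = p] /\
  [/\ 0 < e, 0 < rho, ball x (e + e) `<=` U,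
      (forall q, Sigma q -> enorm (q - p) < rho -> (phi @` ball x e) q) &
      forall y, ball x (e + e) y -> gram phi y <= C /\
        gram phi y = c * \det (frame (nu (phi y)) ('J phi y))].
Proof.
move=> Sp; have [U [phi [ch [x Ux xp]]]] := sS Sp; have [oU _ _ _ op] := ch.
pose D y := \det (frame (nu (phi y)) ('J phi y)); pose c := Num.sg (D x).
have D0 : D x != 0 by have := chart_frame_unit body ch Ux; rewrite unitmxE unitfE.
have cD : {for x, continuous (fun y => c * D y)}.
  apply: (@continuousM _ _ (cst c) D); first exact: cst_continuous.
  have C0 : CkR 0 U D by apply: (CkR_det oU) => i j; exact: (chart_frame_CkR body ch).
  exact: C0.
have N : \forall y \near x, [/\ U y, 0 < c * D y & gram phi y < gram phi x + 1].
  near=> y; split; near: y.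
  - exact: open_nbhs_nbhs.
  - have : 0 < c * D x by rewrite /c -normrEsg normr_gt0.
    by move: cD => /cvgr_gt; apply.
  - by have /cvgr_lt := gram_continuous body ch Ux; apply; rewrite ltrDl.
have /nbhs_ballP[e2 /= e20 eN] := N.
pose e := e2 / 2; have e0 : 0 < e by rewrite divr_gt0.
have ee : e + e = e2 by rewrite /e -splitr.
have [V oV VE] : exists2 V, open V & phi @` ball x e = V `&` Sigma.
  apply: op; first exact: ball_open.
  move=> y xy; have [] := eN y => //; rewrite -ee.
  by apply: le_ball xy; rewrite lerDl ltW.
have [rho /= rho0 rhoV] : exists2 rho, 0 < rho & ball p rho `<=` V.
  have Vp : V p.
    have : (V `&` Sigma) p by rewrite -VE; exists x => //; exact: ballxx.
    by case.
  by have /nbhs_ballP[rho r0 rV] := open_nbhs_nbhs (conj oV Vp); exists rho.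
exists U, phi, x, e, rho, c, (gram phi x + 1); split; split => //.
- by rewrite ee => y /eN[].
- move=> q Sq qp; suff : (phi @` ball x e) q by [].
  rewrite VE; split => //; apply: rhoV.
  rewrite -ball_normE /ball_ /= distrC; exact: le_lt_trans (enorm_ge_norm _) qp.
- rewrite ee => y /eN[Uy cy gy]; split; first exact: ltW.
  rewrite (gramE body ch Uy) -/(D y) -(gtr0_norm cy) normrM.
  by rewrite /c normr_sg D0 mul1r.
Unshelve. all: by end_near. Qed.

Lemma open_enorm_ball p r : open [set q : 'rV[R]_n.+1 | enorm (q - p) < r].
Proof.
rewrite (_ : [set _ | _] = (fun q => enorm (q - p)) @^-1` [set z | z < r])//.
apply: open_comp; last exact: open_lt.
move=> q _; rewrite /enorm.
apply: (@continuous_comp _ _ _ (fun q : 'rV[R]_n.+1 => dot (q - p) (q - p)) (@Num.sqrt R)).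
  have cs : {for q, continuous (fun q : 'rV[R]_n.+1 => q - p)}.
    by apply: (@continuousB _ _ _ id (cst p)); [exact: cvg_id|exact: cst_continuous].
  exact: continuous_dot.
exact: sqrt_continuous.
Qed.

Lemma boundary_cover (rho : 'rV[R]_n.+1 -> R) : (forall p, Sigma p -> 0 < rho p) ->
  exists s : seq 'rV[R]_n.+1, (forall p, p \in s -> Sigma p) /\
    forall q, Sigma q -> exists2 p, p \in s & enorm (q - p) < rho p.
Proof.
move=> rho0; have : compact Sigma by exact: boundary_compact.
rewrite compact_cover => /(_ _ Sigma (fun p => [set q | enorm (q - p) < rho p])) [].
- by move=> p _; exact: open_enorm_ball.
- by move=> q Sq; exists q => //=; rewrite subrr /enorm dot0l sqrtr0 rho0.
move=> D DS cov; exists (finmap.enum_fset D); split.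
  by move=> p pD; have := DS p pD; rewrite inE.
by move=> q /cov[p pD qp]; exists p.
Qed.

(** Compactness yields a finite cover by pieces of charts on which the area density is bounded. *)
Lemma area_finite : (mu Sigma < +oo)%E.
Proof.
have /choice[rho rhoP] p : exists rho, Sigma p -> 0 < rho /\
    (mu (Sigma `&` [set q | (enorm (q - p) < rho)%R]) < +oo)%E.
  have [Sp|] := pselect (Sigma p); last by exists 0.
  have [U [phi [x [e [rho [c [C [[ch Ux xp] [e0 rho0 BU cov gC]]]]]]]]] := local_piece Sp.
  have BU' : ball x e `<=` U.
    by apply: subset_trans BU => y; apply: le_ball; rewrite lerDl ltW.
  have [oU _ _ _ /(_ (ball x e) (ball_open _ _) BU')[V oV VE]] := ch.
  have mB := borel_ball x e; have mi : measurable_fun setT (fun y : borel n => (\1_(ball x e) y : R)).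
    exact: measurable_indic.
  exists rho => _; split => //.
  apply: (@le_lt_trans _ _ (mu (phi @` ball x e))).
    apply: le_measure; rewrite ?inE.
    - apply: measurableI => //; apply: borel_open; exact: open_enorm_ball.
    - by rewrite VE; apply: measurableI => //; exact: borel_open.
    - by move=> q [Sq qp]; exact: cov.
  rewrite (area_image body mu_area ch)//.
  apply: (@le_lt_trans _ _ (\int[lebesgue_rV n]_y (C * \1_(ball x e) y)%:E)%E).
    apply: ge0_le_integral => //.
    - by move=> y _; rewrite lee_fin mulr_ge0// sqrtr_ge0.
    - apply/measurable_EFinP; exact: (measurable_indic_mul oU (gram_continuous body ch)).
    - by apply/measurable_EFinP; apply: measurable_funM.
    move=> y _; rewrite lee_fin indicE; case: (boolP (_ \in _)); rewrite ?mulr1 ?mul1r ?mulr0 ?mul0r//.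
    by rewrite inE => xy; apply: (gC y _).1; apply: le_ball xy; rewrite lerDl ltW.
  rewrite integral_scaled_ball ?ltry//.
  have [] := gC x; last by move=> + _; apply: le_trans; exact: sqrtr_ge0.
  by apply: ballxx; rewrite addr_gt0.
have [s [sS' cov]] := boundary_cover (fun p Sp => (rhoP p Sp).1).
pose W (t : seq 'rV[R]_n.+1) := [set q | exists2 p, p \in t & (Sigma `&` [set q | enorm (q - p) < rho p]) q].
suff : measurable (W s : set (borel n.+1)) /\ (mu (W s) < +oo)%E.
  move=> [mW]; apply: le_lt_trans; apply: le_measure; rewrite ?inE//.
  by move=> q Sq; have [p ps qp] := cov q Sq; exists p.
elim: s sS' {cov} => [_|p t IH pS].
  rewrite (_ : W [::] = set0) ?measure0; last by apply/seteqP; split => // q [].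
  by split; [exact: measurable0|].
have [|mW fW] := IH; first by move=> q qt; apply: pS; rewrite inE qt orbT.
have Sp : Sigma p by apply: pS; rewrite mem_head.
have mV : measurable (Sigma `&` [set q | enorm (q - p) < rho p] : set (borel n.+1)).
  by apply: measurableI => //; apply: borel_open; exact: open_enorm_ball.
have -> : W (p :: t) = (Sigma `&` [set q | enorm (q - p) < rho p]) `|` W t.
  apply/seteqP; split=> q.
    move=> [p']; rewrite inE => /predU1P[-> ?|p't ?]; first by left.
    by right; exists p'.
  move=> [?|[p' p't ?]]; first by exists p => //; rewrite mem_head.
  by exists p' => //; rewrite inE p't orbT.
split; first exact: measurableU.
apply: le_lt_trans (measureU2 _ _ _) _ => //.
by apply: lte_add_pinfty => //; exact: (rhoP p Sp).2.
Qed.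

Lemma surface_C0_integrable f : surface_Ck Omega 0 f -> mu.-integrable Sigma (EFin \o f).
Proof.
move=> Cf; apply: measurable_bounded_integrable => //.
- exact: area_finite.
- exact: surface_C0_measurable.
have [C [C0 CP]] := surface_C0_bounded body Cf.
exists C; split; first exact: num_real.
by move=> M CM p Sp; apply: le_trans (CP p Sp) (ltW CM).
Qed.

(** A positive value persists on a chart ball, where the integrand times the area density stays
    above some [m > 0]; such a ball has positive Lebesgue measure. *)
Lemma surface_C0_eq0 f : surface_Ck Omega 0 f -> (forall p, Sigma p -> 0 <= f p) ->
  \int[mu]_(p in Sigma) f p = 0 -> forall p, Sigma p -> f p = 0.
Proof.
move=> Cf f0 If p Sp; apply/eqP; apply/negPn/negP => fp.
have {}fp : 0 < f p by rewrite lt_neqAle eq_sym fp f0.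
have {}If : (\int[mu]_(q in Sigma) (f q)%:E = 0)%E.
  rewrite -[LHS]fineK; first by rewrite -[fine _]/(\int[mu]_(q in Sigma) f q) If.
  by apply: integrable_fin_num => //; exact: surface_C0_integrable.
have [U [phi [ch [x Ux xp]]]] := sS Sp; have [oU _ _ _ op] := ch.
pose m := f p * gram phi x / 2.
have m0 : 0 < m by rewrite divr_gt0// mulr_gt0// (gram_gt0 body ch).
have cm : {for x, continuous (fun y => f (phi y) * gram phi y)}.
  apply: (@continuousM _ _ (f \o phi) (gram phi)); first exact: (Cf _ _ ch).
  exact: (gram_continuous body ch).
have N : \forall y \near x, U y /\ m < f (phi y) * gram phi y.
  near=> y; split; near: y; first exact: open_nbhs_nbhs.
  move: cm => /cvgr_gt; apply; rewrite xp /m.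
  by rewrite ltr_pdivrMr// ltr_pMr ?ltr1n// mulr_gt0// (gram_gt0 body ch).
have /nbhs_ballP[e /= e0 eN] := N.
have BU : ball x e `<=` U by move=> y /eN[].
have [V oV VE] := op _ (ball_open x e) BU.
have BS : phi @` ball x e `<=` Sigma by rewrite VE => ? [].
have mB := borel_ball x e; have mphiB : measurable (phi @` ball x e : set (borel n.+1)).
  by rewrite VE; apply: measurableI => //; exact: borel_open.
have : (\int[mu]_(q in phi @` ball x e) (f q)%:E <= 0)%E.
  rewrite -If; apply: ge0_subset_integral => //.
  by apply/measurable_EFinP; exact: surface_C0_measurable.
rewrite (chart_integral body mu_area ch (ball_open x e))//; apply/negP; rewrite -ltNge.
apply: (@lt_le_trans _ _ (\int[lebesgue_rV n]_y (m * \1_(ball x e) y)%:E)%E).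
  by rewrite integral_scaled_ball ?(ltW m0)// lte_fin mulr_gt0// exprn_gt0// mulr_gt0.
apply: ge0_le_integral => //.
- by move=> y _; rewrite lee_fin mulr_ge0// ltW.
- by apply/measurable_EFinP; apply: measurable_funM => //; exact: measurable_indic.
- apply/measurable_EFinP.
  apply: (measurable_indic_mul (f := fun y => f (phi y) * gram phi y) oU _ mB BU) => y Uy.
  apply: (@continuousM _ _ (f \o phi) (gram phi)); first exact: (Cf _ _ ch).
  exact: (gram_continuous body ch).
move=> y _; rewrite lee_fin indicE; case: (boolP (_ \in _)); rewrite ?mul0r ?mulr0// inE mul1r mulr1.
by move=> /eN[_ /ltW].
Unshelve. all: by end_near. Qed.

Section LocalDivergence.
Variables (Z : 'rV[R]_n.+1 -> 'rV[R]_n.+1) (DZ : 'rV[R]_n.+1 -> 'M[R]_n.+1).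
Hypothesis dZ : has_differential Omega Z DZ.

Lemma surface_C0_newton_divergence j : surface_Ck Omega 0 (newton_divergence Omega j Z DZ).
Proof.
have CZ i : surface_Ck Omega 0 (fun p => Z p 0 i).
  by have [C _ _] := dZ i; move=> U phi ch; exact/CkR_pred/C.
have CDZ i l : surface_Ck Omega 0 (fun p => DZ p i l).
  by have [_ /(_ i) C _] := dZ l; apply: surface_Ck_eq C => p _; rewrite !mxE.
have Cs i := (surface_Ck_newton_sigma body 0 i).2.
have CT := (surface_Ck_newton_sigma body 0 j).1.
have Cn := surface_Ck_normal body 0.
apply: surface_Ck_sub; last first.
  apply: surface_Ck_mul; first by apply: surface_Ck_dot.
  by apply: surface_Ck_mul => //; exact: surface_Ck_cst.
apply: surface_Ck_sub.
  by apply: surface_Ck_sum => i _; apply: surface_Ck_mulmx.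
apply: surface_Ck_mul => //; apply: surface_Ck_dot => // i.
by apply: surface_Ck_mulmx => // a b; rewrite ord1.
Qed.

(** For a field supported in a chart ball, the integral is that of [c] times the coordinate
    divergence of [flux], extended by zero, and each partial derivative integrates to [0]. *)
Lemma local_divergence (U : set 'rV[R]_n) phi x e c s : local_param Sigma U phi -> 0 < e -> 0 <= s ->
  ball x (e + e) `<=` U ->
  (forall y, ball x (e + e) y -> gram phi y = c * \det (frame (nu (phi y)) ('J phi y))) ->
  (forall q, Sigma q -> ~ (phi @` ball x e) q -> Z q = 0 /\ DZ q = 0) ->
  (\int[mu]_(p in Sigma) (\sum_(j < n.+1) s ^+ j * newton_divergence Omega j Z DZ p)%:E = 0)%E.
Proof.
move=> ch e0 s0 BU gc Z0; have [oU _ iphi _ op] := ch.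
have BU' : ball x e `<=` U.
  by apply: subset_trans BU => y; apply: le_ball; rewrite lerDl ltW.
pose F p := \sum_(j < n.+1) s ^+ j * newton_divergence Omega j Z DZ p.
have CF : surface_Ck Omega 0 F.
  apply: surface_Ck_sum => j _; apply: surface_Ck_mul; first exact: surface_Ck_cst.
  exact: surface_C0_newton_divergence.
have F0 q : Sigma q -> ~ (phi @` ball x e) q -> F q = 0.
  move=> Sq /(Z0 q Sq)[Zq DZq]; rewrite /F big1// => j _.
  by rewrite /newton_divergence Zq DZq mul0mx mulmx0 raddf0 !dot0l mulr0 mul0r !subr0 mulr0.
have off y : U y -> ~ ball x e y -> ~ (phi @` ball x e) (phi y).
  by move=> Uy nBy [y' By' /iphi E]; apply: nBy; rewrite -E// inE//; exact: BU'.
have [V oV VE] := op _ (ball_open x e) BU'.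
have BS : phi @` ball x e `<=` Sigma by rewrite VE => ? [].
have mphiB : measurable (phi @` ball x e : set (borel n.+1)).
  by rewrite VE; apply: measurableI => //; exact: borel_open.
transitivity (\int[mu]_(p in phi @` ball x e) (F p)%:E)%E.
  rewrite -[in RHS](setIidr BS) [RHS]integral_mkcondr; apply: eq_integral => p; rewrite inE => Sp.
  rewrite patchE; case: ifPn => //; rewrite notin_setE => /(F0 p Sp) E.
  by rewrite -/(F p) E.
rewrite (chart_integral body mu_area ch (ball_open x e))//.
pose h a := zero_extension (fun y => c * flux Omega Z s phi a y) x e.
have Ch a : CkR 1 U (fun y => c * flux Omega Z s phi a y).
  by apply: (CkR_mul oU); [exact: (CkR_cst oU)|exact: (flux_CkR body s dZ ch a)].
have h0 a y : U y -> ~ ball x e y -> c * flux Omega Z s phi a y = 0.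
  move=> Uy nBy; have [Zy _] := Z0 _ (chart_boundary ch Uy) (off _ Uy nBy).
  by rewrite /flux Zy det_setrow mul0mx mxE mulr0.
have hi a := integral_derive_extension oU e0 BU (Ch a) (h0 a).
transitivity (\int[lebesgue_rV n]_y (\sum_a ('D_(delta_mx 0 a) (h a) y)%:E))%E; last first.
  rewrite integral_sum//; last by move=> a; have [] := hi a a.
  by rewrite big1// => a _; have [_] := hi a a.
apply: eq_integral => y _; rewrite sumEFin; congr EFin.
have [Uy|nUy] := pselect (U y); last first.
  rewrite indicE memNset ?mul0r ?big1//; last by move=> /BU'.
  by move=> a _; exact: (derive_zero_extension_out _ e0 BU _ nUy).
transitivity (c * \sum_a 'D_(delta_mx 0 a) (flux Omega Z s phi a) y); last first.
  rewrite mulr_sumr; apply: eq_bigr => a _.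
  rewrite (derive_zero_extension oU (h0 a) _ Uy).
  have df : derivable (flux Omega Z s phi a) y (delta_mx 0 a).
    by apply: diff_derivable; have [+ _] := flux_CkR body s dZ ch a; exact.
  exact/esym/(deriveZ c df).
rewrite (flux_divergence body dZ s0 ch)// -/(F (phi y)) mulrA.
rewrite indicE; have [By|nBy] := pselect (ball x e y).
  rewrite mem_set// mul1r mulrC gc//; by apply: le_ball By; rewrite lerDl ltW.
by rewrite memNset// mul0r F0 ?mulr0//; [exact: (chart_boundary ch)|exact: off].
Qed.

End LocalDivergence.

Lemma Rintegral_sum (I : Type) (t : seq I) (f : I -> 'rV[R]_n.+1 -> R) :
  (forall i, mu.-integrable Sigma (EFin \o f i)) ->
  \int[mu]_(p in Sigma) (\sum_(i <- t) f i p) = \sum_(i <- t) \int[mu]_(p in Sigma) f i p.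
Proof.
move=> fi; elim: t => [|i t IH].
  by under eq_Rintegral do rewrite big_nil; rewrite big_nil Rintegral_cst// mul0r.
rewrite big_cons -IH -RintegralD//; first by apply: eq_Rintegral => p _; rewrite big_cons.
under [X in integrable _ _ X]eq_fun => p do rewrite /= -sumEFin.
exact: (integrable_sum mS t (fun i _ => fi i)).
Qed.

(** Squaring the positive part makes it continuously differentiable, which is the regularity that
    [has_gradient] asks of a cut-off function. *)
Lemma is_derive_sqr_max0 (t : R) : is_derive t 1 (fun z => Num.max z 0 ^+ 2) (2 * Num.max t 0).
Proof.
pose L : R -> R := fun z => (2 * Num.max t 0) *: (z : R^o).
have Ll : linear L by move=> a x y; rewrite /L scalerDr !scalerA [_ * a]mulrC.
pose L' := HB.pack_for {linear R -> R} L (GRing.isLinear.Build _ _ _ _ _ Ll).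
have [d dE] : differentiable (fun z : R => Num.max z 0 ^+ 2) t /\
    'd (fun z : R => Num.max z 0 ^+ 2) t = L' :> (R -> R).
  apply: differentiable_eps => [x|e e0].
    by apply: (@continuousM _ _ (cst (2 * Num.max t 0)) id); [exact: cst_continuous|exact: cvg_id].
  near=> y.
  have ye : `|y - t| <= e.
    have : ball t e y by near: y; exact: nbhsx_ballx.
    by rewrite -ball_normE /ball_ /= distrC => /ltW.
  apply: le_trans (ler_wpM2r (normr_ge0 _) ye).
  rewrite -[`|y - t| * _]expr2 real_normK ?num_real// /L' /= /L /GRing.scale /= ler_norml.
  have y2 := sqr_ge0 y; have t2 := sqr_ge0 t; have yt := sqr_ge0 (y - t).
  have [y0|/ltW y0] := leP y 0; have [t0|/ltW t0] := leP t 0.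
  - by apply/andP; split; lra.
  - by have := mulr_le0_ge0 y0 t0 => ?; apply/andP; split; lra.
  - by have := mulr_ge0_le0 y0 t0 => ?; apply/andP; split; lra.
  - by apply/andP; split; lra.
apply: DeriveDef; first exact/derivable1_diffP.
by rewrite deriveE// dE /= /L /GRing.scale /= mulr1.
Unshelve. all: by end_near. Qed.

(** The squared positive part of [rho ^ 2 - |q - c| ^ 2]. Its gradient vanishes together with it
    outside the ball, so multiplying a field by it localises the differential too. *)
Lemma has_gradient_bump c rho : 0 < rho -> exists b g, [/\ has_gradient Omega b g,
  (forall q, 0 <= b q), (forall q, enorm (q - c) < rho -> 0 < b q) &
  (forall q, ~ enorm (q - c) < rho -> b q = 0 /\ g q = 0)].
Proof.
move=> rho0.
have Hj j := has_gradient_add (has_gradient_coord Omega j) (has_gradient_cst Omega (- c 0 j)).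
have Hs := has_gradient_sum (index_enum 'I_n.+1) (fun j => has_gradient_mul (Hj j) (Hj j)).
have := has_gradient_add (has_gradient_cst Omega (rho ^+ 2))
  (has_gradient_mul (has_gradient_cst Omega (-1)) Hs).
set q := (fun p => rho ^+ 2 + _); set gq := (fun p => 0 + _) => Hq.
have qE p : q p = rho ^+ 2 - enorm (p - c) ^+ 2.
  rewrite sqr_enorm dotE /q mulN1r; congr (_ - _); apply: eq_bigr => j _.
  by rewrite !mxE.
have q0 p : (0 < q p) = (enorm (p - c) < rho).
  by rewrite qE subr_gt0 ltr_pXn2r// nnegrE ?enorm_ge0// ltW.
exists (fun p => Num.max (q p) 0 ^+ 2), (fun p => (2 * Num.max (q p) 0) *: gq p); split.
- have := has_gradient_comp (h := fun z => Num.max z 0 ^+ 2) (dh := fun z => 2 * Num.max z 0) Hq.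
  apply=> p _; split; first exact: is_derive_sqr_max0.
  move: (q p) => z; apply: (@continuousM R R (cst 2) (fun z : R => Num.max z 0) z).
    exact: cst_continuous.
  by apply: continuous_max; [exact: cvg_id|exact: cst_continuous].
- by move=> p; exact: sqr_ge0.
- by move=> p; rewrite -q0 => qp; rewrite exprn_gt0// lt_max qp.
- move=> p /negP; rewrite -q0 -leNgt => /max_idPr ->.
  by rewrite expr0n/= mulr0 scale0r.
Qed.

Lemma has_differential_scale f g Z DZ : has_gradient Omega f g -> has_differential Omega Z DZ ->
  has_differential Omega (fun p => f p *: Z p) (fun p => f p *: DZ p + (g p)^T *m Z p).
Proof.
move=> Hf HZ j; have := has_gradient_mul Hf (HZ j).
congr (has_gradient _ _ _); first by apply/funext => p; rewrite mxE.
by apply/funext => p; apply/rowP => i; rewrite !mxE big_ord1 !mxE [Z p 0 j * _]mulrC.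
Qed.

(** The flux argument controls the generating polynomial in [s] as a whole; a partition of unity
    reduces it to chart balls, and its coefficients then vanish one by one. *)
Lemma surface_divergence Z DZ j : has_differential Omega Z DZ -> (j <= n)%N ->
  \int[mu]_(p in Sigma) newton_divergence Omega j Z DZ p = 0.
Proof.
move=> HZ; move: j; pose I j := \int[mu]_(p in Sigma) newton_divergence Omega j Z DZ p.
apply: (@polynomial_pos_eq0 _ I n.+1) => s s0.
have CnZ Z' DZ' : has_differential Omega Z' DZ' ->
    surface_Ck Omega 0 (fun p => \sum_(j < n.+1) s ^+ j * newton_divergence Omega j Z' DZ' p).
  move=> H; apply: surface_Ck_sum => j _; apply: surface_Ck_mul; first exact: surface_Ck_cst.
  exact: surface_C0_newton_divergence.
have /choice[rho rhoP] c : exists rho, 0 < rho /\ (Sigma c -> forall Z' DZ',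
    has_differential Omega Z' DZ' ->
    (forall q, ~ enorm (q - c) < rho -> Z' q = 0 /\ DZ' q = 0) ->
    (\int[mu]_(p in Sigma) (\sum_(j < n.+1) s ^+ j * newton_divergence Omega j Z' DZ' p)%:E = 0)%E).
  have [Sc|] := pselect (Sigma c); last by exists 1; split.
  have [U [phi [x [e [rho [k [C [[ch Ux xp] [e0 rho0 BU cov gC]]]]]]]]] := local_piece Sc.
  exists rho; split => // _ Z' DZ' H' Z0; apply: (local_divergence (c := k) H' ch e0 (ltW s0) BU).
    by move=> y /gC[].
  by move=> q Sq nq; apply: Z0 => qc; apply: nq; exact: cov.
have /choice[b bP] c := has_gradient_bump c (rhoP c).1.
have {bP} /choice[g bP] := bP.
have [t [tS cov]] := boundary_cover (fun c _ => (rhoP c).1).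
pose B q := \sum_(c <- t) b c q; pose gB q := \sum_(c <- t) g c q.
have HB : has_gradient Omega B gB by apply: has_gradient_sum => c; have [] := bP c.
have B0 q : Sigma q -> 0 < B q.
  move=> Sq; have [c ct qc] := cov q Sq; rewrite /B (big_rem c)//=.
  have [_ b0 bp _] := bP c; rewrite ltr_pwDl//; first exact: bp qc.
  by apply: sumr_ge0 => c' _; have [_ + _ _] := bP c'; exact.
have HBV := has_gradient_comp (h := fun z => z^-1) (dh := fun z => - (z ^- 2)) HB.
have {}HBV : has_gradient Omega (fun q => (B q)^-1) (fun q => - (B q) ^- 2 *: gB q).
  apply: HBV => q Sq; split.
    by apply: is_derive_eq; [exact: (is_deriveV (lt0r_neq0 (B0 q Sq)))|rewrite /GRing.scale /= mulr1].
  have Bq := lt0r_neq0 (B0 q Sq).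
  apply: (@continuousN _ _ _ (fun z : R => z ^- 2)).
  apply: (@continuousV _ _ (fun z : R => z ^+ 2)); first by rewrite expf_neq0.
  exact: exprn_continuous.
(* Dividing by the sum [B] of the bumps, positive on [Sigma] by the cover, turns them into a
   partition of unity. *)
have HZ' := has_differential_scale HBV HZ.
set Z' := (fun p => _) in HZ'; set DZ' := (fun p => _ + _) in HZ'.
pose Zc c p := b c p *: Z' p; pose DZc c p := b c p *: DZ' p + (g c p)^T *m Z' p.
have HZc c : has_differential Omega (Zc c) (DZc c).
  by apply: has_differential_scale => //; have [] := bP c.
(* In the sum of the differentials, the derivatives of [B] and of its inverse cancel. *)
have sumE p : Sigma p -> \sum_(c <- t) Zc c p = Z p /\ \sum_(c <- t) DZc c p = DZ p.
  move=> Sp; have Bp := lt0r_neq0 (B0 p Sp); split.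
    by rewrite -scaler_suml -/(B p) scalerA divff ?scale1r.
  rewrite big_split /= -scaler_suml -mulmx_suml -raddf_sum -/(B p) -/(gB p).
  rewrite /DZ' /Z' scalerDr scalerA divff// scale1r -addrA -[RHS]addr0; congr (_ + _).
  rewrite linearZ /= -scalemxAl -scalemxAr scalerA -scalerDl -[RHS](scale0r ((gB p)^T *m Z p)).
  by congr (_ *: _); field.
transitivity (\int[mu]_(p in Sigma) \sum_(j < n.+1) s ^+ j * newton_divergence Omega j Z DZ p).
  have Ci (j : 'I_n.+1) : mu.-integrable Sigma (EFin \o (fun p => s ^+ j * newton_divergence Omega j Z DZ p)).
    apply: surface_C0_integrable; apply: surface_Ck_mul; first exact: surface_Ck_cst.
    exact: surface_C0_newton_divergence.
  rewrite Rintegral_sum//; apply: eq_bigr => j _; rewrite RintegralZl//.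
  by apply: surface_C0_integrable; exact: surface_C0_newton_divergence.
transitivity (\sum_(c <- t) \int[mu]_(p in Sigma)
    \sum_(j < n.+1) s ^+ j * newton_divergence Omega j (Zc c) (DZc c) p).
  rewrite -Rintegral_sum//; last by move=> c; apply: surface_C0_integrable; exact: CnZ.
  apply: eq_Rintegral => p; rewrite inE => Sp; have [ZE DZE] := sumE p Sp.
  rewrite exchange_big /=; apply: eq_bigr => j _; rewrite -mulr_sumr; congr (_ * _).
  rewrite /newton_divergence -ZE -DZE !sumrB -mulr_suml -mulr_sumr; congr (_ - _ * _ - _ * _).
  - by rewrite mulmx_suml raddf_sum.
  - by rewrite /dot mulmx_sumr mulmx_suml summxE.
  - by rewrite /dot mulmx_suml summxE.
rewrite big_seq big1// => c ct; rewrite /Rintegral.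
rewrite ((rhoP c).2 (tS c ct) _ _ (HZc c))// => q nq.
have [_ _ _ /(_ q nq)[bq gq]] := bP c.
by rewrite /Zc /DZc bq gq !scale0r trmx0 mul0mx addr0.
Qed.

End SurfaceDivergence.

Lemma mxtrace_rank_one {R : realType} d (g v : 'rV[R]_d) : \tr (g^T *m v) = dot v g.
Proof. by rewrite mxtrace_mulC /mxtrace big_ord1. Qed.

Lemma dot_rank_one {R : realType} d (w g v w' : 'rV[R]_d) :
  dot (w *m (g^T *m v)) w' = dot w g * dot v w'.
Proof. by rewrite {1}/dot mulmxA -mulmxA mxE big_ord1. Qed.

Lemma mulmx_trE {R : realType} d e f (M : 'M[R]_(d, e)) (N : 'M[R]_(f, e)) a b :
  (M *m N^T) a b = (row a M *m (row b N)^T) 0 0.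
Proof. by rewrite !mxE; apply: eq_bigr => i _; rewrite !mxE. Qed.

(** * Volume and support function *)

Section Moments.
Context {R : realType} {n : nat} (Omega : set 'rV[R]_n.+1).
Variable mu : {measure set (@borel R n.+1) -> \bar R}.
Hypothesis body : convex_body Omega.
Let oO := body_open body.
Let cO := body_convex body.
Let O0 := body_neq0 body.
Let sS := body_smooth body.
Implicit Types (p : 'rV[R]_n.+1).
Let nu := normal Omega.
Let A := Defs.shape Omega.
Notation Sigma := (boundary Omega).
Hypothesis mu_area : is_area_measure Sigma mu.

(** Differentiating the orthogonality of [nu] and the tangent vectors expresses the second
    fundamental form by second derivatives of the chart, which are symmetric; on the normal line
    both sides vanish. *)
Lemma shape_sym p : Sigma p -> (A p)^T = A p.
Proof.
move=> /sS[U [phi [ch [x Ux <-]]]]; have [oU _ _ _ _] := ch.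
set P := 'J phi x; set B := A (phi x); set N := nu (phi x).
pose S a b := \sum_j N 0 j * 'D_(delta_mx 0 a) ('D_(delta_mx 0 b) (fun y => phi y 0 j)) x.
have SC a b : S a b = S b a.
  rewrite /S; apply: eq_bigr => j _.
  by have -> := derive_swap b a oU (chart_CkR ch 2 j) Ux.
have E a b : (P *m B *m P^T) a b = - S a b.
  pose q y := \sum_j nu (phi y) 0 j * 'D_(delta_mx 0 b) (fun z => phi z 0 j) y.
  have dq : is_derive x (delta_mx 0 a) q (\sum_j
      (N 0 j * 'D_(delta_mx 0 a) ('D_(delta_mx 0 b) (fun z => phi z 0 j)) x +
       'D_(delta_mx 0 b) (fun z => phi z 0 j) x * 'D_(delta_mx 0 a) (fun y => nu (phi y) 0 j) x)).
    apply: is_derive_bigsum => j; apply: is_deriveM; apply/derivableP/diff_derivable.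
      exact/differentiable_entry/(chart_normal_differentiable body ch).
    by have [_ /(_ b) [+ _]] := chart_CkR ch 2 j; exact.
  have q0 : \forall y \near x, cst (0 : R) y = q y.
    apply: filterS (open_nbhs_nbhs (conj oU Ux)) => y Uy; rewrite /q.
    have := congr1 (fun M : 'cV[R]_n => M b 0) (chart_normal_orth body ch Uy).
    rewrite mxE [RHS]mxE => E0; rewrite -[LHS]E0; apply: eq_bigr => j _.
    by rewrite (derive_chart ch Uy) [(nu (phi y))^T _ _]mxE mulrC.
  have := near_eq_derive (delta_mx 0 a) q0; rewrite (@derive_val _ _ _ _ _ _ _ dq).
  rewrite [LHS]derive_cst big_split /= -/(S a b) => /esym/eqP; rewrite addrC addr_eq0 => /eqP <-.
  rewrite mxE; apply: eq_bigr => j _.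
  by rewrite (derive_chart ch Ux) (derive_chart_normal body ch Ux) [P^T _ _]mxE mulrC.
have uF := chart_frame_unit body ch Ux; set F := frame N P in uF.
have BN : B *m N^T = 0 by exact: (shape_normal body ch).
have NB : N *m B = 0 by exact: (normal_shape body (chart_boundary ch Ux)).
have FBF i j : (F *m B *m F^T) i j = (F *m B *m F^T) j i.
  have rE a b : (F *m B *m F^T) a b = (row a F *m B *m (row b F)^T) 0 0.
    by rewrite mulmx_trE row_mul.
  rewrite !rE; have [a ->|->] := unliftP ord0 i; have [b ->|->] := unliftP ord0 j.
  - rewrite !row_frameS.
    have rP c d : (row c P *m B *m (row d P)^T) 0 0 = (P *m B *m P^T) c d.
      by rewrite [RHS]mulmx_trE [in RHS]row_mul.
    by rewrite !rP !E SC.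
  - by rewrite row_frameS row_frame0 NB mul0mx -mulmxA BN mulmx0.
  - by rewrite row_frameS row_frame0 NB mul0mx -mulmxA BN mulmx0.
  - by [].
have : (F *m B *m F^T)^T = F *m B *m F^T by apply/matrixP => i j; rewrite mxE FBF.
rewrite !trmx_mul trmxK mulmxA => H.
have uFT : F^T \in unitmx by rewrite unitmx_tr.
by apply: (can_inj (mulKmx uF)); apply: (can_inj (mulmxK uFT)).
Qed.

Lemma has_differential_cst (v : 'rV[R]_n.+1) : has_differential Omega (fun=> v) (fun=> 0).
Proof.
move=> j; have := has_gradient_cst Omega (v 0 j).
by congr (has_gradient _ _ _); apply/funext => p; rewrite col0 trmx0.
Qed.

Lemma has_differential_add Z1 Z2 D1 D2 : has_differential Omega Z1 D1 ->
  has_differential Omega Z2 D2 ->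
  has_differential Omega (fun p => Z1 p + Z2 p) (fun p => D1 p + D2 p).
Proof.
move=> H1 H2 j; have := has_gradient_add (H1 j) (H2 j).
by congr (has_gradient _ _ _); apply/funext => p; [rewrite mxE|rewrite !linearD].
Qed.

(** The tangent field [x_i x_j (nu_i e_j - nu_j e_i)] has surface divergence [x_i nu_i - x_j nu_j]:
    the terms in [A] cancel by symmetry. The volume then has to be computed along one coordinate
    only. *)
Lemma moment_eq i j : \int[mu]_(p in Sigma) (p 0 i * nu p 0 i) =
  \int[mu]_(p in Sigma) (p 0 j * nu p 0 j).
Proof.
have [->//|ij] := eqVneq i j.
have X l := has_gradient_coord Omega l.
have N l := has_gradient_normal body l.
have F l := has_gradient_mul (has_gradient_mul (X i) (X j)) (N l).
have H := has_differential_add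
  (has_differential_scale (F i) (has_differential_cst (delta_mx 0 j)))
  (has_differential_scale (has_gradient_mul (has_gradient_cst Omega (-1)) (F j))
    (has_differential_cst (delta_mx 0 i))).
have mS := measurable_boundary Omega.
have I l : mu.-integrable Sigma (EFin \o (fun p => p 0 l * nu p 0 l)).
  apply: surface_C0_integrable => //; apply: surface_Ck_mul.
    exact: surface_Ck_coord.
  exact: surface_Ck_normal.
apply/eqP; rewrite -subr_eq0 -RintegralB//.
rewrite -(surface_divergence body mu_area H (leq0n n)); apply/eqP.
apply: eq_Rintegral => p; rewrite inE => Sp.
have NA l : dot (normal Omega p) (col l (A p))^T = 0.
  have := congr1 (fun M : 'rV[R]_n.+1 => M 0 l) (normal_shape body Sp).
  by rewrite mxE [RHS]mxE dotE => E; rewrite -[RHS]E; apply: eq_bigr => k _; rewrite !mxE.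
have DA k l : dot (delta_mx 0 k) (col l (A p))^T = A p k l by rewrite dotC dot_delta !mxE.
have SA : A p i j = A p j i by rewrite -[in LHS](shape_sym Sp) mxE.
have D1 k l : dot (delta_mx 0 k : 'rV[R]_n.+1) (delta_mx 0 l) = (k == l)%:R.
  by rewrite dot_delta mxE eqxx eq_sym.
rewrite /newton_divergence /= mulmx1 sigma0 mul1r !scaler0 !add0r !mulmxDr !mxtraceD !dotDl.
have DN k : dot (delta_mx 0 k) (normal Omega p) = nu p 0 k by rewrite dotC dot_delta.
rewrite !(mxtrace_rank_one, dot_rank_one) !(dotZl, dotDr, dotZr, NA, DA, D1, DN, dot_delta, dot0r).
by rewrite !eqxx eq_sym (negbTE ij) /= SA -/nu; ring.
Qed.

End Moments.

(** * Slicing along the first coordinate *)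

Section Points.
Context {R : realType} {n : nat}.
Implicit Types (s : R) (y : 'rV[R]_n) (p : 'rV[R]_n.+1).

Definition point s y : 'rV[R]_n.+1 := row_mx (s%:M : 'rV[R]_1) y.
Definition shadow p : 'rV[R]_n := \row_a p 0 (lift ord0 a).

Lemma point0 s y : point s y 0 0 = s.
Proof.
rewrite /point (_ : 0 = lshift n 0 :> 'I_(1 + n)); last exact: val_inj.
transitivity ((s%:M : 'rV[R]_1) 0 0); first exact: (row_mxEl (s%:M : 'rV[R]_1) y).
by rewrite mxE eqxx.
Qed.

Lemma pointS s y a : point s y 0 (lift ord0 a) = y 0 a.
Proof.
rewrite /point (_ : lift ord0 a = rshift 1 a :> 'I_(1 + n)); last exact: val_inj.
exact: (row_mxEr (s%:M : 'rV[R]_1) y).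
Qed.

Lemma shadow_point s y : shadow (point s y) = y.
Proof. by apply/rowP => a; rewrite mxE pointS. Qed.

Lemma point_shadow p : point (p 0 0) (shadow p) = p.
Proof.
by apply/rowP => j; have [a ->|->] := unliftP ord0 j; rewrite ?pointS ?point0 ?mxE.
Qed.

Lemma point_comb a s1 s2 y :
  point (a * s1 + (1 - a) * s2) y = a *: point s1 y + (1 - a) *: point s2 y.
Proof.
apply/rowP => j; rewrite [RHS]mxE [X in _ = X + _]mxE [X in _ = _ + X]mxE.
by have [b ->|->] := unliftP ord0 j; rewrite ?pointS ?point0//; ring.
Qed.

Lemma continuous_point (T : topologicalType) (f : T -> R) (g : T -> 'rV[R]_n) x :
  {for x, continuous f} -> {for x, continuous g} -> {for x, continuous (fun t => point (f t) (g t))}.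
Proof.
move=> cf cg; apply: continuous_rV => j; have [a ->|->] := unliftP ord0 j.
  rewrite (_ : (fun t => _) = fun t => g t 0 a); last by apply/funext => t; rewrite pointS.
  apply: (@continuous_comp _ _ _ g (fun M : 'rV[R]_n => M 0 a)); first exact: cg.
  exact: coord_continuous.
by rewrite (_ : (fun t => _) = f); last by apply/funext => t; rewrite point0.
Qed.

Lemma continuous_shadow : continuous shadow.
Proof.
move=> p; apply: continuous_rV => a.
rewrite (_ : (fun q => _) = fun q : 'rV[R]_n.+1 => q 0 (lift ord0 a)); last first.
  by apply/funext => q; rewrite mxE.
exact: coord_continuous.
Qed.

End Points.

Lemma CkR_pointwise {R : realType} d k (U : set 'rV[R]_d) (f : 'rV[R]_d -> R) :
  (forall x, U x -> exists N, N x /\ CkR k N f) -> CkR k U f.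
Proof.
elim: k f => [|k IH] f H; first by move=> x /H[N [Nx CN]]; exact: CN.
split=> [x /H[N [Nx [dN _]]]|i]; first exact: dN.
by apply: IH => x /H[N [Nx [_ DN]]]; exists N; split=> //; exact: DN.
Qed.

(* The part of the hypersurface seen from above ([e = 1]) or from below
   ([e = -1]) along the first coordinate. *)
Section Graph.
Context {R : realType} {n : nat} (Omega : set 'rV[R]_n.+1).
Hypothesis body : convex_body Omega.
Let oO := body_open body.
Let cO := body_convex body.
Let O0 := body_neq0 body.
Let sS := body_smooth body.
Notation Sigma := (boundary Omega).
Let nu := normal Omega.
Variable e : R.
Hypothesis ee : e * e = 1.

(** Heights are measured in direction [e]: for [e = -1] the height is minus the lowest first
    coordinate, so the length of a vertical fibre is the sum of the two heights. *)
Definition fiber y := [set s | Omega (point (e * s) y)].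
Definition height y := sup (fiber y).
Definition graph y := point (e * height y) y.
Definition base := [set y | exists s, Omega (point s y)].

Lemma fiber_neq0 y : base y -> fiber y !=set0.
Proof. by move=> [s Os]; exists (e * s); rewrite /fiber /= mulrA ee mul1r. Qed.

Lemma fiber_norm : exists M, forall y s, fiber y s -> `|s| <= M /\ `|y| <= M.
Proof.
have [M [Mr MO]] := body_bounded body; exists (`|M| + 1) => y s Os.
have : `|point (e * s) y| <= `|M| + 1.
  by apply: MO Os; apply: (le_lt_trans (ler_norm _)); rewrite ltrDl.
have M0 : 0 <= `|M| + 1 by rewrite addr_ge0.
move=> /(mx_norm_le _ M0) H; split.
  have := H 0 0; rewrite point0 normrM; suff -> : `|e| = 1 by rewrite mul1r.
  by apply/eqP; rewrite -sqrp_eq1// real_normK ?num_real// expr2 ee.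
by apply/(mx_norm_le _ M0) => i a; rewrite ord1 -(pointS (e * s)).
Qed.

Lemma fiber_bounded y : exists M, ubound (fiber y) M.
Proof.
by have [M MP] := fiber_norm; exists M => s /MP[+ _]; apply: le_trans; exact: ler_norm.
Qed.

Lemma fiber_sup y : base y -> has_sup (fiber y).
Proof. by move=> By; split; [exact: fiber_neq0|exact: fiber_bounded]. Qed.

Lemma fiber_open y s : fiber y s ->
  exists2 d, 0 < d & forall z t, ball y d z -> ball s d t -> fiber z t.
Proof.
move=> ys.
have c : {for (y, s), continuous (fun w : 'rV[R]_n * R => point (e * w.2) w.1)}.
  apply: continuous_point; last exact: cvg_fst.
  by apply: continuousM; [exact: cst_continuous|exact: cvg_snd].
have : nbhs (point (e * s) y) Omega by exact: open_nbhs_nbhs.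
by move=> /c /nbhs_ballP[d /= d0 dO]; exists d => // z t yz st; apply: (dO (z, t)).
Qed.

Lemma fiber_lt y s : fiber y s -> s < height y.
Proof.
move=> ys; have [d d0 dF] := fiber_open ys.
have yt : fiber y (s + d / 2).
  apply: dF; first exact: ballxx.
  by rewrite -ball_normE /ball_ /= opprD addNKr normrN gtr0_norm ?divr_gt0// gtr_pMr// invf_lt1// ltr1n.
apply: (@lt_le_trans _ _ (s + d / 2)); first by rewrite ltrDl divr_gt0.
by apply: ub_le_sup => //; exact: fiber_bounded.
Qed.

Lemma fiber_convex y s1 s2 s : fiber y s1 -> fiber y s2 -> s1 <= s -> s <= s2 -> fiber y s.
Proof.
move=> y1 y2 s1s ss2; have [E|ne] := eqVneq s1 s2.
  by have -> : s = s1 by apply/eqP; rewrite eq_le s1s E ss2.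
have d0 : 0 < s2 - s1 by rewrite subr_gt0 lt_neqAle ne (le_trans s1s).
rewrite /fiber /= (_ : e * s = ((s2 - s) / (s2 - s1)) * (e * s1) +
    (1 - (s2 - s) / (s2 - s1)) * (e * s2)); last by field; rewrite gt_eqF.
rewrite point_comb; apply: convexE => //.
  by rewrite divr_ge0 ?subr_ge0// ltW// -subr_gt0.
by rewrite ler_pdivrMr// mul1r lerB.
Qed.

Lemma fiber_between y s0 s : fiber y s0 -> s0 <= s -> s < height y -> fiber y s.
Proof.
move=> y0 s0s sh; have [s1 y1 ss1] := sup_gt (ex_intro _ s0 y0) sh.
exact: fiber_convex y0 y1 s0s (ltW ss1).
Qed.

Lemma graph_boundary y : base y -> Sigma (graph y).
Proof.
move=> By; apply/(boundaryP oO); split; last by move=> /fiber_lt; rewrite ltxx.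
have c : {for height y, continuous (fun s : R => point (e * s) y)}.
  apply: continuous_point; last exact: cst_continuous.
  by apply: (@continuousM _ _ (cst e) id); [exact: cst_continuous|exact: cvg_id].
move=> N /c /nbhs_ballP[d /= d0 dN].
have [s ys sh] := sup_adherent d0 (fiber_sup By).
exists (point (e * s) y); split => //; apply: dN.
rewrite -ball_normE /ball_ /= gtr0_norm ?subr_gt0 ?fiber_lt//.
by rewrite ltrBlDr -ltrBlDl.
Qed.

Lemma closure_above y s0 s : fiber y s0 -> s0 < s -> closure Omega (point (e * s) y) ->
  s <= height y.
Proof.
move=> y0 s0s cs; rewrite leNgt; apply/negP => hs.
(* The point of the segment at this parameter lies midway between [height y] and [s]. *)
have h0 := fiber_lt y0; pose t := (s - height y) / (s - s0) / 2.
have d0 : 0 < s - s0 by rewrite subr_gt0.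
have t0 : 0 < t by rewrite !divr_gt0// subr_gt0.
have t1 : t <= 1.
  by rewrite /t -mulrA -invfM ler_pdivrMr ?mulr_gt0//; lra.
have := half_open oO cO cs y0 t0 t1.
rewrite -[X in X *: point (e * s0) y](subKr 1) -[t](subKr 1) -point_comb -/(1 - t).
rewrite (_ : _ + _ = e * (s - t * (s - s0))); last by ring.
move=> /fiber_lt; apply/negP; rewrite -leNgt.
rewrite /t (_ : _ * _ = (s - height y) / 2); last by field; rewrite gt_eqF.
by lra.
Qed.

Lemma boundary_graph y s0 s : fiber y s0 -> s0 < s -> Sigma (point (e * s) y) -> s = height y.
Proof.
move=> y0 s0s /(boundaryP oO)[cs nO]; apply/eqP; rewrite eq_le (closure_above y0)//=.
by rewrite leNgt; apply/negP => /(fiber_between y0 (ltW s0s)).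
Qed.

Lemma base_fiber y s : fiber y s -> base y.
Proof. by exists (e * s). Qed.

Lemma base_open : open base.
Proof.
rewrite openE => y By; have [s ys] := fiber_neq0 By; have [d d0 dF] := fiber_open ys.
apply/nbhs_ballP; exists d => //= z yz; apply: (@base_fiber _ s); apply: dF => //.
exact: ballxx.
Qed.

(** The lower bound comes from the openness of Omega, by a fibre point just below the height; the
    upper bound from a point just above, which stays outside the closure for nearby [z]. *)
Lemma height_continuous y : base y -> {for y, continuous height}.
Proof.
move=> By; have [s0 ys0] := fiber_neq0 By; have [d0 d00 dF0] := fiber_open ys0.
suff N eps : 0 < eps -> \forall z \near y, `|height y - height z| < eps.
  by apply/(@cvgrPdist_lt _ _ _ (nbhs y) (nbhs_filter y)) => eps /N.
move=> eps0; have [s ys hs] := sup_adherent eps0 (fiber_sup By).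
have [d d1 dF] := fiber_open ys.
pose t := height y + eps / 2.
have ht : height y < t by rewrite ltrDl divr_gt0.
have nc : ~ closure Omega (point (e * t) y).
  by move=> /(closure_above ys0 (lt_trans (fiber_lt ys0) ht)); rewrite leNgt ht.
have cp : {for y, continuous (fun z => point (e * t) z)}.
  by apply: continuous_point; [exact: cst_continuous|exact: cvg_id].
have nz : \forall z \near y, ~ closure Omega (point (e * t) z).
  have oC : open (~` closure Omega) by exact: closed_openC (@closed_closure _ Omega).
  exact: cp _ (open_nbhs_nbhs (conj oC nc)).
near=> z.
have zs0 : fiber z s0 by apply: dF0; [near: z; exact: nbhsx_ballx|exact: ballxx].
have l1 : height y - eps < height z.
  apply: (lt_trans hs); apply: fiber_lt; apply: dF; last exact: ballxx.
  near: z; exact: nbhsx_ballx.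
have l2 : height z < height y + eps.
  have : height z <= t.
    rewrite leNgt; apply/negP => tz; apply: (near nz z) => //; apply: subset_closure.
    by apply: (fiber_between zs0 (ltW (lt_trans (fiber_lt ys0) ht))).
  by move=> /le_lt_trans; apply; rewrite /t ltrD2l gtr_pMr// invf_lt1// ltr1n.
by rewrite ltr_norml; apply/andP; split; lra.
Unshelve. all: by end_near. Qed.

Lemma graph_continuous y : base y -> {for y, continuous graph}.
Proof.
move=> By; apply: continuous_point; last exact: cvg_id.
by apply: continuousM; [exact: cst_continuous|exact: height_continuous].
Qed.

Lemma graph_normal y : base y -> 0 < e * nu (graph y) 0 0.
Proof.
move=> By; have [s ys] := fiber_neq0 By.
have [_ + _] := normal_spec oO cO sS O0 (graph_boundary By) => /(_ _ ys).
have -> : point (e * s) y - graph y = (e * (s - height y)) *: delta_mx 0 0.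
  apply/rowP => j; rewrite [LHS]mxE [RHS]mxE [(- graph y) 0 j]mxE [X in _ = _ * X]mxE eqxx /=.
  have [a ->|->] := unliftP ord0 j; first by rewrite /graph !pointS /= mulr0 subrr.
  by rewrite /graph !point0 /= mulr1; ring.
by rewrite dotZr dot_delta mulrAC nmulr_llt0 // subr_lt0 fiber_lt.
Qed.

Lemma shadow_graph y : shadow (graph y) = y.
Proof. exact: shadow_point. Qed.

Lemma det_frame_vertical (P : 'M[R]_(n, n.+1)) :
  \det (frame (delta_mx 0 0) P) = \det (\matrix_(a, b) P a (lift ord0 b)).
Proof.
rewrite (expand_det_row _ 0) (bigD1 0)//= big1 ?addr0 => [|j j0].
  rewrite frame0 mxE eqxx mul1r /cofactor expr0 mul1r; congr (\det _).
  by apply/matrixP => a b; rewrite !mxE liftK.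
by rewrite frame0 mxE eqxx (negbTE j0) mul0r.
Qed.

(** An implicit function theorem: [c] is the graph read in a chart, continuous because charts are
    open maps, and inverse to [shadow \o phi]. The Jacobian [F] of the latter is invertible, so
    [left_inverse_differentiable] applies. *)
Lemma graph_smooth k j : CkR k base (fun y => graph y 0 j).
Proof.
apply: CkR_pointwise => y0 By0.
have [U [phi [ch [x0 Ux0 x0E]]]] := sS (graph_boundary By0).
have [oU _ iphi _ op] := ch; have [V oV VE] := op U oU (@subset_refl _ _).
pose c y := xget 0 [set x | U x /\ phi x = graph y].
pose N := base `&` graph @^-1` V.
have cP y : N y -> U (c y) /\ phi (c y) = graph y.
  move=> [By Vy]; have : (phi @` U) (graph y) by rewrite VE; split => //; exact: graph_boundary.
  by move=> [x Ux xE]; apply: (@xgetPex _ 0 [set x | U x /\ phi x = graph y]); exists x.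
have oN : open N.
  rewrite openE => y [By Vy]; apply: filterI; first exact: (open_nbhs_nbhs (conj base_open By)).
  by apply: (graph_continuous By); exact: open_nbhs_nbhs.
have cc y : N y -> {for y, continuous c}.
  move=> Ny W Wcy; have [Uc cE] := cP y Ny.
  have oW : open (W° `&` U) by apply: openI => //; exact: open_interior.
  have [V' oV' VE'] := op _ oW (@subIsetr _ _ _).
  have V'y : V' (graph y).
    have : (V' `&` Sigma) (graph y) by rewrite -VE' -cE; exists (c y).
    by case.
  have near1 : \forall z \near y, N z /\ V' (graph z).
    apply: filterI; first exact: (open_nbhs_nbhs (conj oN Ny)).
    by apply: (graph_continuous Ny.1); exact: open_nbhs_nbhs.
  apply: filterS near1 => z [Nz Vz]; have [Ucz czE] := cP z Nz.
  have : (phi @` (W° `&` U)) (graph z) by rewrite VE'; split => //; exact: graph_boundary Nz.1.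
  move=> [x [Wx Ux] xE]; have cx : x = c z by apply: iphi; rewrite ?inE// xE czE.
  by rewrite /= -cx; exact: interior_subset.
pose F x : 'M[R]_n := \matrix_(a, b) 'J phi x a (lift ord0 b).
(* The determinant of [F] is the first entry of the cross product; its vanishing would make the
   normal horizontal. *)
have uF y : N y -> F (c y) \in unitmx.
  move=> Ny; have [Uc cE] := cP y Ny.
  rewrite unitmxE unitfE -det_frame_vertical -dot_cross dot_delta; apply/eqP => c0.
  have [l lE] : exists l, nu (phi (c y)) = l *: cross ('J phi (c y)).
    apply: parallel_cross; first exact: (chart_rank ch).
    move=> w; rewrite dotC /dot -mulmxA (chart_normal_orth body ch Uc) mulmx0 mxE//.
  by have := graph_normal Ny.1; rewrite -cE lE mxE c0 !mulr0 ltxx.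
have df x : U x -> differentiable (shadow \o phi) x /\ 'J (shadow \o phi) x = F x.
  move=> Ux; have dphi := chart_differentiable ch Ux.
  have d1 : differentiable (shadow \o phi) x.
    apply: differentiable_rV => a.
    rewrite (_ : (fun _ => _) = fun y => phi y 0 (lift ord0 a)); last by apply/funext => y; rewrite /= mxE.
    exact: differentiable_entry.
  split => //; apply/matrixP => a b.
  have -> : 'J (shadow \o phi) x a b = row a ('J (shadow \o phi) x) 0 b by rewrite [RHS]mxE.
  rewrite row_jacobian// derive_entry; last exact: diff_derivable.
  have E : (fun y => (shadow \o phi) y 0 b) = (fun y => phi y 0 (lift ord0 b)).
    by apply/funext => y; rewrite mxE.
  by rewrite E (derive_chart ch Ux) [RHS]mxE.
have dc y : N y -> differentiable c y /\ forall v, 'D_v c y = v *m invmx (F (c y)).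
  move=> Ny; have [Uc cE] := cP y Ny; have [d1 J1] := df _ Uc.
  apply: (left_inverse_differentiable d1 (cc y Ny)); last by rewrite J1 mulmxV// uF.
  apply: filterS (open_nbhs_nbhs (conj oN Ny)) => z Nz.
  by rewrite /= (cP z Nz).2 shadow_graph.
have CF l a b : CkR l U (fun x => F x a b).
  apply: (@CkR_eq _ _ _ oU _ (fun x => 'J phi x a (lift ord0 b))) => [x _|]; first by rewrite [RHS]mxE.
  apply: (jacobian_CkR ch) => [x|i]; first exact: (chart_differentiable ch).
  exact: (chart_CkR ch).
(* Bootstrapping: the derivative of [c] is the inverse of [F] composed with [c], so it is as regular
   as [c] and [c] gains one order. *)
have Cc l : forall i, CkR l N (fun y => c y 0 i).
  elim: l => [|l IH] i.
    move=> y Ny; apply: (@continuous_comp _ _ _ c (fun M : 'rV[R]_n => M 0 i)); first exact: cc.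
    exact: coord_continuous.
  split=> [y Ny|a]; first by apply: differentiable_entry; have [] := dc y Ny.
  have CI := CkR_invmx oN uF (fun a' b' => CkR_comp oN oU (fun y Ny => (cP y Ny).1) IH (CF l a' b')).
  apply: (CkR_eq oN) (CI a i) => y Ny; have [dcy DE] := dc y Ny.
  by rewrite -derive_entry; [rewrite DE -rowE mxE|exact: diff_derivable].
exists N; split.
  split => //; have : (V `&` Sigma) (graph y0) by rewrite -VE; exists x0.
  by case.
have CG := CkR_comp oN oU (fun y Ny => (cP y Ny).1) (Cc k) (chart_CkR ch k j).
by apply: (CkR_eq oN) CG => y Ny; rewrite /= (cP y Ny).2.
Qed.

Lemma graph_differentiable y : base y -> differentiable graph y.
Proof. by move=> By; apply: differentiable_rV => j; have [+ _] := graph_smooth 1 j; exact. Qed.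

Lemma graph_jacobian y a b : base y -> 'J graph y a (lift ord0 b) = (a == b)%:R.
Proof.
move=> By; have dG := graph_differentiable By.
have -> : 'J graph y a (lift ord0 b) = row a ('J graph y) 0 (lift ord0 b) by rewrite [RHS]mxE.
rewrite row_jacobian// derive_entry; last exact: diff_derivable.
rewrite (_ : (fun _ => _) = fun z : 'rV[R]_n => z 0 b); last by apply/funext => z; rewrite pointS.
by rewrite derive_coord mxE eqxx eq_sym.
Qed.

Lemma graph_param : local_param Sigma base graph.
Proof.
split.
- exact: base_open.
- by move=> k; apply/(Ck_coordP _ _ base_open) => j; exact: graph_smooth.
- by move=> y z _ _ /(congr1 shadow); rewrite !shadow_graph.
- move=> y By; apply/eqP; rewrite eqn_leq rank_leq_row /=.
  pose Q : 'M[R]_(n.+1, n) := \matrix_(i, b) (i == lift ord0 b)%:R.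
  have rQ : \rank ('J graph y *m Q) = n.
    rewrite (_ : _ *m Q = 1%:M) ?mxrank1//; apply/matrixP => a b; rewrite [LHS]mxE [RHS]mxE.
    rewrite -(graph_jacobian a b By) (bigD1 (lift ord0 b))//= big1 ?addr0 => [|i ib].
      by rewrite [Q _ _]mxE eqxx mulr1.
    by rewrite [Q _ _]mxE (negbTE ib) mulr0.
  by rewrite -[X in (X <= _)%N]rQ; exact: mxrankM_maxl.
(* The points over [W] that lie beyond some point of Omega in direction [e] form an open set, whose
   trace on [Sigma] is the graph over [W]. *)
move=> W oW WB; exists [set q | W (shadow q) /\ exists2 s, fiber (shadow q) s & s < e * q 0 0].
  rewrite openE => q [Wq [s qs sq]]; have [d d0 dF] := fiber_open qs.
  have cs : {for q, continuous shadow} by exact: continuous_shadow.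
  have c0 : {for q, continuous (fun q : 'rV[R]_n.+1 => e * q 0 0)}.
    apply: (@continuousM _ _ (cst e) (fun q : 'rV[R]_n.+1 => q 0 0)); first exact: cst_continuous.
    exact: coord_continuous.
  apply: filterI; first by apply: cs; exact: open_nbhs_nbhs.
  have n1 : \forall z \near q, ball (shadow q) d (shadow z) by apply: cs; exact: nbhsx_ballx.
  have n2 : \forall z \near q, s < e * (z : 'rV[R]_n.+1) 0 0 by move/cvgr_gt : c0; apply.
  apply: filterS (filterI n1 n2) => z [z1 z2]; exists s => //; apply: dF => //; exact: ballxx.
apply/seteqP; split=> q.
  move=> [y Wy <-]; have By := WB y Wy; split; last exact: graph_boundary.
  split; rewrite shadow_graph//; have [s ys] := fiber_neq0 By; exists s => //.
  by rewrite /graph point0 mulrA ee mul1r fiber_lt.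
move=> [[Wq [s qs sq]] Sq]; exists (shadow q) => //.
have := @boundary_graph (shadow q) s (e * q 0 0) qs sq.
by rewrite mulrA ee mul1r point_shadow => /(_ Sq) E; rewrite /graph -E mulrA ee mul1r point_shadow.
Qed.

(** The projection formula [nu_1 dmu = e dy]. The cross product of the tangent rows has first entry
    [1]; with [nu = l cross], the density is [|l| |cross| ^ 2], while [l ^ 2 |cross| ^ 2 = 1]. *)
Lemma graph_gram y : base y -> nu (graph y) 0 0 * gram graph y = e.
Proof.
move=> By; have ch := graph_param.
set P := 'J graph y; set N := nu (graph y).
have [l lE] : exists l, N = l *: cross P.
  apply: parallel_cross; first exact: (chart_rank ch).
  by move=> w; rewrite dotC /dot -mulmxA (chart_normal_orth body ch By) mulmx0 mxE.
have c0 : cross P 0 0 = 1.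
  rewrite -dot_delta dot_cross det_frame_vertical -[RHS](det1 R n); congr (\det _).
  by apply/matrixP => a b; rewrite mxE [RHS]mxE graph_jacobian.
have N0 : N 0 0 = l by rewrite lE mxE c0 mulr1.
have l0 : 0 < e * l by rewrite -N0; exact: graph_normal.
have : dot N N = 1 by exact/(normal_unit body)/graph_boundary.
rewrite (gramE body ch By) -/P -[normal Omega _]/N -dot_cross lE dotZl !dotZr => lc.
have C0 : 0 <= dot (cross P) (cross P) by exact: dot_ge0.
rewrite normrM (ger0_norm C0) mxE c0 mulr1.
have -> : `|l| = e * l.
  rewrite -(gtr0_norm l0) normrM (_ : `|e| = 1) ?mul1r//.
  by apply/eqP; rewrite -sqrp_eq1// real_normK ?num_real// expr2 ee.
by rewrite -[RHS]mulr1 -[X in _ = _ * X]lc; ring.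
Qed.

Lemma mem_graph p : Sigma p -> 0 < e * nu p 0 0 -> (graph @` base) p.
Proof.
move=> Sp np; have [|t t0 Ot] := inward oO cO sS O0 (v := - e *: delta_mx 0 0) Sp.
  by rewrite dotZr dot_delta mulNr oppr_lt0.
have pE : p + t *: (- e *: delta_mx 0 0) = point (e * (e * p 0 0 - t)) (shadow p).
  apply/rowP => j; rewrite [LHS]mxE [X in _ + X]mxE [X in _ + _ * X]mxE [X in _ + _ * (_ * X)]mxE eqxx /=.
  have [a ->|->] := unliftP ord0 j; first by rewrite pointS mxE /= !mulr0 addr0.
  by rewrite point0 /= mulr1 mulrBr mulrA ee mul1r mulrN mulrC.
rewrite pE in Ot; have ys : fiber (shadow p) (e * p 0 0 - t) by [].
exists (shadow p); first exact: base_fiber ys.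
have lt : e * p 0 0 - t < e * p 0 0 by rewrite ltrBlDr ltrDl.
have := boundary_graph ys lt; rewrite mulrA ee mul1r point_shadow => /(_ Sp) E.
by rewrite /graph -E mulrA ee mul1r point_shadow.
Qed.

Lemma height_integrable : (lebesgue_rV n).-integrable setT (fun y : borel n => (\1_base y * height y)%:E).
Proof.
have [M MP] := fiber_norm.
apply: (@integrable_bounded_support _ _ _ `|M| (`|M| + 1)).
  exact: (measurable_indic_mul base_open height_continuous (borel_open base_open) (@subset_refl _ _)).
move=> y; rewrite !indicE; have [By|nBy] := pselect (base y); last first.
  by rewrite (memNset nBy) mul0r normr0 mulr_ge0.
have [s ys] := fiber_neq0 By; have [sM yM] := MP y s ys.
have MM := ler_norm M; rewrite (mem_set By) mul1r mem_set ?mulr1; last first.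
  by rewrite -ball_normE /ball_ /= sub0r normrN (le_lt_trans yM)// ltr_pwDr.
rewrite ler_norml; apply/andP; split.
  rewrite (le_trans _ (ltW (fiber_lt ys)))//.
  by move: sM; rewrite ler_norml => /andP[+ _]; apply: le_trans; rewrite lerN2.
apply: sup_le_ub; first exact: fiber_neq0.
by move=> t /MP[tM _]; rewrite (le_trans (ler_norm _))// (le_trans tM).
Qed.

End Graph.

Section Volume.
Context {R : realType} {n : nat} (Omega : set 'rV[R]_n.+1).
Variable mu : {measure set (@borel R n.+1) -> \bar R}.
Hypothesis body : convex_body Omega.
Let oO := body_open body.
Notation Sigma := (boundary Omega).
Let nu := normal Omega.
Hypothesis mu_area : is_area_measure Sigma mu.

Let e1 : 1 * 1 = 1 :> R. Proof. by rewrite mulr1. Qed.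
Let eN : -1 * -1 = 1 :> R. Proof. by rewrite mulrNN mulr1. Qed.
Let F (p : 'rV[R]_n.+1) := p 0 0 * nu p 0 0.
Let CF : surface_Ck Omega 0 F.
Proof. by apply: surface_Ck_mul; [exact: surface_Ck_coord|exact: surface_Ck_normal]. Qed.
Let mS := measurable_boundary Omega.

Lemma graph_measurable e : e * e = 1 -> measurable (graph Omega e @` base Omega : set (borel n.+1)).
Proof.
move=> ee; have [_ _ _ _ /(_ _ (base_open body ee) (@subset_refl _ _))[V oV ->]] := graph_param body ee.
by apply: measurableI => //; exact: borel_open.
Qed.

Lemma graph_integral e : e * e = 1 ->
  (\int[mu]_(p in graph Omega e @` base Omega) (F p)%:E =
   \int[lebesgue_rV n]_y (\1_(base Omega) y * height Omega e y)%:E)%E.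
Proof.
move=> ee; have oB := base_open body ee.
rewrite (chart_integral body mu_area (graph_param body ee) oB)//.
apply: eq_integral => y _; congr EFin; rewrite !indicE.
have [By|nBy] := pselect (base Omega y); last by rewrite memNset// !mul0r.
rewrite /F -mulrA (graph_gram body ee By) /graph point0.
by rewrite mulrAC ee mul1r.
Qed.

(** The two graphs carry the parts of [Sigma] where the first entry of the normal is positive or
    negative; where it is [0], so is the integrand. *)
Lemma boundary_moment : \int[mu]_(p in Sigma) F p =
  fine (\int[lebesgue_rV n]_y (\1_(base Omega) y * (height Omega 1 y + height Omega (-1) y))%:E).
Proof.
pose S1 := graph Omega 1 @` base Omega; pose S2 := graph Omega (-1) @` base Omega.
have p1 p : S1 p -> 0 < nu p 0 0.
  by move=> [y By <-]; have := graph_normal body e1 By; rewrite mul1r.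
have p2 p : S2 p -> nu p 0 0 < 0.
  by move=> [y By <-]; have := graph_normal body eN By; rewrite mulN1r oppr_gt0.
have SS : S1 `|` S2 `<=` Sigma by move=> p [] [y By <-]; exact: graph_boundary.
have Fi := surface_C0_integrable body mu_area CF.
have m1 := graph_measurable e1; have m2 := graph_measurable eN.
rewrite /Rintegral; congr fine.
transitivity (\int[mu]_(p in S1 `|` S2) (F p)%:E)%E.
  rewrite -[in RHS](setIidr SS) [RHS]integral_mkcondr; apply: eq_integral => p; rewrite inE => Sp.
  rewrite patchE; case: ifPn => //; rewrite notin_setE => nSp.
  have [n0|n0|n0] := ltgtP (nu p 0 0) 0.
  - by exfalso; apply: nSp; right; apply: mem_graph => //; rewrite mulN1r oppr_gt0.
  - by exfalso; apply: nSp; left; apply: mem_graph => //; rewrite mul1r.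
  - by rewrite /F n0 mulr0.
rewrite integral_setU_EFin//; last 2 first.
- by apply: (measurable_funS mS SS) (surface_C0_measurable (Omega := Omega) body CF).
- apply/disj_setPS => p [/p1 h1 /p2 h2]; by have := lt_trans h1 h2; rewrite ltxx.
rewrite (graph_integral e1) (graph_integral eN) -integralD//; last 2 first.
- exact: height_integrable.
- exact: height_integrable.
by apply: eq_integral => y _; rewrite -EFinD mulrDr.
Qed.

Lemma fiber_measure y :
  lebesgue_measure [set t : measurableTypeR R | Omega (point t y)] =
  (\1_(base Omega) y * (height Omega 1 y + height Omega (-1) y))%:E.
Proof.
rewrite indicE; have [By|nBy] := pselect (base Omega y); last first.
  rewrite memNset// mul0r (_ : [set t | _] = set0) ?measure0//.
  by apply/seteqP; split => // t Ot; apply: nBy; exists t.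
rewrite mem_set// mul1r; set a := height Omega 1 y; set b := height Omega (-1) y.
have f1 t : Omega (point t y) -> fiber Omega 1 y t by rewrite /fiber /= mul1r.
have f2 t : Omega (point t y) -> fiber Omega (-1) y (- t) by rewrite /fiber /= mulrNN mul1r.
have lta t : Omega (point t y) -> t < a by move=> /f1; exact: fiber_lt.
have ltb t : Omega (point t y) -> - b < t by move=> /f2 /(fiber_lt body eN); rewrite ltrNl.
have [t0 Ot0] := By.
have -> : [set t : measurableTypeR R | Omega (point t y)] = [set` `]- b, a[].
  apply/seteqP; split=> t; rewrite /= in_itv /=.
    by move=> Ot; rewrite ltb// lta.
  move=> /andP[bt ta]; have [t0t|/ltW tt0] := leP t0 t.
    by have := fiber_between body (f1 _ Ot0) t0t ta; rewrite /fiber /= mul1r.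
  have := fiber_between body (s := - t) (f2 _ Ot0); rewrite lerN2 ltrNl => /(_ tt0 bt).
  by rewrite /fiber /= mulrNN mul1r.
have ab : - b < a := lt_trans (ltb _ Ot0) (lta _ Ot0).
by rewrite lebesgue_measure_itv /= lte_fin ab -EFinB opprK.
Qed.

Lemma volume_moment : volume Omega = \int[mu]_(p in Sigma) F p.
Proof.
rewrite boundary_moment /volume /=; congr fine.
pose f (z : measurableTypeR R * borel n) : \bar R := (\1_Omega (point z.1 z.2))%:E.
have mf : measurable_fun setT f.
  apply/measurable_EFinP.
  have mi : measurable_fun setT (\1_Omega : borel n.+1 -> R).
    by apply: measurable_indic; exact: borel_open.
  exact: (measurableT_comp mi (@measurable_row_mx R n)).
have f0 z : (0 <= f z)%E by rewrite lee_fin.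
transitivity (\int[lebesgue_measure]_t \int[lebesgue_rV n]_y f (t, y))%E.
  apply: eq_integral => t _; rewrite lebesgue_intE//.
  exact: (measurableT_comp mf (pair1_measurable t)).
rewrite (fubini_tonelli _ mf)//; apply: eq_integral => y _.
have mB : measurable [set t : measurableTypeR R | Omega (point t y)].
  have mp : measurable_fun setT (fun t : measurableTypeR R => point t y : borel n.+1).
    exact: (measurableT_comp (@measurable_row_mx R n) (pair2_measurable y)).
  by have := mp measurableT _ (borel_open oO); rewrite setTI.
rewrite -fiber_measure.
have -> : [set t : measurableTypeR R | Omega (point t y)] = [set t | Omega (point t y)] `&` setT.
  by rewrite setIT.
by rewrite -integral_indic.
Qed.

(** [volume_moment] computes the volume along the first coordinate and [moment_eq] transfers it to
    the others, whence the factor [n.+1]. *)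
Lemma volume_support : n.+1%:R * volume Omega = \int[mu]_(p in Sigma) Defs.support Omega p.
Proof.
have I l : mu.-integrable Sigma (EFin \o (fun p : 'rV[R]_n.+1 => p 0 l * nu p 0 l)).
  apply: surface_C0_integrable => //; apply: surface_Ck_mul.
    exact: surface_Ck_coord.
  exact: surface_Ck_normal.
transitivity (\int[mu]_(p in Sigma) \sum_l p 0 l * nu p 0 l); last first.
  by apply: eq_Rintegral => p _; rewrite /Defs.support dotE.
rewrite Rintegral_sum// volume_moment.
transitivity (\sum_(l < n.+1) \int[mu]_(p in Sigma) F p).
  by rewrite sumr_const card_ord mulr_natl.
by apply: eq_bigr => l _; exact: moment_eq.
Qed.

End Volume.

(** * Weighted Minkowski identities and stability *)

Section SecondOrder.
Context {R : realType}.
Implicit Types (a u q r : R).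

Lemma mean_value (f df : R -> R) x y : 0 < x -> 0 < y -> x != y ->
  (forall z : R, 0 < z -> is_derive z 1 f (df z)) ->
  exists2 t, 0 < t < 1 & f y - f x = df (x + t * (y - x)) * (y - x).
Proof.
wlog xy : x y / x < y => [H x0 y0 ne dh|].
  have [xy|yx|E] := ltgtP x y; [exact: H| |by rewrite E eqxx in ne].
  have [|t /andP[t0 t1] E] := H y x yx y0 x0 _ dh; first by rewrite eq_sym.
  exists (1 - t); first by apply/andP; split; lra.
  rewrite (_ : x + _ = y + t * (x - y)); last by ring.
  by rewrite -(opprB (f x)) E; ring.
move=> x0 _ _ dh; have [] := @MVT R f df x y xy.
- by move=> z; rewrite in_itv /= => /andP[xz _]; apply: dh; exact: lt_trans xz.
- apply: derivable_within_continuous => z; rewrite in_itv /= => /andP[xz _].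
  by apply: ex_derive; apply: dh; exact: lt_le_trans xz.
move=> z; rewrite in_itv /= => /andP[xz zy] E.
have d0 : 0 < y - x by rewrite subr_gt0.
exists ((z - x) / (y - x)).
  by rewrite divr_gt0 ?subr_gt0//= ltr_pdivrMr// mul1r ltrD2r.
by rewrite divfK ?gt_eqF// addrCA subrr addr0.
Qed.

(** Two mean values in place of a Taylor remainder. With a constant [c] for the second derivative,
    the error is [g2 z - c] times a positive factor. That [z < r] is strict even if [a] or [u]
    equals [r] is what makes [powR_gap2] strict. *)
Lemma second_order (g g1 g2 : R -> R) (c r a u : R) : 0 < a -> a <= r -> 0 < u -> u <= r -> u != a ->
  (forall z : R, 0 < z -> is_derive z 1 g (g1 z)) -> (forall z : R, 0 < z -> is_derive z 1 g1 (g2 z)) ->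
  exists z w, [/\ 0 < z, z < r, 0 < w &
    g u - g a - g1 a * (u - a) - c / 2 * (u - a) ^+ 2 = (g2 z - c) * w].
Proof.
move=> a0 ar u0 ur ua dg dg1.
pose h x := g x - g1 a * x - c / 2 * (x - a) ^+ 2.
have dh (z : R) : 0 < z -> is_derive z 1 h (g1 z - g1 a - c * (z - a)).
  move=> z0; have dgz := dg z z0.
  have d1 : is_derive z 1 (fun x : R => g1 a * x) (g1 a).
    by apply: is_derive_eq; rewrite /GRing.scale /= mulr1.
  have d2 : is_derive z 1 (fun x : R => c / 2 * (x - a) ^+ 2) (c * (z - a)).
    apply: is_derive_eq; rewrite /GRing.scale /= subr0 !mulr1.
    by field.
  have := is_deriveB (is_deriveB dgz d1) d2.
  by [].
have au : a != u by rewrite eq_sym.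
have [t /andP[t0 t1] hE] := mean_value a0 u0 au dh.
pose z := a + t * (u - a); have z0 : 0 < z.
  by rewrite /z (_ : _ + _ = (1 - t) * a + t * u); [rewrite addr_gt0// mulr_gt0// subr_gt0|ring].
have E1 : z - a = t * (u - a) by rewrite /z addrC addKr.
have az : a != z.
  by rewrite eq_sym -subr_eq0 E1 mulf_neq0 ?subr_eq0// gt_eqF.
have [t' /andP[t'0 t'1] gE] := mean_value a0 z0 az dg1.
exists (a + t' * (z - a)), (t * (u - a) ^+ 2); split.
- by rewrite (_ : _ + _ = (1 - t') * a + t' * z); [rewrite addr_gt0// mulr_gt0// subr_gt0|ring].
- have s0 : 0 < t' * t by rewrite mulr_gt0.
  have s1 : t' * t < 1 by rewrite -[ltRHS]mulr1 ltr_pM// ltW.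
  rewrite E1 mulrA (_ : _ + _ = (1 - t' * t) * a + t' * t * u); last by ring.
  have [lt|gt|/eqP] := ltgtP u a; last by rewrite (negbTE ua).
    apply: lt_le_trans ar; rewrite -subr_gt0 (_ : _ - _ = t' * t * (a - u)); last by ring.
    by rewrite mulr_gt0// subr_gt0.
  apply: lt_le_trans ur; rewrite -subr_gt0 (_ : _ - _ = (1 - t' * t) * (u - a)); last by ring.
  by rewrite mulr_gt0// subr_gt0.
- by rewrite mulr_gt0// exprn_even_gt0//= subr_eq0.
transitivity (h u - h a); first by rewrite /h; ring.
by rewrite hE -/z gE E1; ring.
Qed.

Lemma powR_primitive q : exists f : R -> R, forall x : R, 0 < x -> is_derive x 1 f (x `^ (q - 1)).
Proof.
have [->|q0] := eqVneq q 0.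
  exists (@ln R) => x x0; rewrite sub0r powR_inv1 ?ltW//; exact: is_derive1_ln.
exists (fun x => q^-1 * x `^ q) => x x0.
have := is_deriveZ q^-1 (is_derive1_powR q x0).
rewrite (_ : q^-1 *: (q * _) = x `^ (q - 1)); last by rewrite /GRing.scale /= mulKf.
by [].
Qed.

Lemma powR_decreasing q (x y : R) : q < 0 -> 0 < x -> x < y -> y `^ q < x `^ q.
Proof.
move=> q0 x0 xy; have y0 := lt_trans x0 xy.
rewrite -[q]opprK !(powRN _ (- q)) ltf_pV2 ?posrE ?powR_gt0//.
by apply: gt0_ltr_powR; rewrite ?oppr_gt0// nnegrE ltW.
Qed.

Section Primitive.
Variables (q r : R) (f : R -> R).
Hypotheses (q1 : -1 <= q) (q2 : q < 1).
Hypothesis f_primitive : forall x : R, 0 < x -> is_derive x 1 f (x `^ (q - 1)).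

(** [x f x] has the derivatives [f x + x ^ q] and [(q + 1) x ^ (q - 1)], the latter nonincreasing.
    The inequality is weak: at [q = -1] the expression is [0]. *)
Lemma powR_gap1 a u : 0 < a -> a <= r -> 0 < u -> u <= r ->
  0 <= u * f u - a * f a - (f a + a `^ q) * (u - a) - (q + 1) * r `^ (q - 1) / 2 * (u - a) ^+ 2.
Proof.
move=> a0 ar u0 ur; have [->|ua] := eqVneq u a; first by rewrite !subrr expr0n !mulr0 !subr0.
have dF (z : R) : 0 < z -> is_derive z 1 (fun x => x * f x) (f z + z `^ q).
  move=> z0; have := is_deriveM (is_derive_id z 1) (f_primitive z0).
  rewrite (_ : _ *: _ + _ = f z + z `^ q)//.
  have E : z * z `^ (q - 1) = z `^ q.
    by rewrite -{1}(powRr1 (ltW z0)) -powRD ?(gt_eqF z0) ?implybT// addrCA subrr addr0.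
  by rewrite /GRing.scale /= mulr1 E addrC.
have dG (z : R) : 0 < z -> is_derive z 1 (fun x => f x + x `^ q) ((q + 1) * z `^ (q - 1)).
  move=> z0; have := is_deriveD (f_primitive z0) (is_derive1_powR q z0).
  by have -> : (q + 1) * z `^ (q - 1) = z `^ (q - 1) + q * z `^ (q - 1) by ring.
have [z [w [z0 zr w0 ->]]] := second_order ((q + 1) * r `^ (q - 1)) a0 ar u0 ur ua dF dG.
rewrite -mulrBr mulr_ge0 ?(ltW w0)// mulr_ge0 ?subr_ge0//; first by rewrite -lerBlDr sub0r.
by apply/ltW/powR_decreasing => //; rewrite subr_lt0.
Qed.

(** Strict because [1 - q > 0] and [x ^ (q - 2)] is strictly decreasing. *)
Lemma powR_gap2 b u : 0 < b -> b <= r -> 0 < u -> u <= r -> u != b ->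
  0 < f b - f u + b `^ (q - 1) * (u - b) - (1 - q) * r `^ (q - 2) / 2 * (u - b) ^+ 2.
Proof.
move=> b0 br u0 ur ub.
have dF (z : R) : 0 < z -> is_derive z 1 (fun x => - f x) (- z `^ (q - 1)).
  by move=> z0; apply: is_deriveN; exact: f_primitive.
have dG (z : R) : 0 < z -> is_derive z 1 (fun x => - x `^ (q - 1)) ((1 - q) * z `^ (q - 2)).
  move=> z0; have := is_deriveN (is_derive1_powR (q - 1) z0).
  by rewrite -mulNr opprB (_ : q - 1 - 1 = q - 2)//; ring.
have [z [w [z0 zr w0]]] := second_order ((1 - q) * r `^ (q - 2)) b0 br u0 ur ub dF dG.
rewrite opprK mulNr opprK [- f u + _]addrC => ->.
rewrite -mulrBr mulr_gt0// mulr_gt0 ?subr_gt0//.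
by apply: powR_decreasing => //; rewrite subr_lt0 (lt_trans q2)// ltr1n.
Qed.

End Primitive.

Section Tangents.
Variables (q : R) (f : R -> R).
Hypotheses (q1 : -1 <= q) (q2 : q < 1).
Hypothesis f_primitive : forall x : R, 0 < x -> is_derive x 1 f (x `^ (q - 1)).

(** [powR_gap2] without its quadratic term, [a + b] serving as an upper bound for both points. *)
Lemma primitive_lower_left a b : 0 < a -> 0 < b -> a `^ (q - 1) * (a - b) <= f a - f b.
Proof.
move=> a0 b0; have [->|ba] := eqVneq b a; first by rewrite !subrr mulr0.
have := powR_gap2 (r := a + b) q2 f_primitive a0 _ b0 _ ba.
rewrite lerDl lerDr => /(_ (ltW b0) (ltW a0)) /ltW h; rewrite -subr_ge0.
apply: le_trans h _; rewrite -subr_ge0.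
rewrite (_ : _ - _ = (1 - q) * (a + b) `^ (q - 2) / 2 * (b - a) ^+ 2); last by ring.
by rewrite mulr_ge0 ?sqr_ge0// divr_ge0// mulr_ge0 ?powR_ge0// subr_ge0 ltW.
Qed.

(** [powR_gap1] expanded at [b] and evaluated at [a], without its quadratic term, then divided by
    [a]. *)
Lemma primitive_lower_right a b : 0 < a -> 0 < b -> b `^ q * (1 - b / a) <= f a - f b.
Proof.
move=> a0 b0.
have := powR_gap1 (r := a + b) q1 q2 f_primitive b0 _ a0 _.
rewrite lerDl lerDr => /(_ (ltW a0) (ltW b0)) h.
rewrite -(ler_pM2l a0) -subr_ge0; apply: le_trans h _; rewrite -subr_ge0.
rewrite (_ : _ - _ = (q + 1) * (a + b) `^ (q - 1) / 2 * (a - b) ^+ 2).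
  by rewrite mulr_ge0 ?sqr_ge0// divr_ge0// mulr_ge0 ?powR_ge0// -lerBlDr sub0r.
by field; rewrite gt_eqF.
Qed.

End Tangents.

End SecondOrder.

(** * Weighted Minkowski formulas and the integrated Taylor inequality *)

Section Minkowski.
Context {R : realType} {n : nat} (Omega : set 'rV[R]_n.+1).
Variable mu : {measure set (@borel R n.+1) -> \bar R}.
Hypothesis body : convex_body Omega.
Let oO := body_open body.
Let cO := body_convex body.
Let O0 := body_neq0 body.
Let bO := body_bounded body.
Let sS := body_smooth body.
Notation Sigma := (boundary Omega).
Hypothesis mu_area : is_area_measure Sigma mu.
Let mS := measurable_boundary Omega.
Let u := Defs.support Omega.
Notation "'I f" := (\int[mu]_(p in Sigma) f p) (at level 10, f at level 8).
Implicit Types (f g : 'rV[R]_n.+1 -> R).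
Local Notation C0 f := (surface_Ck Omega 0 f).

Let intD f g : C0 f -> C0 g -> 'I (fun p => f p + g p) = 'I f + 'I g.
Proof. by move=> Cf Cg; rewrite RintegralD//; exact: surface_C0_integrable. Qed.

Let intZ c f : C0 f -> 'I (fun p => c * f p) = c * 'I f.
Proof. by move=> Cf; rewrite RintegralZl//; exact: surface_C0_integrable. Qed.

Lemma surface_C0_Hmean j : C0 (Hmean j Omega).
Proof.
apply: surface_Ck_mul; last exact: surface_Ck_cst.
exact: (surface_Ck_newton_sigma body 0 j).2.
Qed.

Lemma Hmean_gt0 j p : (j <= n)%N -> Sigma p -> 0 < Hmean j Omega p.
Proof.
move=> jn Sp; rewrite divr_gt0 ?ltr0n ?bin_gt0// sigma_gt0// => i.
exact: curvatures_gt0.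
Qed.

Hypothesis Omega0 : Omega 0.

Lemma support_gt0 p : Sigma p -> 0 < u p.
Proof.
move=> Sp; have [_ /(_ _ Omega0) + _] := normal_spec oO cO sS O0 Sp.
by rewrite sub0r dotNr oppr_lt0 dotC.
Qed.

Lemma surface_C0_support_comp (h dh : R -> R) : (forall x : R, 0 < x -> is_derive x 1 h (dh x)) ->
  C0 (h \o u).
Proof.
move=> dhP; apply: surface_C0_comp; first exact: surface_Ck_support.
move=> p Sp; apply/differentiable_continuous/derivable1_diffP.
by case: (dhP _ (support_gt0 Sp)).
Qed.

(** The divergence theorem for the field [h(u) X]. The gradient [dh(u) A X] of the weight gives the
    quadratic form, in which the normal part of [X] drops out; the common constant is
    [(j + 1) C(n, j + 1) = (n - j) C(n, j)]. *)
Lemma minkowski_weighted j (h dh ddh : R -> R) : (j < n)%N ->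
  (forall x : R, 0 < x -> is_derive x 1 h (dh x)) -> (forall x : R, 0 < x -> is_derive x 1 dh (ddh x)) ->
  'I (fun p => dh (u p) * newton_shape j Omega p (tangential_part Omega p)) =
  (j.+1 * 'C(n, j.+1))%:R * 'I (fun p => h (u p) * (u p * Hmean j.+1 Omega p - Hmean j Omega p)).
Proof.
move=> jn dhP ddhP.
have X l := has_gradient_coord Omega l.
have HX : has_differential Omega (fun p => p) (fun=> 1%:M).
  move=> l; have := X l; congr (has_gradient _ _ _); apply/funext => p.
  by apply/rowP => i; rewrite !mxE eqxx.
have Hu : has_gradient Omega (h \o u) (fun p => dh (u p) *: (p *m (Defs.shape Omega p)^T)).
  apply: (has_gradient_comp (has_gradient_support body)) => p Sp.
  have u0 := support_gt0 Sp; split; first exact: dhP.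
  apply/differentiable_continuous/derivable1_diffP.
  by case: (ddhP _ u0).
have HZ := has_differential_scale Hu HX.
pose c : R := (j.+1 * 'C(n, j.+1))%:R.
pose S p := newton_shape j Omega p (tangential_part Omega p).
have E p : Sigma p -> newton_divergence Omega j (fun p => (h \o u) p *: p)
    (fun p => (h \o u) p *: 1%:M + (dh (u p) *: (p *m (Defs.shape Omega p)^T))^T *m p) p =
    dh (u p) * S p + (- c) * (h (u p) * (u p * Hmean j.+1 Omega p - Hmean j Omega p)).
  move=> Sp; have kp i : 0 < curvatures Omega p 0 i by exact: curvatures_gt0.
  have pc := curvatures_spec body Sp.
  rewrite /newton_divergence !mulmxDl !mulmxDr !mxtraceD !dotDl -!scalemxAl -!scalemxAr mul1mx.
  rewrite -mulmxA mxtraceZ mxtrace_rank_one dot_rank_one mulmx1 !dotZl !dotZr.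
  set A := Defs.shape Omega p; set N := normal Omega p; set T := newton j Omega p.
  have nA : N *m A = 0 by exact: (normal_shape body Sp).
  have An : A *m N^T = 0 by have /(congr1 trmx) := nA; rewrite trmx_mul (shape_sym body Sp : A^T = A) trmx0.
  have AT : A *m T = T *m A by exact: newton_comm.
  have d0 : dot N (p *m A^T) = 0 by rewrite /dot trmx_mul trmxK mulmxA nA mul0mx mxE.
  have d1 : dot (p *m A *m T) N = 0.
    by rewrite -mulmxA AT /dot mulmxA -mulmxA An mulmx0 mxE.
  have SE : S p = dot (p *m T) (p *m A^T).
    rewrite /S /newton_shape /tangential_part -/A -/N -/T mulmxBl -scalemxAl nA scaler0 subr0.
    by rewrite dotBr dotZr d1 mulr0 subr0 -mulmxA AT mulmxA [RHS]/dot trmx_mul trmxK mulmxA.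
  (* The ambient trace gives [n + 1 - j] times [sigma j], and the normal term removes one, leaving
     [n - j]. *)
  rewrite d0 -SE (trace_newton pc kp (ltnW jn)) (normal_unit body Sp).
  have -> : dot p N = u p by [].
  have cE : c * Hmean j.+1 Omega p = j.+1%:R * sigma j.+1 (curvatures Omega p).
    by rewrite /c /Hmean natrM; field; rewrite pnatr_eq0 -lt0n bin_gt0.
  have cE' : c * Hmean j Omega p = (n%:R - j%:R) * sigma j (curvatures Omega p).
    rewrite /c /Hmean mul_bin_left natrM natrB 1?ltnW//; field.
    by rewrite pnatr_eq0 -lt0n bin_gt0 ltnW.
  rewrite [in RHS]mulNr [c * _]mulrCA [c * _]mulrBr cE' [c * _]mulrCA cE /=.
  by rewrite -[n.+1]addn1 natrD; ring.
have C1 : C0 (fun p => h (u p) * (u p * Hmean j.+1 Omega p - Hmean j Omega p)).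
  apply: surface_Ck_mul; first exact: surface_C0_support_comp dhP.
  apply: surface_Ck_sub; last exact: surface_C0_Hmean.
  by apply: surface_Ck_mul; [exact: surface_Ck_support|exact: surface_C0_Hmean].
have C2 : C0 (fun p => dh (u p) * S p).
  apply: surface_Ck_mul; first exact: surface_C0_support_comp ddhP.
  have CX l : C0 (fun p => p 0 l) by exact: surface_Ck_coord.
  have CN l : C0 (fun p => normal Omega p 0 l) by exact: surface_Ck_normal.
  have CV l : C0 (fun p => tangential_part Omega p 0 l).
    apply: (@surface_Ck_eq _ _ _ _ (fun p => p 0 l - u p * normal Omega p 0 l)).
      by move=> p _; rewrite !mxE.
    by apply: surface_Ck_sub => //; apply: surface_Ck_mul => //; exact: surface_Ck_support.
  apply: surface_Ck_dot => // l.
  apply: surface_Ck_mulmx => [a b|a b]; last exact: (surface_Ck_newton_sigma body 0 j).1.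
  apply: surface_Ck_mulmx => [a' b'|a' b']; first by rewrite ord1.
  exact: surface_Ck_shape.
have := surface_divergence body mu_area HZ (ltnW jn).
rewrite (@eq_Rintegral _ _ _ mu _ (fun p : 'rV[R]_n.+1 => dh (u p) * S p +
  (- c) * (h (u p) * (u p * Hmean j.+1 Omega p - Hmean j Omega p)))); last first.
  by move=> p; rewrite inE => /E.
rewrite intD//; last by apply: surface_Ck_mul => //; exact: surface_Ck_cst.
by rewrite intZ// mulNr => /eqP; rewrite subr_eq0 => /eqP.
Qed.

Variable r : R.
Hypothesis circ : is_circumscribed Sigma 0 r.

Lemma support_le p : Sigma p -> u p <= r.
Proof.
move=> Sp; apply: le_trans (dot_unit_le _ (normal_unit body Sp)) _.
by have := circ.1 p Sp; rewrite subr0.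
Qed.

Lemma ray_meets_boundary y : y != 0 -> exists2 s, 0 < s & Sigma (s *: y).
Proof.
move=> y0; have cy : (fun s : R => s *: y) @ (0 : R) --> (0 : 'rV[R]_n.+1).
  rewrite -[X in _ --> X](scale0r y); apply: cvgZl; exact: cvg_id.
have /cy [e /= e0 eO] : nbhs (0 : 'rV[R]_n.+1) Omega by exact: open_nbhs_nbhs.
have e2 : 0 < e / 2 by rewrite divr_gt0.
have [||t t1 St] := ray_boundary (y := (e / 2) *: y) oO bO.
- by apply: eO; rewrite /= sub0r normrN gtr0_norm// ltr_pdivrMr// ltr_pMr// ltr1n.
- by rewrite scaler_eq0 gt_eqF.
by exists (t * (e / 2)); [rewrite mulr_gt0// (lt_le_trans ltr01)|rewrite -scalerA].
Qed.

Lemma boundary_nonempty : exists p, Sigma p.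
Proof.
have [|s _ Ss] := ray_meets_boundary (y := delta_mx 0 0); last by eexists; exact: Ss.
by apply/eqP => /matrixP/(_ 0 0)/eqP; rewrite !mxE !eqxx oner_eq0.
Qed.

Lemma boundary_neq0 p : Sigma p -> p != 0.
Proof. by move=> /(boundaryP oO)[_ nOp]; apply/eqP => p0; apply: nOp; rewrite p0. Qed.

(* A point of Sigma at maximal distance from the origin has its position vector as
   normal direction, so the constant support function is that distance. *)
Lemma support_cst_sphere b : (forall p, Sigma p -> u p = b) -> is_centered_sphere Sigma.
Proof.
move=> ub.
have ce : {within Sigma, continuous (fun p : 'rV[R]_n.+1 => dot p p)}.
  apply: continuous_subspaceT => p; apply: continuous_dot; exact: cvg_id.
have [q /set_mem Sq qmax] := EVT_max_rV boundary_nonempty (boundary_compact oO bO) ce.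
have le_q p : Sigma p -> enorm p <= enorm q.
  by move=> Sp; rewrite /enorm ler_wsqrtr// qmax// inE.
have q0 := boundary_neq0 Sq.
have [_ _ /(_ q) Nq] := normal_spec oO cO sS O0 Sq.
have eq0 : 0 < enorm q by rewrite sqrtr_gt0 dot_gt0.
have E : enorm q = b.
  rewrite -(ub _ Sq) /u /Defs.support Nq//.
    by rewrite dotZr -sqr_enorm expr2 mulKf// gt_eqF.
  move=> z Oz; have zq := omega_enorm_le oO bO (ltW eq0) le_q Oz.
  rewrite dotBr subr_le0 -(sqr_enorm q) expr2.
  have := dot_unit_le z (v := (enorm q)^-1 *: q).
  rewrite dotZl dotZr dotZr -sqr_enorm expr2 mulKf ?gt_eqF// mulVf ?gt_eqF// => /(_ erefl).
  by rewrite ler_pdivrMl// dotC => /le_trans; apply; rewrite ler_pM2l.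
have SE p : Sigma p -> enorm p = b.
  move=> Sp; apply/le_anti; rewrite -{1}E le_q//= -(ub _ Sp).
  exact: dot_unit_le (normal_unit body Sp).
exists b; first by rewrite -E.
apply/seteqP; split => [p /SE//|x /= xb].
have b0 : 0 < b by rewrite -E.
have x0 : x != 0 by apply/eqP => x0; move: b0; rewrite -xb x0 /enorm dot0l sqrtr0 ltxx.
have [s s0 Ss] := ray_meets_boundary x0.
have := SE _ Ss; rewrite /enorm dotZl dotZr mulrA sqrtrM ?mulr_ge0 ?ltW//.
rewrite -expr2 sqrtr_sqr gtr0_norm// -/(enorm x) xb => /eqP.
rewrite -subr_eq0 -{2}[b]mul1r -mulrBl mulf_eq0 subr_eq0 (gt_eqF b0) orbF => /eqP s1.
by move: Ss; rewrite s1 scale1r.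
Qed.

Lemma surface_C0_int_gt0 f : C0 f -> (forall p, Sigma p -> 0 < f p) -> 0 < 'I f.
Proof.
move=> Cf f0; have [p Sp] := boundary_nonempty.
rewrite lt0r; apply/andP; split.
  apply/eqP => E; have := f0 p Sp.
  by rewrite (surface_C0_eq0 body mu_area Cf (fun p Sp => ltW (f0 p Sp)) E Sp) ltxx.
by apply: Rintegral_ge0 => p' Sp'; exact/ltW/f0.
Qed.

Let CH j : C0 (Hmean j Omega).
Proof. exact: surface_C0_Hmean. Qed.
Let CZ c f : C0 f -> C0 (fun p => c * f p).
Proof. by move=> Cf; apply: surface_Ck_mul => //; exact: surface_Ck_cst. Qed.
Let CuH j : C0 (fun p => u p * Hmean j Omega p).
Proof. by apply: surface_Ck_mul; [exact: surface_Ck_support|exact: CH]. Qed.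

Lemma minkowski j : (j < n)%N -> 'I (Hmean j Omega) = 'I (fun p => u p * Hmean j.+1 Omega p).
Proof.
move=> jn; have d (c x : R) : 0 < x -> is_derive x 1 (cst c) (cst 0 x : R).
  by move=> _; exact: is_derive_cst.
have := minkowski_weighted (h := cst 1) (dh := cst 0) (ddh := cst 0) jn (d 1) (d 0).
under eq_Rintegral do rewrite /= mul0r.
under [in X in _ = _ * X -> _]eq_Rintegral do rewrite /= mul1r.
rewrite Rintegral_cst// mul0r => /esym/eqP; rewrite mulf_eq0 pnatr_eq0 muln_eq0 /= -leqn0 leqNgt bin_gt0 jn /=.
under eq_Rintegral do rewrite -mulN1r.
by rewrite intD//; [rewrite intZ// mulN1r subr_eq0 => /eqP ->|exact: CZ].
Qed.

(** [b] is the mean of [u] for the weight [Hmean j Omega]. By [minkowski], the case of [j + 1]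
    bounds the ratio of two consecutive integrals. *)
Lemma Hmean_ratio_bounds j : (j <= n)%N ->
  let b := 'I (fun p => u p * Hmean j Omega p) / 'I (Hmean j Omega) in 0 < b <= r.
Proof.
move=> jn; have h0 p : Sigma p -> 0 < Hmean j Omega p by move=> Sp; exact: Hmean_gt0.
have I0 := surface_C0_int_gt0 (@CH j) h0.
rewrite /= divr_gt0//=; last first.
  by apply: surface_C0_int_gt0 => // p Sp; rewrite mulr_gt0 ?h0 ?support_gt0.
rewrite ler_pdivrMr// -intZ// -subr_ge0 -mulN1r -intZ//.
rewrite -intD; [|exact: CZ|by apply: CZ].
apply: Rintegral_ge0 => p Sp; rewrite mulN1r -mulrBl mulr_ge0 ?subr_ge0 ?support_le//.
exact/ltW/h0.
Qed.

Let C_lin c f1 f2 : C0 f1 -> C0 f2 -> C0 (fun p => f1 p + c * f2 p).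
Proof. by move=> C1 C2; apply: surface_Ck_add => //; exact: CZ. Qed.

(** Linearity for the seven terms into which [phiE] splits the integrand. *)
Let int_lin c2 c3 c4 c5 c6 c7 f1 f2 f3 f4 f5 f6 f7 :
  C0 f1 -> C0 f2 -> C0 f3 -> C0 f4 -> C0 f5 -> C0 f6 -> C0 f7 ->
  'I (fun p => f1 p + c2 * f2 p + c3 * f3 p + c4 * f4 p + c5 * f5 p + c6 * f6 p + c7 * f7 p) =
  'I f1 + c2 * 'I f2 + c3 * 'I f3 + c4 * 'I f4 + c5 * 'I f5 + c6 * 'I f6 + c7 * 'I f7.
Proof.
have int2 c g1 g2 : C0 g1 -> C0 g2 -> 'I (fun p => g1 p + c * g2 p) = 'I g1 + c * 'I g2.
  by move=> C1 C2; rewrite intD ?intZ//; exact: CZ.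
move=> C1 C2 C3 C4 C5 C6 C7.
have D2 := C_lin (c := c2) C1 C2; have D3 := C_lin (c := c3) D2 C3; have D4 := C_lin (c := c4) D3 C4.
have D5 := C_lin (c := c5) D4 C5; have D6 := C_lin (c := c6) D5 C6.
by rewrite (int2 _ _ _ D6 C7) (int2 _ _ _ D5 C6) (int2 _ _ _ D4 C5) (int2 _ _ _ D3 C4)
  (int2 _ _ _ D2 C3) (int2 _ _ _ C1 C2).
Qed.

Section WeightedGap.
Variables (j : nat) (q : R) (f : R -> R).
Hypotheses (jn : (j < n)%N) (q1 : -1 <= q) (q2 : q < 1).
Hypothesis f_primitive : forall x : R, 0 < x -> is_derive x 1 f (x `^ (q - 1)).
Let I1 := 'I (Hmean j.+1 Omega).
Let I0 := 'I (Hmean j Omega).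
Let Im := 'I (fun p => u p * Hmean j Omega p).
Let a := I0 / I1.
Let b := Im / I0.
Let dev s i := 'I (fun p => (u p - s) ^+ 2 * Hmean i Omega p).
Let gap := newton_integral mu j.+1 Omega (1 - q) - ((f a - f b) * I0
  + (q + 1) * r `^ (q - 1) / 2 * dev a j.+1 + (1 - q) * r `^ (q - 2) / 2 * dev b j).
(** Taylor remainders at [a] and [b], diminished by the quadratic terms. By the choice of [a] and
    [b], the terms in [u - a] and [u - b] integrate to [0] against [H_{j+1}] and [H_j], so the
    weighted sum [phi] integrates to [gap]. *)
Let phi1 x := x * f x - a * f a - (f a + a `^ q) * (x - a) - (q + 1) * r `^ (q - 1) / 2 * (x - a) ^+ 2.
Let phi2 x := f b - f x + b `^ (q - 1) * (x - b) - (1 - q) * r `^ (q - 2) / 2 * (x - b) ^+ 2.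
Let phi p := phi1 (u p) * Hmean j.+1 Omega p + phi2 (u p) * Hmean j Omega p.

Let C_dev s i : C0 (fun p => (u p - s) ^+ 2 * Hmean i Omega p).
Proof.
apply: surface_Ck_mul => //.
apply: (@surface_Ck_eq _ _ _ _ (fun p => (u p - s) * (u p - s))) => [p _|]; first by rewrite expr2.
have Cs : C0 (fun p => u p - s).
  by apply: surface_Ck_sub; [exact: surface_Ck_support|exact: surface_Ck_cst].
exact: surface_Ck_mul.
Qed.

Let Cf : C0 (fun p => f (u p) * (u p * Hmean j.+1 Omega p - Hmean j Omega p)).
Proof.
apply: surface_Ck_mul; first exact: surface_C0_support_comp f_primitive.
exact: (surface_Ck_sub (@CuH _) (@CH _)).
Qed.

Let phiE p : phi p = f (u p) * (u p * Hmean j.+1 Omega p - Hmean j Omega p) +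
  ((f a + a `^ q) * a - a * f a) * Hmean j.+1 Omega p +
  (- (f a + a `^ q)) * (u p * Hmean j.+1 Omega p) +
  (f b - b `^ (q - 1) * b) * Hmean j Omega p + b `^ (q - 1) * (u p * Hmean j Omega p) +
  (- ((q + 1) * r `^ (q - 1) / 2)) * ((u p - a) ^+ 2 * Hmean j.+1 Omega p) +
  (- ((1 - q) * r `^ (q - 2) / 2)) * ((u p - b) ^+ 2 * Hmean j Omega p).
Proof.
rewrite /phi /phi1 /phi2; move: (f (u p)) (f a) (f b) (a `^ q) (b `^ (q - 1)).
move: (r `^ (q - 1)) (r `^ (q - 2)) (u p) (Hmean _ _ _) (Hmean _ _ _); move: a b => a' b' *; ring.
Qed.

Let C_phi : C0 phi.
Proof.
rewrite (funext phiE).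
exact: (C_lin (C_lin (C_lin (C_lin (C_lin (C_lin Cf (@CH _)) (@CuH _)) (@CH _)) (@CuH _))
  (@C_dev _ _)) (@C_dev _ _)).
Qed.

Let I1_gt0 : 0 < I1.
Proof. by apply: surface_C0_int_gt0 => // p Sp; exact: Hmean_gt0. Qed.

Let I0_gt0 : 0 < I0.
Proof. by apply: surface_C0_int_gt0 => // p Sp; exact: (Hmean_gt0 (ltnW jn)). Qed.

Let a_bounds : 0 < a <= r.
Proof. by have := Hmean_ratio_bounds jn; rewrite -minkowski. Qed.

Let b_bounds : 0 < b <= r.
Proof. exact: Hmean_ratio_bounds (ltnW jn). Qed.

Let gapE : gap = 'I phi.
Proof.
under eq_Rintegral do rewrite phiE.
rewrite (int_lin _ _ _ _ _ _ Cf (@CH _) (@CuH _) (@CH _) (@CuH _) (@C_dev _ _) (@C_dev _ _)).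
have NE : newton_integral mu j.+1 Omega (1 - q) =
    'I (fun p => f (u p) * (u p * Hmean j.+1 Omega p - Hmean j Omega p)).
  have d (x : R) : 0 < x -> is_derive x 1 (fun x => x `^ (q - 1)) ((q - 1) * x `^ (q - 1 - 1)).
    by move=> x0; exact: is_derive1_powR.
  have := minkowski_weighted jn f_primitive d.
  rewrite /newton_integral /= -/u => E.
  have c0 : (j.+1 * 'C(n, j.+1))%:R != 0 :> R by rewrite pnatr_eq0 muln_eq0 /= -lt0n bin_gt0.
  apply: (mulfI c0); rewrite -E mulrA mulfV// mul1r.
  apply: eq_Rintegral => p _.
  by rewrite mulrC -powRN opprB.
rewrite -NE -minkowski// -/I0 -/I1 -/Im -/(dev a j.+1) -/(dev b j) /gap.
have aE : I0 = a * I1 by rewrite /a divfK// gt_eqF.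
have bE : Im = b * I0 by rewrite /b divfK// gt_eqF.
move: aE bE; clear -R; clearbody a b.
move: (newton_integral _ _ _ _) (dev _ _) (dev _ _) (r `^ (q - 1)) (r `^ (q - 2)) => N d1 d0 r1 r2.
move: (f a) (f b) (a `^ q) (b `^ (q - 1)) => fa fb aq bq.
by move: a b I1 I0 Im => a' b' i1 i0 im aE ->; rewrite [in LHS]aE [in RHS]aE; ring.
Qed.

Let phi1_ge0 p : Sigma p -> 0 <= phi1 (u p).
Proof.
have [a0 ar] := andP a_bounds; move=> Sp.
by apply: powR_gap1 => //; [exact: support_gt0|exact: support_le].
Qed.

Let phi2_gt0 p : Sigma p -> u p != b -> 0 < phi2 (u p).
Proof.
have [b0 br] := andP b_bounds; move=> Sp ub.
by apply: powR_gap2 => //; [exact: support_gt0|exact: support_le].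
Qed.

Let phi2_ge0 p : Sigma p -> 0 <= phi2 (u p).
Proof.
move=> Sp; have [E|/(phi2_gt0 Sp)/ltW//] := eqVneq (u p) b.
by rewrite /phi2 E !subrr expr0n !mulr0 addr0 subr0.
Qed.

Let phi_ge0 p : Sigma p -> 0 <= phi p.
Proof.
move=> Sp; rewrite addr_ge0// mulr_ge0 ?phi1_ge0 ?phi2_ge0//; apply/ltW/Hmean_gt0 => //.
exact: ltnW.
Qed.

Lemma weighted_gap_ge0 : 0 <= gap.
Proof. by rewrite gapE; apply: Rintegral_ge0 => p; exact: phi_ge0. Qed.

(** A nonnegative continuous integrand with integral [0] vanishes everywhere; strictness of [phi2]
    then forces [u = b]. *)
Lemma weighted_gap_eq0 : gap = 0 -> is_centered_sphere Sigma.
Proof.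
rewrite gapE => E; apply: (@support_cst_sphere b) => p Sp.
have := surface_C0_eq0 body mu_area C_phi phi_ge0 E Sp.
have [//|ub] := eqVneq (u p) b; rewrite /phi => /eqP; rewrite gt_eqF// ltr_wpDl//.
  by rewrite mulr_ge0 ?phi1_ge0//; exact/ltW/Hmean_gt0.
by rewrite mulr_gt0 ?phi2_gt0//; apply: Hmean_gt0 => //; exact: ltnW.
Qed.

End WeightedGap.

Lemma sphere_normal rho p : 0 < rho -> Sigma = [set x | enorm x = rho] -> Sigma p ->
  normal Omega p = rho^-1 *: p.
Proof.
move=> rho0 SE Sp; have ep : enorm p = rho by move: Sp; rewrite SE.
have [_ _ /(_ p) ->//] := normal_spec oO cO sS O0 Sp; first by rewrite ep.
  move=> z Oz; have zr : enorm z <= rho.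
    by apply: (omega_enorm_le oO bO (ltW rho0) _ Oz) => q; rewrite SE => ->.
  rewrite dotBr subr_le0 -(sqr_enorm p) ep expr2.
  have := dot_unit_le z (v := rho^-1 *: p).
  rewrite dotZl dotZr dotZr -sqr_enorm ep expr2 mulKf ?gt_eqF// mulVf ?gt_eqF// => /(_ erefl).
  by rewrite ler_pdivrMl// dotC => /le_trans; apply; rewrite ler_pM2l.
exact: boundary_neq0.
Qed.

Let dev s i := 'I (fun p => (u p - s) ^+ 2 * Hmean i Omega p).

(** [X] is a lower bound of [f a - f b] valid for every primitive, which removes [f] from the
    conclusion. The two parts of the theorem differ by [X] and by the sign of [q]. *)
Lemma weighted_stability j q X : (j < n)%N -> -1 <= q -> q < 1 ->
  let I1 := 'I (Hmean j.+1 Omega) in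
  let I0 := 'I (Hmean j Omega) in
  let Im := 'I (fun p => u p * Hmean j Omega p) in
  let a := I0 / I1 in
  let b := Im / I0 in
  (forall f : R -> R, (forall x : R, 0 < x -> is_derive x 1 f (x `^ (q - 1))) -> X <= f a - f b) ->
  let lhs := X * I0 + (q + 1) * r `^ (q - 1) / 2 * dev a j.+1
    + (1 - q) * r `^ (q - 2) / 2 * dev b j in
  let rhs := newton_integral mu j.+1 Omega (1 - q) in
  lhs <= rhs /\ (lhs = rhs -> is_centered_sphere Sigma).
Proof.
move=> jn q1 q2 I1 I0 Im a b hX lhs rhs.
have [f fP] := powR_primitive q.
have I0_ge0 : 0 <= I0 by apply: Rintegral_ge0 => p Sp; apply/ltW/Hmean_gt0 => //; exact: ltnW.
have le1 : X * I0 <= (f a - f b) * I0 by rewrite ler_wpM2r ?hX.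
have h0 := weighted_gap_ge0 jn q1 q2 fP.
have h1 := weighted_gap_eq0 jn q1 q2 fP.
rewrite -/I1 -/I0 -/Im -/a -/b -/rhs in h0 h1.
split; first by move: h0; rewrite subr_ge0; apply: le_trans; rewrite !lerD2r.
by move=> E; apply/h1/eqP; rewrite eq_le h0 andbT subr_le0 -E !lerD2r.
Qed.

Lemma sphere_integrals j rho : (j < n)%N -> 0 < rho -> Sigma = [set x | enorm x = rho] ->
  [/\ 'I (Hmean j Omega) = rho * 'I (Hmean j.+1 Omega),
      'I (fun p => u p * Hmean j Omega p) = rho * 'I (Hmean j Omega),
      (forall i, dev rho i = 0) &
      forall q, newton_integral mu j.+1 Omega q = 0].
Proof.
move=> jn rho0 SE.
have uE p : Sigma p -> u p = rho.
  move=> Sp; rewrite /u /Defs.support (sphere_normal rho0 SE Sp) dotZr -sqr_enorm.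
  by move: Sp; rewrite SE /= => ->; rewrite expr2 mulKf// gt_eqF.
have uH i : 'I (fun p => u p * Hmean i Omega p) = rho * 'I (Hmean i Omega).
  by rewrite -intZ//; apply: eq_Rintegral => p; rewrite inE => /uE ->.
split => [||i|q] //; first by rewrite -uH minkowski.
  rewrite -[RHS](mul0r ('I (Hmean i Omega))) -intZ//; apply: eq_Rintegral => p.
  by rewrite inE => /uE ->; rewrite subrr expr0n.
rewrite /newton_integral -[RHS](mulr0 (j.+1 * 'C(n, j.+1))%:R^-1); congr (_ * _).
rewrite -[RHS](mul0r ('I (Hmean j Omega))) -intZ//; apply: eq_Rintegral => p.
rewrite inE => Sp; have -> : tangential_part Omega p = 0.
  rewrite /tangential_part -/(u p) uE// (sphere_normal rho0 SE Sp) scalerA mulfV ?gt_eqF//.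
  by rewrite scale1r subrr.
by rewrite /newton_shape dot0r !mul0r.
Qed.

Lemma delta2_sqr i s : (i <= n)%N -> delta2 mu i Omega s ^+ 2 = dev s i.
Proof.
move=> i_n; rewrite sqr_sqrtr//; apply: Rintegral_ge0 => p Sp.
by rewrite mulr_ge0 ?sqr_ge0//; exact/ltW/Hmean_gt0.
Qed.

(** For [j = 0] the index is [-1], that is [Negz 0], and the volume enters; otherwise this is
    Minkowski's formula one degree lower. *)
Lemma Iint_sub2 j : (j < n)%N -> Iint mu Omega (j.+1%:Z - 2) = 'I (fun p => u p * Hmean j Omega p).
Proof.
case: j => [|j] jn.
  rewrite (_ : _ - _ = Negz 0)//= (volume_support body mu_area); apply: eq_Rintegral => p _.
  rewrite /Hmean /sigma (big_pred1 finset.set0) => [|J]; last by rewrite cards_eq0.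
  by rewrite big_set0 bin0 divr1 mulr1.
by rewrite (_ : _ - _ = j%:Z)/= ?minkowski 1?ltnW// -addn2 PoszD addrK.
Qed.

End Minkowski.

(** * The two families of stability inequalities *)

Theorem theorem4p7 (R : realType) (n k : nat) (Omega : set 'rV[R]_n.+1)
    (mu : {measure set (@borel R n.+1) -> \bar R}) (r : R)
    (n_ge1 : (1 <= n)%N) (k_ge1 : (1 <= k)%N) (k_le_n : (k <= n)%N)
    (Omega_open : open Omega) (Omega_nonempty : Omega !=set0)
    (Omega_bounded : bounded_set Omega)
    (Omega_convex : @convex_set R 'rV[R]_n.+1 Omega)
    (Sigma_smooth : smooth_hypersurface (boundary Omega))
    (Sigma_strictly_convex : strictly_convex Omega)
    (mu_area : is_area_measure (boundary Omega) mu)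
    (r_circumradius : is_circumscribed (boundary Omega) 0 r) :
  let I := Iint mu Omega in
  let I_k := I k%:Z in
  let I_k1 := I (k%:Z - 1) in
  let I_k2 := I (k%:Z - 2) in
  let delta_k := delta2 mu k Omega (I_k1 / I_k) in
  let delta_k1 := delta2 mu k.-1 Omega (I_k2 / I_k1) in
  (forall m : R, 0 <= m -> m < 1 ->
     let lhs := (I_k / I_k1) `^ (1 - m) * ((I_k1 ^+ 2 - I_k * I_k2) / I_k)
                + (m + 1) / (2 * r `^ (1 - m)) * delta_k ^+ 2
                + (1 - m) / (2 * r `^ (2 - m)) * delta_k1 ^+ 2 in
     let rhs := newton_integral mu k Omega (1 - m) in
     lhs <= rhs /\ (lhs = rhs <-> is_centered_sphere (boundary Omega))) /\
  (forall m : R, 0 <= m -> m <= 1 ->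
     let lhs := (I_k2 / I_k1) `^ (1 - m) * ((I_k1 ^+ 2 - I_k * I_k2) / I_k2)
                + (1 - m) / (2 * r `^ (m + 1)) * delta_k ^+ 2
                + (m + 1) / (2 * r `^ (m + 2)) * delta_k1 ^+ 2 in
     let rhs := newton_integral mu k Omega (m + 1) in
     lhs <= rhs /\ (lhs = rhs <-> is_centered_sphere (boundary Omega))).
Proof.
have body := ConvexBody n_ge1 Omega_open Omega_nonempty Omega_bounded Omega_convex
  Sigma_smooth Sigma_strictly_convex.
have Omega0 := circumcenter_inside Omega_open Omega_convex Sigma_smooth Omega_nonempty
  Omega_bounded r_circumradius.
case: k k_ge1 k_le_n => // j _ jn; rewrite [j.+1.-1]/=.
rewrite (_ : j.+1%:Z - 1 = j%:Z); last by rewrite -addn1 PoszD addrK.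
cbv zeta; rewrite (Iint_sub2 body mu_area Omega0 jn) !(delta2_sqr mu body)//; last exact: ltnW.
have WS := weighted_stability body mu_area Omega0 r_circumradius jn.
have SI := sphere_integrals body mu_area Omega0 jn.
have /andP[a0 ar] := Hmean_ratio_bounds body mu_area Omega0 r_circumradius jn.
have /andP[b0 br] := Hmean_ratio_bounds body mu_area Omega0 r_circumradius (ltnW jn).
rewrite -(minkowski body mu_area Omega0 jn) in a0 ar.
change (Iint mu Omega j.+1%:Z) with (\int[mu]_(p in boundary Omega) Hmean j.+1 Omega p).
change (Iint mu Omega j%:Z) with (\int[mu]_(p in boundary Omega) Hmean j Omega p).
have I1_gt0 : 0 < \int[mu]_(p in boundary Omega) Hmean j.+1 Omega p.
  by apply: surface_C0_int_gt0 => // [|p Sp]; [exact: surface_C0_Hmean|exact: Hmean_gt0].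
have I0_gt0 : 0 < \int[mu]_(p in boundary Omega) Hmean j Omega p.
  apply: surface_C0_int_gt0 => // [|p Sp]; first exact: surface_C0_Hmean.
  by apply: Hmean_gt0 => //; exact: ltnW.
move: a0 ar b0 br I1_gt0 I0_gt0 SI WS => /=.
set I1 := \int[mu]_(p in _) Hmean j.+1 Omega p.
set I0 := \int[mu]_(p in _) Hmean j Omega p.
set Im := \int[mu]_(p in _) (Defs.support Omega p * Hmean j Omega p).
move=> a0 ar b0 br I1_gt0 I0_gt0 SI WS.
have r0 : 0 < r := lt_le_trans a0 ar.
have bE : Im / I0 * I0 = Im by rewrite divfK ?gt_eqF.
pose d1 := \int[mu]_(p in boundary Omega) ((Defs.support Omega p - I0 / I1) ^+ 2 * Hmean j.+1 Omega p).
pose d0 := \int[mu]_(p in boundary Omega) ((Defs.support Omega p - Im / I0) ^+ 2 * Hmean j Omega p).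
(* Converse of the equality case: on a centred sphere both ratios equal the radius, the deviations
   and the right-hand side vanish, and so does the first term. *)
have sphere q X : (I0 / I1 = Im / I0 -> X = 0) -> is_centered_sphere (boundary Omega) ->
    X * I0 + (q + 1) * r `^ (q - 1) / 2 * d1 + (1 - q) * r `^ (q - 2) / 2 * d0 =
    newton_integral mu j.+1 Omega (1 - q).
  move=> X0 [rho rho0 SE]; have [E1 E0 dE NE] := SI rho rho0 SE.
  have Ea : I0 / I1 = rho by rewrite E1 mulfK// gt_eqF.
  have Eb : Im / I0 = rho by rewrite E0 mulfK// gt_eqF.
  by rewrite NE /d1 /d0 Ea Eb !dE X0 ?Ea ?Eb// mul0r !mulr0 !addr0.
have coef (c t : R) : c / (2 * r `^ t) = c * r `^ (- t) / 2.
  by rewrite powRN; field; rewrite gt_eqF// powR_gt0.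
split => m m0 m1.
(* With [q = m], the bound from the tangent of [- f] at [a]; times [I0] it is the first term of
   (i). *)
- pose X := (I0 / I1) `^ (m - 1) * (I0 / I1 - Im / I0).
  have [||f fP|le1 eq1] := WS m X.
  + lra.
  + lra.
  + by apply: (@primitive_lower_left _ m) => //; lra.
  have first_term : (I1 / I0) `^ (1 - m) * ((I0 ^+ 2 - I1 * Im) / I1) = X * I0.
    rewrite /X -[I1 / I0]invf_div -powR_inv1 ?(ltW a0)// -powRrM mulN1r opprB -mulrA.
    by congr (_ * _); field; rewrite !gt_eqF.
  rewrite /= first_term !coef !opprB -/d1 -/d0; split => //; split => [/eq1//|].
  by apply: sphere => E; rewrite /X E subrr mulr0.
(* With [q = - m], the bound from the tangent of [x f x] at [b], divided by [a]; times [I0] it is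
   the first term of (ii). *)
- pose X := (Im / I0) `^ (- m) * (1 - (Im / I0) / (I0 / I1)).
  have [||f fP|le1 eq1] := WS (- m) X.
  + lra.
  + lra.
  + by apply: (@primitive_lower_right _ (- m)) => //; lra.
  have Im_gt0 : 0 < Im by rewrite -bE mulr_gt0.
  have first_term : (Im / I0) `^ (1 - m) * ((I0 ^+ 2 - I1 * Im) / Im) = X * I0.
    rewrite /X powRD ?(gt_eqF b0) ?implybT// powRr1 ?(ltW b0)//.
    by move: (_ `^ (- m)) => B; field; rewrite !gt_eqF.
  have e1 : - (m + 1) = - m - 1 by ring.
  have e2 : - (m + 2) = - m - 2 by ring.
  have e3 : 1 - - m = m + 1 by rewrite opprK addrC.
  move: le1 eq1 (@sphere (- m) X); rewrite /= first_term !coef e1 e2 e3 [- m + 1]addrC -/d1 -/d0.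
  move=> le1 eq1 sph; split => //; split => [/eq1//|].
  by apply: sph => E; rewrite /X E divff ?gt_eqF// subrr mulr0.
Qed.
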